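(* Let $\beta>\alpha>-1$ be real numbers and define $g_0(z):=(1-z^2)^{-\frac{\beta-\alpha}{2}}$ for $z\in\Delta$. Then $$\mathbb{M}_{g_0}^2(\alpha,\beta)=\frac{1}{2^{\beta-\alpha}}\,\frac{\Gamma(\beta+2)}{\Gamma(\alpha+2)}\left[\frac{\Gamma(1+\alpha/2)}{\Gamma(1+\beta/2)}\right]^2,$$ where $\Gamma$ is the Gamma function.
   Context: $\Delta=\{z\in\mathbb{C}:|z|<1\}$; $\mathcal{A}(\Delta)$ is the set of analytic functions on $\Delta$. For $\alpha>-1$, the weighted Bergman space is ${\bf A}_{\alpha}^2=\{\phi\in\mathcal{A}(\Delta): \|\phi\|_{\alpha}^2:=(\alpha+1)\iint_{\Delta}|\phi(z)|^2(1-|z|^2)^{\alpha}\frac{dx\,dy}{\pi}<\infty\}$. For $\beta>\alpha>-1$, a function $g\in\mathcal{A}(\Delta)$ is a multiplier from ${\bf A}_\alpha^2$ to ${\bf A}_\beta^2$ if $\phi\mapsto g\phi$ is bounded from ${\bf A}_\alpha^2$ to ${\bf A}_\beta^2$; its multiplier norm is $\mathbb{M}_g(\alpha,\beta)=\|g\|_{{\bf M}_{\alpha,\beta}}:=\sup_{\phi\in{\bf A}_\alpha^2,\,\phi\neq0}\|g\phi\|_\beta/\|\phi\|_\alpha$, and $\mathbb{M}_g^2(\alpha,\beta)$ denotes its square. Powers are taken with the principal branch (value $1$ at $z=0$). *)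

(* Defs.v *)
From HB Require Import structures.
From mathcomp Require Import all_boot all_order all_algebra.
From mathcomp Require Import complex.
From mathcomp Require Import all_classical all_reals all_analysis.

Set Implicit Arguments.
Unset Strict Implicit.
Unset Printing Implicit Defensive.

Import Order.TTheory GRing.Theory Num.Theory.
Import numFieldNormedType.Exports.

Local Open Scope classical_set_scope.
Local Open Scope complex_scope.
Local Open Scope ring_scope.

(* The modulus of [z] as an element of [R]; the norm [`|z|] of the library
   takes its values in [R[i]]. *)
Definition cmod (R : realType) (z : R[i]) : R :=
  Num.sqrt (complex.Re z ^+ 2 + complex.Im z ^+ 2).

Definition unit_disk (R : realType) : set R[i] := [set z | cmod z < 1].

(* [derivable] over the scalar field [R[i]], hence complex differentiability. *)
Definition analytic_on_disk (R : realType) (f : R[i] -> R[i]) : Prop :=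
  forall z, unit_disk z -> @derivable R[i] (R[i]^o) (R[i]^o) f z 1.

(* Principal argument, with values in ]-pi, pi] for [w != 0]. *)
Definition carg (R : realType) (w : R[i]) : R :=
  if 0 <= complex.Im w then acos (complex.Re w / cmod w)
  else - acos (complex.Re w / cmod w).

Definition cexp (R : realType) (w : R[i]) : R[i] :=
  (expR (complex.Re w))%:C * (cos (complex.Im w) +i* sin (complex.Im w)).

Definition cLog (R : realType) (w : R[i]) : R[i] := ln (cmod w) +i* carg w.

(* Principal branch of [w ^ s], for [w != 0]. *)
Definition cpow (R : realType) (w : R[i]) (s : R) : R[i] :=
  cexp (s%:C * cLog w).

(* Values of functions outside the disk play no role. The result is [+oo]
   when the (nonnegative) integral diverges. *)
Definition bergman_normsq (R : realType) (alpha : R) (phi : R[i] -> R[i]) :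
    \bar R :=
  ((alpha + 1)%:E *
   \int[(@lebesgue_measure R \x @lebesgue_measure R)%E]_(p in
       [set p : R * R | unit_disk (p.1 +i* p.2)])
     (cmod (phi (p.1 +i* p.2)) ^+ 2
        * (1 - cmod (p.1 +i* p.2) ^+ 2) `^ alpha / pi)%:E)%E.

Definition bergman_norm (R : realType) (alpha : R) (phi : R[i] -> R[i]) :
    \bar R :=
  sqrte (bergman_normsq alpha phi).

Definition bergman_space (R : realType) (alpha : R) : set (R[i] -> R[i]) :=
  [set phi | analytic_on_disk phi /\ (bergman_normsq alpha phi < +oo)%E].

Definition is_multiplier (R : realType) (alpha beta : R) (g : R[i] -> R[i]) :
    Prop :=
  analytic_on_disk g /\
  exists C : R, forall phi, bergman_space alpha phi ->
    bergman_space beta (fun z => g z * phi z) /\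
    (bergman_norm beta (fun z => g z * phi z)%R
       <= C%:E * bergman_norm alpha phi)%E.

(* [phi != 0] in the Bergman space means that [phi] does not vanish
   identically on the disk. *)
Definition multiplier_norm (R : realType) (alpha beta : R)
    (g : R[i] -> R[i]) : \bar R :=
  ereal_sup [set (bergman_norm beta (fun z => g z * phi z)%R
                    / bergman_norm alpha phi)%E |
             phi in [set phi | bergman_space alpha phi /\
                               exists2 z, unit_disk z & phi z != 0]].

(* Euler's integral, for [0 < x]. *)
Definition Gamma (R : realType) (x : R) : R :=
  \int[@lebesgue_measure R]_(t in `]0, +oo[) (t `^ (x - 1) * expR (- t)).

Definition g0 (R : realType) (alpha beta : R) (z : R[i]) : R[i] :=
  cpow (1 - z ^+ 2) (- ((beta - alpha) / 2)).

(* Main.v *)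
(* The map z = tanh (w / 2) sends the strip |Im w| < pi/2 onto the disk. With
   w = x + i y and psi (w) = phi (z) (1 - z^2)^((alpha + 2) / 2), the squared
   norm of phi becomes (alpha + 1) / (4 pi) times the integral of
   cos(y)^alpha M(y), where M(y) is the integral over x of |psi (x + i y)|^2;
   multiplying phi by g0 and passing to beta keeps the same psi and only replaces
   cos^alpha by cos^beta. By Cauchy's theorem M is midpoint convex, so its
   symmetrization increases with |y|, whereas cos^(beta - alpha) decreases:
   Chebyshev's inequality gives the upper bound K = (beta + 1) J(beta) /
   ((alpha + 1) J(alpha)) for the ratio of the squared norms, where J(a) is the
   integral of cos^a over ]-pi/2, pi/2[. The functions (1 - z^2)^((e - alpha - 2) / 2),
   for which M is constant up to a factor 2^e, show that K is optimal as e -> 0.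
   Since (a + 1) J(a) J(a + 1) does not depend on a, K = J(alpha + 1) / J(beta + 1),
   and J(2 b - 1) = 2^(2 b - 1) Gamma(b)^2 / Gamma(2 b) turns this into the stated
   value. *)
Require Import Defs.
From mathcomp Require Import all_boot all_order all_algebra.
From mathcomp Require Import complex.
From mathcomp Require Import all_classical all_reals all_analysis.
From mathcomp Require Import measurable_realfun.
From mathcomp Require Import ring lra.
Set Implicit Arguments.
Unset Strict Implicit.
Unset Printing Implicit Defensive.
Import Order.TTheory GRing.Theory Num.Theory.
Import numFieldNormedType.Exports.
Local Open Scope classical_set_scope.
Local Open Scope complex_scope.
Local Open Scope ring_scope.

(** * Complex differentiation *)

(** Let C = cosh x + cos y. At z = tanh (w / 2) one has 1 - |z|^2 = 2 cos y / C and |1 - z^2| = 2 /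
    C, and the Jacobian is C^-2, so (1 - |z|^2)^a dA becomes cos(y)^a |1 - z^2|^(a + 2) / 4. This is
    where the exponent (alpha + 2) / 2 and the constant 4 pi come from, and why |g0|^2 = |1 -
    z^2|^(alpha - beta) converts one weight into the other. The obstacle is that a general phi gives
    no decay of psi along the strip, so the vertical sides of the rectangles in Cauchy's theorem
    cannot be estimated pointwise. Only the integral over x of their bounds is known to be finite,
    by Tonelli; small values therefore occur at arbitrarily distant abscissas, and these are enough.
    This needs M locally integrable, which the finite norm provides because cos^alpha has a positive
    lower bound on compact subintervals. Continuity of M is not at hand: local integrability and
    midpoint convexity first give local boundedness, and the monotonicity of the symmetrization is
    then obtained from suprema alone. *)

Section ComplexDifferentiation.
Variable R : realType.
Implicit Types (z w h c : R[i]) (f g : R[i] -> R[i]) (x y e d : R).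

Lemma cmodE z : (cmod z)%:C = `|z|.
Proof. by rewrite normc_def. Qed.

Lemma cmod_ge0 z : 0 <= cmod z. Proof. exact: sqrtr_ge0. Qed.

Lemma cmodM z w : cmod (z * w) = cmod z * cmod w.
Proof. by apply/complexI; rewrite rmorphM /= !cmodE normrM. Qed.

Lemma cmodD z w : cmod (z + w) <= cmod z + cmod w.
Proof. by rewrite -lecR rmorphD /= !cmodE ler_normD. Qed.

Lemma cmodN z : cmod (- z) = cmod z.
Proof. by apply/complexI; rewrite !cmodE normrN. Qed.

Lemma cmodB z w : cmod (z - w) <= cmod z + cmod w.
Proof. by rewrite -(cmodN w) cmodD. Qed.

Lemma cmodBC z w : cmod (z - w) = cmod (w - z).
Proof. by rewrite -cmodN opprB. Qed.

Lemma cmod0 : cmod (0 : R[i]) = 0.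
Proof. by rewrite /cmod /= expr0n /= addr0 sqrtr0. Qed.

Lemma cmod1 : cmod (1 : R[i]) = 1.
Proof. by rewrite /cmod /= expr0n /= addr0 expr1n sqrtr1. Qed.

Lemma cmod_eq0 z : (cmod z == 0) = (z == 0).
Proof. by rewrite -(inj_eq (@complexI R)) cmodE normr_eq0. Qed.

Lemma cmod_gt0 z : (0 < cmod z) = (z != 0).
Proof. by rewrite lt0r cmod_ge0 andbT cmod_eq0. Qed.

Lemma cmodV z : cmod z^-1 = (cmod z)^-1.
Proof. by apply/complexI; rewrite fmorphV /= !cmodE normfV. Qed.

Lemma cmodR x : cmod x%:C = `|x|.
Proof. by rewrite /cmod /= expr0n /= addr0 sqrtr_sqr. Qed.

Lemma sqr_cmod z : cmod z ^+ 2 = complex.Re z ^+ 2 + complex.Im z ^+ 2.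
Proof. by rewrite sqr_sqrtr // addr_ge0 // sqr_ge0. Qed.

Lemma ler_Re_cmod z : `|complex.Re z| <= cmod z.
Proof. by rewrite -sqrtr_sqr ler_wsqrtr // lerDl sqr_ge0. Qed.

Lemma ler_Im_cmod z : `|complex.Im z| <= cmod z.
Proof. by rewrite -sqrtr_sqr ler_wsqrtr // lerDr sqr_ge0. Qed.

Lemma cmod_le_ReIm z : cmod z <= `|complex.Re z| + `|complex.Im z|.
Proof.
rewrite -ler_sqr ?nnegrE ?cmod_ge0 ?addr_ge0 // sqr_cmod sqrrD !real_normK ?num_real //.
by rewrite lerD2r lerDl mulrn_wge0 // mulr_ge0.
Qed.

Lemma lerB_cmod z w : cmod z - cmod w <= cmod (z - w).
Proof. by rewrite lerBlDr (le_trans _ (cmodD _ _)) // subrK. Qed.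

Lemma cmodJ z : cmod z^* = cmod z.
Proof. by apply/complexI; rewrite !cmodE normcJ. Qed.

(** Complex differentiability as a first-order expansion in real-valued moduli: there is no
    quotient, so [h = 0] is no exception, and no comparison takes place in [R[i]]. *)
Definition cdiff f z c : Prop := forall e, 0 < e -> exists2 d, 0 < d &
  forall h, cmod h < d -> cmod (f (z + h) - f z - c * h) <= e * cmod h.

Lemma cdiff_cst c z : cdiff (fun=> c) z 0.
Proof.
move=> e e0; exists 1 => // h _.
by rewrite subrr mul0r subr0 cmod0 mulr_ge0 ?cmod_ge0 ?ltW.
Qed.

Lemma cdiff_id z : cdiff id z 1.
Proof.
move=> e e0; exists 1 => // h _.
rewrite [X in cmod X](_ : _ = 0); last by ring.
by rewrite cmod0 mulr_ge0 ?cmod_ge0 ?ltW.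
Qed.

Lemma cdiff_ext f g z c d : 0 < d ->
  (forall h, cmod h < d -> f (z + h) = g (z + h)) -> cdiff f z c -> cdiff g z c.
Proof.
move=> d0 fg fz e e0; have [d' d'0 H] := fz e e0.
exists (Num.min d d'); first by rewrite lt_min d0.
move=> h; rewrite lt_min => /andP[hd hd'].
have := fg 0; rewrite addr0 cmod0 => /(_ d0) <-.
by rewrite -fg // H.
Qed.

Lemma cdiffD f g z a b : cdiff f z a -> cdiff g z b ->
  cdiff (fun w => f w + g w) z (a + b).
Proof.
move=> fz gz e e0.
have e20 : 0 < e / 2 by rewrite divr_gt0.
have [d d0 Hf] := fz _ e20; have [d' d'0 Hg] := gz _ e20.
exists (Num.min d d'); first by rewrite lt_min d0.
move=> h; rewrite lt_min => /andP[hd hd'].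
rewrite [X in cmod X](_ : _ = (f (z + h) - f z - a * h) + (g (z + h) - g z - b * h)); last by ring.
rewrite (le_trans (cmodD _ _)) // [e](splitr e) mulrDl lerD ?Hf ?Hg //.
Qed.

Lemma cdiff_cvg f z c : cdiff f z c -> forall e, 0 < e -> exists2 d, 0 < d &
  forall h, cmod h < d -> cmod (f (z + h) - f z) <= e.
Proof.
move=> fz e e0; have [d d0 H] := fz 1 ltr01.
have K0 : 0 < 1 + cmod c by rewrite ltr_pwDl ?cmod_ge0.
exists (Num.min d (e / (1 + cmod c))); first by rewrite lt_min d0 divr_gt0.
move=> h; rewrite lt_min ltr_pdivlMr // => /andP[hd he].
rewrite [X in cmod X](_ : _ = (f (z + h) - f z - c * h) + c * h); last by ring.
rewrite (le_trans (cmodD _ _)) // (le_trans (lerD (H _ hd) (lexx _))) //.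
by rewrite cmodM -mulrDl mulrC ltW.
Qed.

Lemma cdiff_comp f g z a b : cdiff g z a -> cdiff f (g z) b ->
  cdiff (fun w => f (g w)) z (b * a).
Proof.
move=> gz fz e e0.
have K0 : 0 < cmod a + 1 by rewrite ltr_wpDl ?cmod_ge0.
have B0 : 0 < cmod b + 1 by rewrite ltr_wpDl ?cmod_ge0.
(* The error splits into the error of [f] at the increment [k] of [g], where |k| <= (|a| + 1) |h|,
   and [b] times the error of [g]; [e1] and [e2] make each part at most e |h| / 2. *)
pose e1 := e / 2 / (cmod a + 1); have e10 : 0 < e1 by rewrite !divr_gt0.
pose e2 := e / 2 / (cmod b + 1); have e20 : 0 < e2 by rewrite !divr_gt0.
have [d1 d10 H1] := fz _ e10.
have [d2 d20 H2] := gz _ e20.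
have [d3 d30 H3] := gz _ (@ltr01 R).
exists (Num.min (Num.min d2 d3) (d1 / (cmod a + 1))).
  by rewrite !lt_min d20 d30 divr_gt0.
move=> h; rewrite !lt_min ltr_pdivlMr // => /andP[/andP[h2 h3] h1].
set k := g (z + h) - g z.
have kh : cmod k <= (cmod a + 1) * cmod h.
  rewrite (_ : k = (g (z + h) - g z - a * h) + a * h); last by rewrite /k; ring.
  rewrite (le_trans (cmodD _ _)) // addrC mulrDl mul1r cmodM lerD //.
  by rewrite (le_trans (H3 _ h3)) // mul1r.
have kd : cmod k < d1 by rewrite (le_lt_trans kh) // mulrC.
have gk : g z + k = g (z + h) by rewrite /k; ring.
have := H1 _ kd; rewrite gk => Hk.
rewrite [X in cmod X](_ : _ = (f (g (z + h)) - f (g z) - b * k)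
   + b * (g (z + h) - g z - a * h)); last by rewrite /k; ring.
rewrite (le_trans (cmodD _ _)) // [e in leRHS](splitr e) mulrDl lerD //.
  rewrite (le_trans Hk) // (le_trans (ler_wpM2l (ltW e10) kh)) //.
  by rewrite mulrA divfK ?gt_eqF.
rewrite cmodM (le_trans (ler_wpM2l (cmod_ge0 b) (H2 _ h2))) // mulrA.
rewrite ler_wpM2r ?cmod_ge0 // /e2 mulrA ler_pdivrMr // mulrC ler_wpM2l ?lerDl //.
by rewrite divr_ge0 // ltW.
Qed.

Lemma cdiff_sqr z : cdiff (fun w => w ^+ 2) z (2 * z).
Proof.
move=> e e0; exists e => // h he.
rewrite [X in cmod X](_ : _ = h * h); last by ring.
by rewrite cmodM ler_wpM2r ?cmod_ge0 // ltW.
Qed.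

Lemma cdiffZ f z a c : cdiff f z a -> cdiff (fun w => c * f w) z (c * a).
Proof.
move=> fz; apply: (@cdiff_comp (fun w => c * w)) => //.
move=> e e0; exists 1 => // h _.
rewrite [X in cmod X](_ : _ = 0); last by ring.
by rewrite cmod0 mulr_ge0 ?cmod_ge0 ?ltW.
Qed.

Lemma cdiffN f z a : cdiff f z a -> cdiff (fun w => - f w) z (- a).
Proof.
move=> fz e e0; have [d d0 H] := fz e e0; exists d => // h hd.
rewrite [X in cmod X](_ : _ = - (f (z + h) - f z - a * h)); last by ring.
by rewrite cmodN H.
Qed.

(* Polarization reduces products to squares and linear combinations. *)
Lemma cdiffM f g z a b : cdiff f z a -> cdiff g z b ->
  cdiff (fun w => f w * g w) z (a * g z + f z * b).
Proof.
move=> fz gz.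
have S := cdiff_comp (cdiffD fz gz) (cdiff_sqr _).
have D := cdiff_comp (cdiffD fz (cdiffN gz)) (cdiff_sqr _).
have := cdiffD (cdiffZ (4^-1) S) (cdiffN (cdiffZ (4^-1) D)).
rewrite (_ : 4^-1 * _ - _ = a * g z + f z * b); last by field.
apply: (cdiff_ext ltr01) => h _; by field.
Qed.

Lemma cdiff_inv z : z != 0 -> cdiff (fun w => w^-1) z (- z^-2).
Proof.
move=> z0 e e0.
have m0 : 0 < cmod z by rewrite cmod_gt0.
(* The remainder is exactly h^2 / ((z + h) z^2). The first radius gives |z + h| >= |z| / 2, and the
   second then bounds the remainder by e |h|. *)
exists (Num.min (cmod z / 2) (e * cmod z ^+ 3 / 2)).
  by rewrite lt_min !divr_gt0 ?mulr_gt0 ?exprn_gt0.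
move=> h; rewrite lt_min => /andP[h1 h2].
have zh : cmod z / 2 <= cmod (z + h).
  have := lerB_cmod z (- h); rewrite opprK cmodN.
  by lra.
have zh0 : z + h != 0 by rewrite -cmod_gt0 (lt_le_trans _ zh) // divr_gt0.
rewrite [X in cmod X](_ : _ = h * h / ((z + h) * z ^+ 2)); last first.
  by field; rewrite zh0 z0.
rewrite expr2 !cmodM cmodV !cmodM -mulrA mulrC ler_wpM2r ?cmod_ge0 //.
rewrite ler_pdivrMr ?mulr_gt0 ?cmod_gt0 // (le_trans (ltW h2)) //.
rewrite (_ : _ / 2 = e * (cmod z / 2 * (cmod z * cmod z))); last by field.
by rewrite ler_pM2l // ler_wpM2r // mulr_ge0 ?cmod_ge0.
Qed.

(** Schwarz reflection: conjugating before and after restores holomorphy. It makes the product used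
    in [rect_shift] holomorphic. *)
Lemma cdiff_reflect f z a : cdiff f z^* a -> cdiff (fun w => (f w^*)^*) z a^*.
Proof.
move=> fz e e0; have [d d0 H] := fz e e0; exists d => // h hd.
rewrite -[X in cmod X]conjcK cmodJ !rmorphB rmorphM /= !conjcK rmorphD /=.
by rewrite (le_trans (H _ _)) // cmodJ.
Qed.

Lemma derivable_cdiff f z : @derivable R[i] R[i]^o R[i]^o f z 1 ->
  exists c, cdiff f z c.
Proof.
move=> /cvg_ex[l /cvgrPdist_le fl]; exists l => e e0.
have := fl e%:C; rewrite -[0]/(0%:C) ltcR => /(_ e0) /nbhs_ballP[d /= d0 H].
(* Positivity in [R[i]] forces the imaginary part to vanish, so the radius is real. *)
have dE : d = (complex.Re d)%:C.
  by move: d0; rewrite ltcE => /andP[/eqP dI _]; case: (d) dI => a b /= ->.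
exists (complex.Re d); first by rewrite -ltcR -dE.
move=> h hd; have [->|h0] := eqVneq h 0.
  by rewrite addr0 mulr0 subrr subr0 cmod0 mulr0.
have := H h; rewrite /ball /= sub0r normrN -cmodE dE ltcR => /(_ hd h0).
rewrite -cmodE lecR => H1.
rewrite -ler_pdivrMr ?cmod_gt0 // -cmodV -cmodM (le_trans _ H1) //.
rewrite -cmodN le_eqVlt; apply/orP; left; apply/eqP; congr cmod.
have -> : h *: (1 : R[i]^o) = h by rewrite /GRing.scale /= mulr1.
rewrite /GRing.scale /= [h + z]addrC; field.
exact: h0.
Qed.

Lemma cdiff_derivable f z c : cdiff f z c -> @derivable R[i] R[i]^o R[i]^o f z 1.
Proof.
move=> fz; apply/cvg_ex; exists c; apply/cvgrPdist_le => e.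
rewrite ltcE => /andP[/eqP eI e0].
have eE : e = (complex.Re e)%:C by case: (e) eI => a b /= ->.
have [d d0 H] := fz _ e0.
apply/nbhs_ballP; exists d%:C => /=; first by rewrite -[0]/(0%:C) ltcR.
move=> h; rewrite /ball /= sub0r normrN -cmodE ltcR => hd h0.
rewrite eE -cmodE lecR.
rewrite -(@ler_pM2r _ (cmod h)) ?cmod_gt0 // (le_trans _ (H _ hd)) //.
rewrite -cmodM -[in leRHS]cmodN le_eqVlt; apply/orP; left; apply/eqP; congr cmod.
have -> : h *: (1 : R[i]^o) = h by rewrite /GRing.scale /= mulr1.
rewrite /GRing.scale /= [h + z]addrC; field.
exact: h0.
Qed.

End ComplexDifferentiation.

(** * Complex exponential, principal logarithm and powers *)

Section ComplexExpLog.
Variable R : realType.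
Implicit Types (z w h c : R[i]) (f g : R[i] -> R[i]) (x y e d s : R).

Lemma is_derive_littleo (f : R -> R) x l : is_derive x 1 f l ->
  forall e, 0 < e -> exists2 d, 0 < d &
    forall t, `|t| < d -> `|f (x + t) - f x - l * t| <= e * `|t|.
Proof.
move=> [/cvg_ex[k fk] fl] e e0.
have kl : k = l by rewrite -fl; apply/esym; exact: (cvg_lim _ fk).
subst k; move/cvgrPdist_le : fk => /(_ e e0) /nbhs_ballP[d /= d0 H].
exists d => // t td; have [->|t0] := eqVneq t 0.
  by rewrite addr0 mulr0 subrr subr0 normr0 mulr0.
have := H t; rewrite /ball /= sub0r normrN => /(_ td t0) H1.
rewrite -ler_pdivrMr ?normr_gt0 // -normfV -normrM (le_trans _ H1) //.
rewrite -normrN le_eqVlt; apply/orP; left; apply/eqP; congr (`|_|).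
have -> : t *: (1 : R^o) = t by rewrite /GRing.scale /= mulr1.
by rewrite /GRing.scale /= [t + x]addrC; field.
Qed.

Lemma cexpE x y : cexp (x +i* y) = expR x * cos y +i* (expR x * sin y).
Proof. by rewrite /cexp /=; simpc. Qed.

Lemma cexpD z w : cexp (z + w) = cexp z * cexp w.
Proof.
case: z w => [a b] [c d]; rewrite [_ + _]/= !cexpE expRD cosD sinD; simpc.
by congr (_ +i* _); ring.
Qed.

Lemma cmod_cexp z : cmod (cexp z) = expR (complex.Re z).
Proof.
case: z => x y; rewrite cexpE /cmod /= !exprMn -mulrDr cos2Dsin2 mulr1.
by rewrite sqrtr_sqr ger0_norm // expR_ge0.
Qed.

Lemma cexp0 : cexp (0 : R[i]) = 1.
Proof. by rewrite (cexpE 0 0) expR0 cos0 sin0 mulr1 mulr0. Qed.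

(** Only the origin is treated by hand, from the real expansions of [expR], [cos] and [sin]; the
    addition formula [cexpD] carries the result to every point. *)
Lemma cdiff_cexp0 : cdiff (@cexp R) 0 1.
Proof.
(* The linear errors add up to 3 k |h| <= e |h| / 2, and the product term is at most 6 |h|^2 <= e
   |h| / 2 once |h| < e / 12. *)
move=> e e0; pose k := Num.min 1 (e / 6).
have k0 : 0 < k by rewrite lt_min ltr01 divr_gt0.
have k1 : k <= 1 by rewrite ge_min lexx.
have ke : k <= e / 6 by rewrite ge_min lexx orbT.
have [d1 d10 H1] := is_derive_littleo (is_derive_expR 0) k0.
have [d2 d20 H2] := is_derive_littleo (is_derive_cos 0) k0.
have [d3 d30 H3] := is_derive_littleo (is_derive_sin 0) k0.
exists (Num.min (Num.min d1 d2) (Num.min d3 (e / 12))).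
  by rewrite !lt_min d10 d20 d30 divr_gt0.
move=> h; rewrite !lt_min => /andP[/andP[hd1 hd2] /andP[hd3 he]].
have Rh := ler_Re_cmod h; have Ih := ler_Im_cmod h.
set x := complex.Re h in Rh *; set y := complex.Im h in Ih *.
have {}H1 := H1 x (le_lt_trans Rh hd1).
have {}H2 := H2 y (le_lt_trans Ih hd2).
have {}H3 := H3 y (le_lt_trans Ih hd3).
rewrite !add0r expR0 mul1r in H1.
rewrite !add0r cos0 sin0 oppr0 mul0r subr0 in H2.
rewrite !add0r sin0 subr0 cos0 mul1r in H3.
have hE : h = x +i* y by rewrite /x /y; case: (h).
pose A := expR x - 1 - x; pose B := cos y - 1; pose S := sin y - y.
rewrite -/A in H1; rewrite -/B in H2; rewrite -/S in H3.
have -> : cexp (0 + h) - cexp 0 - 1 * h =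
   (A + x) %:C * (B +i* (S + y)) + A%:C + (B +i* S).
  rewrite cexp0 add0r mul1r hE cexpE; simpc.
  by congr (_ +i* _); rewrite /A /B /S; ring.
have c0 := cmod_ge0 h.
have HA : `|A| <= k * cmod h by rewrite (le_trans H1) // ler_wpM2l // ltW.
have HB : `|B| <= k * cmod h by rewrite (le_trans H2) // ler_wpM2l // ltW.
have HS : `|S| <= k * cmod h by rewrite (le_trans H3) // ler_wpM2l // ltW.
have HAx : cmod (A + x)%:C <= 2 * cmod h.
  by rewrite cmodR (le_trans (ler_normD _ _)) //; nra.
have HBS : cmod (B +i* (S + y)) <= 3 * cmod h.
  rewrite (le_trans (cmod_le_ReIm _)) //=.
  by have := ler_normD S y; nra.
rewrite (le_trans (cmodD _ _)) // (le_trans (lerD (cmodD _ _) (cmod_le_ReIm _))) //=.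
rewrite cmodM [cmod A%:C]cmodR.
have : cmod (A + x)%:C * cmod (B +i* (S + y)) <= 2 * cmod h * (3 * cmod h).
  by rewrite ler_pM ?cmod_ge0.
nra.
Qed.

Lemma cdiff_cexp z : cdiff (@cexp R) z (cexp z).
Proof.
have := cdiffZ (cexp z) cdiff_cexp0; rewrite mulr1 => H e e0.
have [d d0 {}H] := H e e0; exists d => // h /H.
by rewrite add0r cexp0 mulr1 -cexpD.
Qed.

Lemma carg_cos w : w != 0 -> cos (carg w) = complex.Re w / cmod w.
Proof.
rewrite -cmod_gt0 => w0.
have : -1 <= complex.Re w / cmod w <= 1.
  by rewrite -ler_norml normrM normfV (gtr0_norm w0) ler_pdivrMr // mul1r ler_Re_cmod.
move=> b; rewrite /carg; case: ifP => _; rewrite ?cosN acosK // in_itv.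
Qed.

Lemma carg_sin w : w != 0 -> sin (carg w) = complex.Im w / cmod w.
Proof.
rewrite -cmod_gt0 => w0.
have b : -1 <= complex.Re w / cmod w <= 1.
  by rewrite -ler_norml normrM normfV (gtr0_norm w0) ler_pdivrMr // mul1r ler_Re_cmod.
have E : Num.sqrt (1 - (complex.Re w / cmod w) ^+ 2) = `|complex.Im w| / cmod w.
  rewrite (_ : 1 - _ = (complex.Im w / cmod w) ^+ 2); last first.
    apply/eqP; rewrite subr_eq !expr_div_n sqr_cmod -mulrDl [X in X / _]addrC.
    by rewrite divff // -sqr_cmod gt_eqF // exprn_gt0.
  by rewrite sqrtr_sqr normrM normfV (gtr0_norm w0).
rewrite /carg; case: ifPn => [i0|]; first by rewrite sin_acos // E ger0_norm.
by rewrite -ltNge => i0; rewrite sinN sin_acos // E ltr0_norm // mulNr opprK.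
Qed.

Lemma cLogK w : w != 0 -> cexp (cLog w) = w.
Proof.
move=> w0; have m0 : 0 < cmod w by rewrite cmod_gt0.
rewrite cexpE lnK ?posrE // carg_cos // carg_sin // ![_ * (_ / _)]mulrC !divfK ?gt_eqF //.
by case: (w).
Qed.

(** When Re w > 0 the argument lies in ]-pi/2, pi/2[, where [tan] is inverted by [atan]. The single
    formula gives continuity across the real axis, which the case distinction in [carg] hides. *)
Lemma carg_atan w : 0 < complex.Re w -> carg w = atan (complex.Im w / complex.Re w).
Proof.
move=> r0; have w0 : w != 0 by apply: contraTneq r0 => ->; rewrite ltxx.
have m0 : 0 < cmod w by rewrite cmod_gt0.
rewrite -[LHS]tanK; last first.
  rewrite in_itv /=.
  have : 0 <= acos (complex.Re w / cmod w) < pi / 2.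
    have b : 0 < complex.Re w / cmod w <= 1.
      rewrite divr_gt0 //= ler_pdivrMr // mul1r (le_trans (ler_norm _)) //.
      exact: ler_Re_cmod.
    case/andP: b => b1 b2.
    have b3 : -1 <= complex.Re w / cmod w by rewrite (le_trans _ (ltW b1)) // lerN10.
    rewrite acos_ge0 ?b3 //= ltNge; apply/negP => h.
    have : cos (acos (complex.Re w / cmod w)) <= 0.
      rewrite -[X in cos X](subrK pi) cosDpi oppr_le0.
      apply: cos_ge0_pihalf; have := acos_lepi; move/(_ R (complex.Re w / cmod w)).
      rewrite b3 b2 => /(_ isT) p; move: h p; have := pi_gt0 R; lra.
    by rewrite acosK ?in_itv /= ?b3 // leNgt b1.
  by rewrite /carg => /andP[h1 h2]; case: ifP => _; have := pi_gt0 R; lra.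
congr atan; rewrite /tan carg_cos // carg_sin // invfM invrK mulrACA.
by rewrite [X in _ * X]mulrC mulfV ?gt_eqF // mulr1.
Qed.

Lemma cLog_cvg w : 0 < complex.Re w -> forall e, 0 < e -> exists2 d, 0 < d &
  forall h, cmod h < d -> cmod (cLog (w + h) - cLog w) <= e.
Proof.
move=> r0 e e0; have w0 : w != 0 by apply: contraTneq r0 => ->; rewrite ltxx.
have m0 : 0 < cmod w by rewrite cmod_gt0.
have rm : complex.Re w <= cmod w by rewrite (le_trans (ler_norm _)) // ler_Re_cmod.
have e20 : 0 < e / 2 by rewrite divr_gt0.
set r := complex.Re w in r0 rm *; set q := complex.Im w.
have [d1 /= d10 H1] : exists2 d : R, 0 < d & forall t, `|cmod w - t| < d -> `|ln (cmod w) - ln t| <= e / 2.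
  have /cvgrPdist_le/(_ _ e20)/nbhs_ballP[d /= d0 H] := continuous_ln m0.
  by exists d => // t /H.
have [d2 /= d20 H2] : exists2 d : R, 0 < d &
    forall t, `|q / r - t| < d -> `|atan (q / r) - atan t| <= e / 2.
  have /cvgrPdist_le/(_ _ e20)/nbhs_ballP[d /= d0 H] := @continuous_atan R (q / r).
  by exists d => // t /H.
(* The bound [r / 2] keeps the real part above half its value; the last one then moves the quotient
   Im / Re by less than [d2]. *)
exists (Num.min (Num.min d1 (r / 2)) (d2 * r ^+ 2 / (4 * cmod w))).
  by rewrite !lt_min d10 !divr_gt0 ?mulr_gt0 ?exprn_gt0.
move=> h; rewrite !lt_min => /andP[/andP[h1 h2]].
rewrite ltr_pdivlMr ?mulr_gt0 // => h3.
have Rh := ler_Re_cmod h; have Ih := ler_Im_cmod h; have c0 := cmod_ge0 h.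
have Iw := ler_Im_cmod w.
have rh : r / 2 < r + complex.Re h.
  have : - complex.Re h <= `|complex.Re h| by rewrite -normrN ler_norm.
  lra.
have rh0 : 0 < r + complex.Re h by rewrite (lt_trans _ rh) // divr_gt0.
have hE : complex.Re (w + h) = r + complex.Re h by rewrite /r; case: (w) (h) => [? ?] [].
have iE : complex.Im (w + h) = q + complex.Im h by rewrite /q; case: (w) (h) => [? ?] [].
have k1 : `|cmod w - cmod (w + h)| < d1.
  rewrite (le_lt_trans _ h1) // ler_norml.
  have := cmodD w h; have := lerB_cmod w (- h); rewrite opprK cmodN.
  by move=> ? ?; apply/andP; split; lra.
have k2 : `|q / r - (q + complex.Im h) / (r + complex.Re h)| < d2.
  rewrite (_ : _ - _ = (q * complex.Re h - r * complex.Im h) / (r * (r + complex.Re h)));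
    last by field; rewrite !gt_eqF.
  rewrite normrM normfV (@gtr0_norm _ (_ * _)) ?mulr_gt0 // ltr_pdivrMr ?mulr_gt0 //.
  apply: (@le_lt_trans _ _ (2 * cmod w * cmod h)).
    rewrite (le_trans (ler_normB _ _)) // !normrM (gtr0_norm r0).
    have : `|q| * `|complex.Re h| <= cmod w * cmod h by rewrite ler_pM.
    have : r * `|complex.Im h| <= cmod w * cmod h by rewrite ler_pM // ltW.
    lra.
  apply: (@le_lt_trans _ _ (cmod h * (4 * cmod w) / 2)); first by lra.
  rewrite (lt_le_trans (_ : _ < d2 * r ^+ 2 / 2)) ?ltr_pM2r //.
  by rewrite expr2 -!mulrA ler_pM2l // ler_pM2l // ltW.
rewrite (le_trans (cmod_le_ReIm _)) // [e]splitr.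
have -> : cLog (w + h) = ln (cmod (w + h)) +i* atan ((q + complex.Im h) / (r + complex.Re h)).
  by rewrite /cLog carg_atan ?hE // iE.
have -> : cLog w = ln (cmod w) +i* atan (q / r) by rewrite /cLog carg_atan.
by rewrite lerD //= distrC ?H1 ?H2.
Qed.

(** Derivative of an inverse function: with k = Log (w + h) - Log w, the expansion of the
    exponential at Log w reads h - w k = o(k), and continuity of the logarithm makes k small. *)
Lemma cdiff_cLog w : 0 < complex.Re w -> cdiff (@cLog R) w w^-1.
Proof.
move=> r0 e e0; have w0 : w != 0 by apply: contraTneq r0 => ->; rewrite ltxx.
have m0 : 0 < cmod w by rewrite cmod_gt0.
(* The first bound absorbs e1 |k| into |w| |k| and gives |k| <= 2 |h| / |w|; the second turns this
   into the final error e |h|. *)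
pose e1 := Num.min (cmod w / 2) (e * cmod w ^+ 2 / 2).
have e10 : 0 < e1 by rewrite lt_min !divr_gt0 ?mulr_gt0 ?exprn_gt0.
have [d1 d10 H1] := cdiff_cexp (cLog w) e10.
have d120 : 0 < d1 / 2 by rewrite divr_gt0.
have [d2 d20 H2] := cLog_cvg r0 d120.
exists (Num.min d2 (complex.Re w)); first by rewrite lt_min d20.
move=> h; rewrite lt_min => /andP[hd hr].
have wh0 : w + h != 0.
  rewrite -cmod_gt0; have := lerB_cmod w (- h); rewrite opprK cmodN.
  have : complex.Re w <= cmod w by rewrite (le_trans (ler_norm _)) // ler_Re_cmod.
  lra.
set k := cLog (w + h) - cLog w.
have kd : cmod k < d1 by rewrite (le_lt_trans (H2 _ hd)) // ltr_pdivrMr // ltr_pMr // ltr1n.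
have := H1 _ kd; rewrite (_ : cLog w + k = cLog (w + h)); last by rewrite /k; ring.
rewrite !cLogK // (_ : w + h - w = h); last by ring.
move=> Hk.
have Hk2 : cmod k <= 2 * (cmod h / cmod w).
  have : cmod w * cmod k <= cmod h + e1 * cmod k.
    rewrite -cmodM (_ : w * k = h - (h - w * k)); last by ring.
    by rewrite (le_trans (cmodB _ _)) // lerD2l.
  have : e1 * cmod k <= cmod w / 2 * cmod k by rewrite ler_wpM2r ?cmod_ge0 // ge_min lexx.
  move=> a b; rewrite mulrA ler_pdivlMr //; lra.
rewrite (_ : k - w^-1 * h = - (w^-1 * (h - w * k))); last by field.
rewrite cmodN cmodM cmodV mulrC ler_pdivrMr // (le_trans Hk) //.
apply: (@le_trans _ _ (e * cmod w ^+ 2 / 2 * (2 * (cmod h / cmod w)))).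
  by rewrite ler_pM ?cmod_ge0 ?(ltW e10) // ge_min lexx orbT.
by rewrite le_eqVlt; apply/orP; left; apply/eqP; field; rewrite gt_eqF.
Qed.

Lemma cdiff_cpow w s : 0 < complex.Re w -> exists c, cdiff (fun w => cpow w s) w c.
Proof.
move=> r0; eexists.
exact: (cdiff_comp (cdiffZ s%:C (cdiff_cLog r0)) (cdiff_cexp _)).
Qed.

Lemma cmod_cpow w s : w != 0 -> cmod (cpow w s) = cmod w `^ s.
Proof.
move=> w0; rewrite /cpow cmod_cexp /powR cmod_eq0 (negPf w0) /cLog.
by congr expR; simpc.
Qed.

(** Keeps 1 - z^2 in the right half-plane, away from the cut of the principal logarithm. *)
Lemma Re_1Bsqr z : unit_disk z -> 0 < complex.Re (1 - z ^+ 2).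
Proof.
move=> z1; have z21 : cmod z ^+ 2 < 1 by rewrite expr_lt1 // cmod_ge0.
rewrite (_ : complex.Re _ = 1 - (complex.Re z ^+ 2 - complex.Im z ^+ 2)).
  by move: z21; rewrite sqr_cmod; have := sqr_ge0 (complex.Im z); lra.
by case: (z) => x y; rewrite !expr2; simpc.
Qed.

Lemma Re_gt0_neq0 z : 0 < complex.Re z -> z != 0.
Proof. by apply: contraTneq => ->; rewrite ltxx. Qed.

Lemma cdiff_cpow_1Bsqr s z : unit_disk z ->
  exists c, cdiff (fun z => cpow (1 - z ^+ 2) s) z c.
Proof.
move=> /Re_1Bsqr/(cdiff_cpow s)[c cs]; eexists.
exact: (cdiff_comp (cdiffD (cdiff_cst 1 z) (cdiffN (cdiff_sqr z))) cs).
Qed.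

End ComplexExpLog.

(** * Measurability in the plane and substitution *)

Section PlaneMeasurability.
Variable R : realType.

(** An open set is the union of the squares with rational centre and radius 1 / (n + 1) that it
    contains. There are countably many of them, and each is measurable for the product
    sigma-algebra. *)
Lemma plane_open_measurable (U : set (R * R)) :
  (forall p, U p -> exists2 d, 0 < d &
     forall q, `|q.1 - p.1| < d -> `|q.2 - p.2| < d -> U q) ->
  measurable U.
Proof.
move=> oU.
pose box (i : rat * rat * nat) : set (R * R) :=
  [set q | `|q.1 - ratr i.1.1| < i.2.+1%:R^-1] `&`
  [set q | `|q.2 - ratr i.1.2| < i.2.+1%:R^-1].
have mbox i : measurable (box i).
  have m1 (f : R * R -> R) (c r : R) : measurable_fun setT f -> measurable [set q | `|f q - c| < r].
    move=> mf; rewrite -[X in measurable X]setTI.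
    have mg : measurable_fun setT (fun q => `|f q - c|).
      by apply: measurableT_comp => //; exact: measurable_funB.
    rewrite (_ : [set q | _] = (fun q => `|f q - c|) @^-1` `]-oo, r[); first exact: mg.
    by apply/seteqP; split => q /=; rewrite in_itv.
  by apply: measurableI; apply: m1.
rewrite (_ : U = \bigcup_i (if `[< box i `<=` U >] then box i else set0)); last first.
  apply/seteqP; split => [p Up|p [i _]]; last by case: asboolP => // H /H.
  have [d d0 H] := oU p Up.
  (* Half of [d], since two points of one square differ in each coordinate by less than twice its
     radius. *)
  have [n nd] : exists n, n.+1%:R^-1 < d / 2.
    have [n nd] := ltr_add_invr (divr_gt0 d0 (@ltr0Sn R 1)).
    by exists n; rewrite add0r in nd.
  have [r rE] : exists r : R, r = n.+1%:R^-1 by eexists.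
  have r0 : 0 < r by rewrite rE invr_gt0.
  rewrite -rE in nd.
  have itv0 (x : R) : x - r < x + r by rewrite ltrD2l gtrN.
  have [q1] := rat_in_itvoo (itv0 p.1).
  have [q2] := rat_in_itvoo (itv0 p.2).
  rewrite !in_itv /= => /andP[a1 a2] /andP[b1 b2].
  exists (q1, q2, n) => //; case: asboolP.
    by move=> _; rewrite /box -rE; split => /=; rewrite ltr_norml; apply/andP; split; lra.
  case=> q; rewrite /box -rE => -[/=]; rewrite !ltr_norml => /andP[? ?] /andP[? ?].
  by apply: H; rewrite ltr_norml; apply/andP; split; lra.
apply: countable_bigcupT_measurable => // i.
by case: asboolP.
Qed.

Lemma plane_continuous_measurable (U : set (R * R)) (f : R * R -> R) :
  (forall p, U p -> exists2 d, 0 < d &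
     forall q, `|q.1 - p.1| < d -> `|q.2 - p.2| < d -> U q) ->
  (forall p, U p -> forall e, 0 < e -> exists2 d, 0 < d &
     forall q, `|q.1 - p.1| < d -> `|q.2 - p.2| < d -> `|f q - f p| <= e) ->
  measurable_fun U f.
Proof.
move=> oU cf mU; apply: (measurability _ (RGenOInfty.measurableE R)) => //.
move=> _ [_ [x ->] <-]; apply: plane_open_measurable => p [Up].
rewrite /= in_itv /= andbT => xf.
have [d1 d10 H1] := oU p Up.
have e0 : 0 < (f p - x) / 2 by rewrite divr_gt0 // subr_gt0.
have [d2 d20 H2] := cf p Up _ e0.
exists (Num.min d1 d2); first by rewrite lt_min d10.
move=> q; rewrite !lt_min => /andP[a1 a2] /andP[b1 b2]; split; first exact: H1.
have := H2 _ a2 b2; rewrite ler_norml /= in_itv /= andbT => /andP[+ _].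
by move: xf; lra.
Qed.

End PlaneMeasurability.

(** * One-dimensional substitution for nonnegative integrands *)

Section Substitution.
Variable R : realType.
Let mu := @lebesgue_measure R.

(** Working on an open neighbourhood [A] of the segment supplies the one-sided limits at both
    endpoints. *)
Lemma integration_by_substitution_segment (A : set R) (F f G : R -> R) (a b : R) :
  a < b -> open A -> `[a, b] `<=` A ->
  (forall x, A x -> is_derive x 1 F (f x)) ->
  (forall x, A x -> {for x, continuous f}) ->
  (forall x, A x -> 0 < f x) ->
  (forall x, A x -> {for F x, continuous G}) ->
  (\int[mu]_(x in `[F a, F b]) (G x)%:E = \int[mu]_(x in `[a, b]) (G (F x) * f x)%:E)%E.
Proof.
move=> ab oA abA dF cf f0 cG.
have D1 x : A x -> F^`()%classic x = f x by move=> Ax; rewrite derive1E; have := dF x Ax => /@derive_val.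
have D1c x : A x -> {for x, continuous F^`()%classic}.
  move=> Ax; suff : F^`()%classic y @[y --> x] --> F^`()%classic x by [].
  rewrite (D1 x Ax); apply: cvg_trans (cf x Ax).
  apply: near_eq_cvg; near=> y; rewrite D1 //.
  by near: y; exact: open_nbhs_nbhs (conj oA Ax).
have cF x : A x -> {for x, continuous F}.
  move=> Ax; apply/differentiable_continuous/derivable1_diffP.
  by have := dF x Ax => /@ex_derive.
have aA : A a by apply: abA; rewrite /= in_itv /= lexx ltW.
have bA : A b by apply: abA; rewrite /= in_itv /= lexx ltW.
have oAb x : x \in `]a, b[ -> A x by move=> xab; apply: abA; exact: subset_itv_oo_cc.
have cFab : {within `[a, b], continuous F}.
  by apply: continuous_in_subspaceT => x /set_mem/abA; exact: cF.
have inc : {in `[a, b] &, {homo F : x y / x < y}}.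
  apply: gtr0_derive1_lt_cc => // x xab; last by rewrite D1 ?f0 //; exact: oAb.
  by have := dF x (oAb _ xab) => /@ex_derive.
rewrite (@integration_by_substitution_increasing _ F G a b) ?(ltW ab) //.
- apply: eq_integral => x /set_mem/abA Ax /=.
  by rewrite !fctE D1.
- by move=> x /oAb; exact: D1c.
- by apply/cvg_ex; exists (F^`()%classic a); apply: cvg_at_right_filter; exact: D1c.
- by apply/cvg_ex; exists (F^`()%classic b); apply: cvg_at_left_filter; exact: D1c.
- split.
  + by move=> x /oAb Ax; have := dF x Ax => /@ex_derive.
  + by apply: cvg_at_right_filter; exact: cF.
  + by apply: cvg_at_left_filter; exact: cF.
- apply: continuous_in_subspaceT => y /set_mem /= yF.
  have : exists2 x, x \in `[a, b] & F x = y.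
    apply: IVT => //; first exact: ltW.
    have Fab : F a < F b by apply: inc => //; rewrite in_itv /= lexx ltW.
    by rewrite (min_idPl (ltW Fab)) (max_idPr (ltW Fab)).
  by case=> x /abA /cG Gx <-.
Unshelve. all: by end_near. Qed.

(** Monotone convergence along the nested segments and along their images passes from segments to
    open sets, the value +oo included. *)
Lemma ge0_integration_by_substitution_exhaust (A B : set R) (a b : nat -> R) (F f G : R -> R) :
  open A -> open B -> A = \bigcup_n `[a n, b n]%classic ->
  (forall n, a n < b n) -> nonincreasing_seq a -> nondecreasing_seq b ->
  (forall x, A x -> is_derive x 1 F (f x)) ->
  (forall x, A x -> {for x, continuous f}) ->
  (forall x, A x -> 0 < f x) ->
  (forall x, A x -> B (F x)) -> (forall y, B y -> exists2 x, A x & F x = y) ->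
  (forall y, B y -> {for y, continuous G}) ->
  (forall y, B y -> 0 <= G y) ->
  (\int[mu]_(y in B) (G y)%:E = \int[mu]_(x in A) (G (F x) * f x)%:E)%E.
Proof.
move=> oA oB AE ab na nb dF cf f0 AB BA cG G0.
have abA n : `[a n, b n] `<=` A by move=> x xn; rewrite AE; exists n.
have cF x : A x -> {for x, continuous F}.
  move=> Ax; apply/differentiable_continuous/derivable1_diffP.
  by have := dF x Ax => /@ex_derive.
have D1 x : A x -> F^`()%classic x = f x by move=> Ax; rewrite derive1E; have := dF x Ax => /@derive_val.
have incF n : {in `[a n, b n] &, {homo F : x y / x < y}}.
  have oab x : x \in `]a n, b n[ -> A x by move=> xab; apply: (abA n); exact: subset_itv_oo_cc.
  apply: gtr0_derive1_lt_cc => // [x xab|x xab|].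
  - by have := dF x (oab _ xab) => /@ex_derive.
  - by rewrite D1 ?f0 //; exact: oab.
  - by apply: continuous_in_subspaceT => x /set_mem/abA; exact: cF.
have inA n : a n \in `[a n, b n] by rewrite in_itv /= lexx ltW.
have inB n : b n \in `[a n, b n] by rewrite in_itv /= lexx ltW.
have leF n x : x \in `[a n, b n] -> F (a n) <= F x <= F (b n).
  rewrite in_itv /= => /andP[]; rewrite le_eqVlt => /predU1P[<-|ax].
    by move=> _; rewrite lexx /=; apply: ltW; apply: (incF n).
  rewrite le_eqVlt => /predU1P[->|xb]; first by rewrite lexx andbT; apply: ltW; apply: (incF n).
  by apply/andP; split; apply: ltW; apply: (incF n) => //; rewrite in_itv /= (ltW ax) (ltW xb).
have BE : B = \bigcup_n `[F (a n), F (b n)]%classic.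
  apply/seteqP; split.
    move=> y /BA[x Ax <-]; move: Ax; rewrite {1}AE => -[n _ xn]; exists n => //=.
    by rewrite in_itv /= leF.
  move=> y [n _ /= yn].
  have : exists2 x, x \in `[a n, b n] & F x = y.
    apply: IVT; first exact: ltW.
      by apply: continuous_in_subspaceT => x /set_mem/abA; exact: cF.
    have Fab : F (a n) < F (b n) by apply: incF.
    by rewrite (min_idPl (ltW Fab)) (max_idPr (ltW Fab)).
  by case=> x /abA /AB Bx <-.
have mG : measurable_fun B (fun y => (G y)%:E).
  apply/measurable_EFinP; apply: open_continuous_measurable_fun => // y /set_mem; exact: cG.
have mGF : measurable_fun A (fun x => (G (F x) * f x)%:E).
  apply/measurable_EFinP; apply: open_continuous_measurable_fun => // x /set_mem Ax.
  by apply: continuousM; [apply: continuous_comp; [exact: cF|exact/cG/AB]|exact: cf].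
have ndA : nondecreasing_seq (fun n => `[a n, b n]%classic).
  move=> m n mn; apply/subsetPset => x /=; rewrite !in_itv /= => /andP[h1 h2].
  by rewrite (le_trans (na _ _ mn)) //= (le_trans h2) // nb.
have ndB : nondecreasing_seq (fun n => `[F (a n), F (b n)]%classic).
  move=> m n mn; apply/subsetPset => y /=; rewrite !in_itv /= => /andP[h1 h2].
  have /subsetPset sub := ndA _ _ mn.
  have /andP[g1 _] := leF n (a m) (sub _ (inA m)).
  have /andP[_ g2] := leF n (b m) (sub _ (inB m)).
  by rewrite (le_trans g1) //= (le_trans h2).
have LB : (\int[mu]_(y in `[F (a n), F (b n)]) (G y)%:E @[n --> \oo] --> \int[mu]_(y in B) (G y)%:E)%E.
  rewrite BE; apply: ge0_nondecreasing_set_cvg_integral => //.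
  - by move=> n; apply: measurable_funS mG => //; [exact: open_measurable|rewrite BE => y yn; exists n].
  - by move=> n y yn; rewrite lee_fin G0 // BE; exists n.
have LA : (\int[mu]_(x in `[a n, b n]) (G (F x) * f x)%:E @[n --> \oo] -->
    \int[mu]_(x in A) (G (F x) * f x)%:E)%E.
  rewrite AE; apply: ge0_nondecreasing_set_cvg_integral => //.
  - by move=> n; apply: measurable_funS mGF => //; exact: open_measurable.
  - by move=> n x /abA Ax; rewrite lee_fin; apply: mulr_ge0; [exact/G0/AB|exact/ltW/f0].
have E n : (\int[mu]_(y in `[F (a n), F (b n)]) (G y)%:E =
    \int[mu]_(x in `[a n, b n]) (G (F x) * f x)%:E)%E.
  by apply: (@integration_by_substitution_segment A) => // x /AB /cG.
rewrite (funext E) in LB.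
exact: (cvg_unique _ LB LA).
Qed.

Let exhaust_eps (e : R) : 0 < e -> exists n, n.+3%:R^-1 < e.
Proof.
move=> e0; have [k] := ltr_add_invr e0; rewrite add0r => ke; exists k.
by rewrite (le_lt_trans _ ke) // lef_pV2 ?posrE // ler_nat -(addn2 k.+1) leq_addr.
Qed.

Lemma ge0_integration_by_substitution_itvoo (a b : R) (B : set R) (F f G : R -> R) :
  a < b -> open B ->
  (forall x, x \in `]a, b[ -> is_derive x 1 F (f x)) ->
  (forall x, x \in `]a, b[ -> {for x, continuous f}) ->
  (forall x, x \in `]a, b[ -> 0 < f x) ->
  (forall x, x \in `]a, b[ -> B (F x)) ->
  (forall y, B y -> exists2 x, x \in `]a, b[ & F x = y) ->
  (forall y, B y -> {for y, continuous G}) ->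
  (forall y, B y -> 0 <= G y) ->
  (\int[mu]_(y in B) (G y)%:E = \int[mu]_(x in `]a, b[) (G (F x) * f x)%:E)%E.
Proof.
move=> ab oB dF cf f0 FB BF cG G0; pose c := b - a.
have c0 : 0 < c by rewrite subr_gt0.
(* Denominators start at 3 so that [a + c / (n + 3), b - c / (n + 3)] is nondegenerate already for n
   = 0. *)
have inv3 n : n.+3%:R^-1 <= 3^-1 :> R by rewrite lef_pV2 ?posrE // ler_nat.
have inv0 n : 0 < n.+3%:R^-1 :> R by rewrite invr_gt0.
have invle m n : (m <= n)%N -> n.+3%:R^-1 <= m.+3%:R^-1 :> R.
  by move=> mn; rewrite lef_pV2 ?posrE // ler_nat.
apply: (@ge0_integration_by_substitution_exhaust _ B
  (fun n => a + c * n.+3%:R^-1) (fun n => b - c * n.+3%:R^-1)) => //.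
- apply/seteqP; split => [x|x [n _]]; rewrite /= !in_itv /=.
    move=> /andP[ax xb].
    have m0 : 0 < Num.min (x - a) (b - x) / c by rewrite divr_gt0 // lt_min !subr_gt0 ax.
    have [n] := exhaust_eps m0; rewrite ltr_pdivlMr // lt_min => /andP[n1 n2].
    exists n => //=; rewrite in_itv /= [c * _]mulrC.
    by move: n1 n2; move: (_ * c) => t n1 n2; apply/andP; split; lra.
  move: (inv0 n) => i0 /andP[h1 h2].
  have p0 := mulr_gt0 c0 i0.
  by rewrite (lt_le_trans _ h1) ?(le_lt_trans h2) // ?ltrDl // gtrBl.
- move=> n; have := ler_wpM2l (ltW c0) (inv3 n).
  move: (c * n.+3%:R^-1) => t; rewrite -/c; have -> : b = a + c by rewrite /c; ring.
  lra.
- by move=> m n mn; rewrite lerD2l ler_wpM2l ?(ltW c0) // invle.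
- by move=> m n mn; rewrite lerD2l lerN2 ler_wpM2l ?(ltW c0) // invle.
Qed.

Lemma ge0_integration_by_substitution_setT (B : set R) (F f G : R -> R) :
  open B ->
  (forall x : R, is_derive x 1 F (f x)) -> continuous f -> (forall x, 0 < f x) ->
  (forall x, B (F x)) -> (forall y, B y -> exists x, F x = y) ->
  (forall y, B y -> {for y, continuous G}) ->
  (forall y, B y -> 0 <= G y) ->
  (\int[mu]_(y in B) (G y)%:E = \int[mu]_x (G (F x) * f x)%:E)%E.
Proof.
move=> oB dF cf f0 FB BF cG G0.
apply: (@ge0_integration_by_substitution_exhaust _ B
  (fun n => - n.+1%:R) (fun n => n.+1%:R)) => //.
- exact: openT.
- apply/seteqP; split => // x _.
  exists (Num.truncn `|x|) => //=; rewrite in_itv /= -ler_norml ltW //.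
  exact: truncnS_gt.
- by move=> n; rewrite gtrN.
- by move=> m n mn; rewrite lerN2 ler_nat.
- by move=> m n mn; rewrite ler_nat.
- by move=> x _; exact: cf.
- by move=> y /BF[x <-]; exists x.
Qed.

Lemma ge0_integration_by_substitution_itv0y (B : set R) (F f G : R -> R) :
  open B ->
  (forall x : R, 0 < x -> is_derive x 1 F (f x)) ->
  (forall x, 0 < x -> {for x, continuous f}) ->
  (forall x, 0 < x -> 0 < f x) ->
  (forall x, 0 < x -> B (F x)) -> (forall y, B y -> exists2 x, 0 < x & F x = y) ->
  (forall y, B y -> {for y, continuous G}) ->
  (forall y, B y -> 0 <= G y) ->
  (\int[mu]_(y in B) (G y)%:E = \int[mu]_(x in `]0%R, +oo[) (G (F x) * f x)%:E)%E.
Proof.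
move=> oB dF cf f0 FB BF cG G0.
have inE (x : R) : x \in `]0, +oo[ -> 0 < x by rewrite in_itv /= andbT.
have inv3 n : n.+3%:R^-1 < 1 :> R by rewrite invf_lt1 ?ltr1n.
have inv0 n : 0 < n.+3%:R^-1 :> R by rewrite invr_gt0.
apply: (@ge0_integration_by_substitution_exhaust _ B
  (fun n => n.+3%:R^-1) (fun n => n.+1%:R)) => //.
- apply/seteqP; split => [x /inE x0|x [n _]]; last first.
    by rewrite /= !in_itv /= andbT => /andP[+ _]; exact: lt_le_trans.
  have [n nx] := exhaust_eps x0.
  exists (maxn n (Num.truncn x)) => //=; rewrite in_itv /=; apply/andP; split.
    by rewrite (le_trans _ (ltW nx)) // lef_pV2 ?posrE // ler_nat !ltnS leq_maxl.
  by rewrite (le_trans (ltW (truncnS_gt x))) // ler_nat ltnS leq_maxr.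
- by move=> n; rewrite (lt_le_trans (inv3 n)) // ler1n.
- by move=> m n mn; rewrite lef_pV2 ?posrE // ler_nat.
- by move=> m n mn; rewrite ler_nat.
- by move=> x /inE; exact: dF.
- by move=> x /inE; exact: cf.
- by move=> x /inE; exact: f0.
- by move=> x /inE; exact: FB.
- by move=> y /BF[x x0 <-]; exists x => //=; rewrite in_itv /= x0.
Qed.

End Substitution.

(** * The strip model of the disk *)

Section RealCalculus.
Variable R : realType.
Implicit Types (f g : R -> R) (x y a b : R).

Lemma is_derive_continuous f x a : is_derive x 1 f a -> {for x, continuous f}.
Proof.
by move=> df; apply/differentiable_continuous/derivable1_diffP; exact: ex_derive.
Qed.

Lemma is_derive_div f g x a b : is_derive x 1 f a -> is_derive x 1 g b -> g x != 0 ->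
  is_derive x 1 (fun t => f t / g t) ((a * g x - f x * b) / g x ^+ 2).
Proof.
move=> df dg g0; have dV := is_deriveV g0 dg.
have -> : (fun t => f t / g t) = f * (fun t => (g t)^-1) by [].
by apply: is_derive_eq; rewrite /GRing.scale /=; field.
Qed.

Definition ch x : R := (expR x + expR (- x)) / 2.
Definition sh x : R := (expR x - expR (- x)) / 2.

Lemma is_derive_expRN x : is_derive x 1 (fun t => expR (- t)) (- expR (- x)).
Proof.
have -> : (fun t => expR (- t)) = expR \o (@GRing.opp R) by [].
by apply: is_derive_eq; rewrite mulrN1.
Qed.

Lemma is_derive_ch x : is_derive x 1 ch (sh x).
Proof.
have := is_derive_expRN x => d1.
have -> : ch = 2^-1 *: (expR \+ (fun t => expR (- t))).
  by apply/funext => t; rewrite /ch /= !fctE /GRing.scale /= mulrC.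
by apply: is_derive_eq; rewrite /sh /GRing.scale /= mulrC.
Qed.

Lemma is_derive_sh x : is_derive x 1 sh (ch x).
Proof.
have := is_derive_expRN x => d1.
have -> : sh = 2^-1 *: (expR - (fun t => expR (- t))).
  by apply/funext => t; rewrite /sh /= !fctE /GRing.scale /= mulrC.
by apply: is_derive_eq; rewrite /ch /GRing.scale /= opprK mulrC.
Qed.

Lemma ch2Bsh2 x : ch x ^+ 2 - sh x ^+ 2 = 1.
Proof. by rewrite -[RHS](expRxMexpNx_1 x) /ch /sh; field. Qed.

Lemma ch_ge1 x : 1 <= ch x.
Proof.
have : 0 < ch x by rewrite divr_gt0 // addr_gt0 // expR_gt0.
by have := ch2Bsh2 x; have := sqr_ge0 (sh x); nra.
Qed.

Lemma expR_chDsh x : expR x = ch x + sh x.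
Proof. by rewrite /ch /sh; field. Qed.

End RealCalculus.

(** * Real coordinates of the conformal map and of its partial inverse *)

Section StripCoordinates.
Variable R : realType.
Implicit Types (a b x y : R).

(* The conformal map [T w = (e^w - 1) / (e^w + 1)] of the strip
   [|Im w| < pi/2] onto the disk, in real coordinates. *)
Definition strip_re x y : R := sh x / (ch x + cos y).
Definition strip_im x y : R := sin y / (ch x + cos y).

Lemma cos_gt0_strip y : y \in `](- (pi / 2)), (pi / 2)[ -> 0 < cos y.
Proof. by rewrite in_itv => /cos_gt0_pihalf. Qed.

Lemma strip_den_gt0 x y : y \in `](- (pi / 2)), (pi / 2)[ -> 0 < ch x + cos y.
Proof. by move/cos_gt0_strip; have := ch_ge1 x; lra. Qed.

(** For z = T w the left side is 1 - |z|^2; its factor cos y is the source of the weights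
    cos(y)^a. *)
Lemma strip_normsq x y : y \in `](- (pi / 2)), (pi / 2)[ ->
  1 - strip_re x y ^+ 2 - strip_im x y ^+ 2 = 2 * cos y / (ch x + cos y).
Proof.
move=> /(strip_den_gt0 x) d0; rewrite /strip_re /strip_im.
have := ch2Bsh2 x; have := cos2Dsin2 y.
move: (sin y) (cos y) (sh x) (ch x) d0 => s c S C d0 e1 e2.
have -> : 1 - (S / (C + c)) ^+ 2 - (s / (C + c)) ^+ 2 =
    ((C + c) ^+ 2 - S ^+ 2 - s ^+ 2) / (C + c) ^+ 2 by field; rewrite gt_eqF.
have -> : S ^+ 2 = C ^+ 2 - 1 by rewrite -e2; ring.
have -> : s ^+ 2 = 1 - c ^+ 2 by rewrite -e1; ring.
by field; rewrite gt_eqF.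
Qed.

Lemma strip_disk x y : y \in `](- (pi / 2)), (pi / 2)[ ->
  strip_re x y ^+ 2 + strip_im x y ^+ 2 < 1.
Proof.
move=> yB; have : 0 < 1 - strip_re x y ^+ 2 - strip_im x y ^+ 2.
  rewrite strip_normsq // divr_gt0 ?strip_den_gt0 // mulr_gt0 //.
  exact: cos_gt0_strip.
by lra.
Qed.

(* [|1 - z^2| = 2 / (cosh x + cos y)], squared. *)
Lemma strip_1Bsqr x y : y \in `](- (pi / 2)), (pi / 2)[ ->
  (1 - strip_re x y ^+ 2 - strip_im x y ^+ 2) ^+ 2 + 4 * strip_im x y ^+ 2
  = 4 / (ch x + cos y) ^+ 2.
Proof.
move=> yB; rewrite strip_normsq // /strip_im.
have d0 := strip_den_gt0 x yB; have e := cos2Dsin2 y.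
transitivity (4 * (cos y ^+ 2 + sin y ^+ 2) / (ch x + cos y) ^+ 2).
  by field; rewrite gt_eqF.
by rewrite e mulr1.
Qed.

(** The left side is Re (1 - z^2), which is also the numerator of [arg_disk_deriv] up to a factor
    2. *)
Lemma strip_1Bsqr_re x y : y \in `](- (pi / 2)), (pi / 2)[ ->
  1 - strip_re x y ^+ 2 + strip_im x y ^+ 2
  = 2 * (1 + ch x * cos y) / (ch x + cos y) ^+ 2.
Proof.
move=> /(strip_den_gt0 x) d0; rewrite /strip_re /strip_im.
have := ch2Bsh2 x; have := cos2Dsin2 y.
move: (sin y) (cos y) (sh x) (ch x) d0 => s c S C d0 e1 e2.
have -> : 1 - (S / (C + c)) ^+ 2 + (s / (C + c)) ^+ 2 =
    ((C + c) ^+ 2 - S ^+ 2 + s ^+ 2) / (C + c) ^+ 2 by field; rewrite gt_eqF.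
have -> : S ^+ 2 = C ^+ 2 - 1 by rewrite -e2; ring.
have -> : s ^+ 2 = 1 - c ^+ 2 by rewrite -e1; ring.
by field; rewrite gt_eqF.
Qed.

Lemma strip_re_surj a y : y \in `](- (pi / 2)), (pi / 2)[ -> -1 < a < 1 ->
  exists x, strip_re x y = a.
Proof.
move=> yB /andP[a1 a2]; have c0 := cos_gt0_strip yB.
(* With E = e^x the equation [strip_re x y = a] becomes (1 - a) E^2 - 2 a c E - (1 + a) = 0; [s] is
   the square root of its reduced discriminant and [E] below is its positive root. *)
pose c := cos y; pose s := Num.sqrt (a ^+ 2 * c ^+ 2 + (1 - a ^+ 2)).
have p0 : 0 < 1 - a ^+ 2 by nra.
have s2 : s ^+ 2 = a ^+ 2 * c ^+ 2 + (1 - a ^+ 2).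
  by rewrite sqr_sqrtr //; apply: addr_ge0; [rewrite mulr_ge0 // sqr_ge0|exact: ltW].
have s0 : 0 <= s by rewrite sqrtr_ge0.
have ac : `|a * c| < s.
  by rewrite -ltr_sqr ?nnegrE // s2 real_normK ?num_real // exprMn ltrDl.
pose E := (a * c + s) / (1 - a).
have a10 : 0 < 1 - a by lra.
have E0 : 0 < E by rewrite divr_gt0 //; move: ac; rewrite ltr_norml => /andP[]; lra.
have EE : (1 - a) * E ^+ 2 - 2 * a * c * E - (1 + a) = 0.
  have -> : (1 - a) * E ^+ 2 - 2 * a * c * E - (1 + a) =
     (s ^+ 2 - a ^+ 2 * c ^+ 2 - (1 - a ^+ 2)) / (1 - a).
    by rewrite /E; field; rewrite gt_eqF.
  by rewrite s2; field; rewrite gt_eqF.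
exists (ln E); rewrite /strip_re.
have d0 := strip_den_gt0 (ln E) yB; move: d0.
rewrite /ch /sh expRN lnK ?posrE // -/c => d0.
apply/(mulIf (lt0r_neq0 d0)); rewrite divfK ?lt0r_neq0 //.
apply/eqP; rewrite -subr_eq0; apply/eqP.
transitivity (((1 - a) * E ^+ 2 - 2 * a * c * E - (1 + a)) / (2 * E)).
  by field; rewrite gt_eqF.
by rewrite EE mul0r.
Qed.

(* [arg_disk a b] is the ordinate [y] of the strip coordinates of [a + i b];
   [arg_inv a] inverts it on the vertical chord of abscissa [a]. *)
Definition arg_disk a b : R := atan (2 * b / (1 - a ^+ 2 - b ^+ 2)).
Definition arg_inv a y : R :=
  sin y * (1 - a ^+ 2) / (cos y + Num.sqrt (1 - a ^+ 2 * sin y ^+ 2)).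

Lemma arg_disk_itv a b : arg_disk a b \in `](- (pi / 2)), (pi / 2)[.
Proof. by rewrite in_itv /= atan_gtNpi2 atan_ltpi2. Qed.

(** The relation tan y = 2 b / (1 - a^2 - b^2) is quadratic in b, and [arg_inv] is its root in the
    disk, rationalized so that y = 0 is no exception. With L = |1 - z^2|, the cosine of y is m / L
    and the square root in [arg_inv] is Re (1 - z^2) / L. *)
Lemma arg_diskK a b : a ^+ 2 + b ^+ 2 < 1 -> arg_inv a (arg_disk a b) = b.
Proof.
move=> ab1; pose m := 1 - a ^+ 2 - b ^+ 2.
have m0 : 0 < m by rewrite /m; lra.
pose L := Num.sqrt (m ^+ 2 + 4 * b ^+ 2).
have L2 : L ^+ 2 = m ^+ 2 + 4 * b ^+ 2.
  by rewrite sqr_sqrtr // addr_ge0 ?sqr_ge0 // mulr_ge0 // sqr_ge0.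
have L0 : 0 < L.
  by rewrite sqrtr_gt0 ltr_pwDl ?exprn_gt0 // mulr_ge0 ?sqr_ge0.
have cE : cos (arg_disk a b) = m / L.
  rewrite cos_atan -/m (_ : 1 + _ = (L / m) ^+ 2); last first.
    by rewrite [in RHS]expr_div_n L2; field; rewrite gt_eqF.
  by rewrite sqrtr_sqr ger0_norm ?invf_div // divr_ge0 // ltW.
have sE : sin (arg_disk a b) = 2 * b / L.
  have := atanK (2 * b / m); rewrite /tan -/(arg_disk a b) cE.
  have cn0 : m / L != 0 by rewrite mulf_neq0 // ?invr_neq0 ?gt_eqF.
  move/(congr1 ( *%R^~ (m / L))); rewrite divfK // => ->.
  by field; rewrite !gt_eqF.
have n0 : 0 < 1 - a ^+ 2 + b ^+ 2 by have := sqr_ge0 b; rewrite /m in m0; lra.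
rewrite /arg_inv cE sE [X in Num.sqrt X](_ : _ = ((1 - a ^+ 2 + b ^+ 2) / L) ^+ 2); last first.
  rewrite !expr_div_n L2 /m; field.
  by rewrite gt_eqF // -[X in 0 < X]L2 exprn_gt0.
rewrite sqrtr_sqr ger0_norm ?divr_ge0 ?ltW // /m.
have q0 : 0 < 1 - a ^+ 2 by have := sqr_ge0 b; lra.
have q20 : 0 < 1 - a ^+ 2 - b ^+ 2 + (1 - a ^+ 2 + b ^+ 2) by lra.
by field; rewrite !gt_eqF // -mulrDl ?mulr_gt0 ?invr_gt0.
Qed.

Lemma arg_disk_strip x y : y \in `](- (pi / 2)), (pi / 2)[ ->
  arg_disk (strip_re x y) (strip_im x y) = y.
Proof.
move=> yB; rewrite /arg_disk strip_normsq //.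
have d0 := strip_den_gt0 x yB; have c0 := cos_gt0_strip yB.
rewrite -[RHS]tanK // /tan /strip_im; congr atan.
by field; rewrite !gt_eqF.
Qed.

Lemma arg_inv_strip x y : y \in `](- (pi / 2)), (pi / 2)[ ->
  arg_inv (strip_re x y) y = strip_im x y.
Proof.
by move=> yB; rewrite -{2}(arg_disk_strip x yB) arg_diskK // strip_disk.
Qed.

Lemma arg_inv_disk a y : y \in `](- (pi / 2)), (pi / 2)[ -> -1 < a < 1 ->
  a ^+ 2 + arg_inv a y ^+ 2 < 1 /\ arg_disk a (arg_inv a y) = y.
Proof.
move=> yB /(strip_re_surj yB)[x <-].
by rewrite arg_inv_strip // arg_disk_strip // strip_disk.
Qed.

Lemma is_derive_strip_re x y : y \in `](- (pi / 2)), (pi / 2)[ ->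
  is_derive x 1 (fun x => strip_re x y) ((1 + ch x * cos y) / (ch x + cos y) ^+ 2).
Proof.
move=> yB; have d0 := strip_den_gt0 x yB.
have dch := is_derive_ch x.
have dD : is_derive x 1 (fun t => ch t + cos y) (sh x).
  have -> : (fun t => ch t + cos y) = @ch R + cst (cos y) by [].
  by apply: is_derive_eq; rewrite addr0.
have d0' : ch x + cos y != 0 by rewrite gt_eqF.
have := is_derive_div (is_derive_sh x) dD d0'.
rewrite (_ : ch x * (ch x + cos y) - sh x * sh x = 1 + ch x * cos y) //.
by rewrite -[X in _ = X + _](ch2Bsh2 x); ring.
Qed.

Definition arg_disk_deriv a b : R :=
  2 * (1 - a ^+ 2 + b ^+ 2) / ((1 - a ^+ 2 - b ^+ 2) ^+ 2 + 4 * b ^+ 2).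

Lemma is_derive_arg_disk a b : a ^+ 2 + b ^+ 2 < 1 ->
  is_derive b 1 (arg_disk a) (arg_disk_deriv a b).
Proof.
move=> ab1; have m0 : 0 < 1 - a ^+ 2 - b ^+ 2 by lra.
have m0' : 1 - a ^+ 2 - b ^+ 2 != 0 by rewrite gt_eqF.
have dn : is_derive b 1 (fun b : R => 2 * b) 2.
  have -> : (fun b : R => 2 * b) = 2 *: (@id R) by [].
  by apply: is_derive_eq; rewrite /GRing.scale /= mulr1.
have dd : is_derive b 1 (fun b : R => 1 - a ^+ 2 - b ^+ 2) (- (2 * b)).
  have -> : (fun b : R => 1 - a ^+ 2 - b ^+ 2) = cst (1 - a ^+ 2) - (@id R) ^+ 2.
    by apply/funext => t; rewrite /= !fctE.
  by apply: is_derive_eq; rewrite /GRing.scale /= expr1 mulr1 sub0r.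
have dq := is_derive_div dn dd m0'.
have -> : arg_disk a = @atan R \o (fun b => 2 * b / (1 - a ^+ 2 - b ^+ 2)) by [].
apply: is_derive_eq; rewrite /arg_disk_deriv.
have L0 : 0 < (1 - a ^+ 2 - b ^+ 2) ^+ 2 + 4 * b ^+ 2.
  by rewrite ltr_pwDl ?exprn_gt0 // mulr_ge0 ?sqr_ge0.
by field; rewrite m0' gt_eqF //=.
Qed.

Lemma arg_disk_deriv_gt0 a b : a ^+ 2 + b ^+ 2 < 1 -> 0 < arg_disk_deriv a b.
Proof.
move=> ab1; have m0 : 0 < 1 - a ^+ 2 - b ^+ 2 by lra.
rewrite /arg_disk_deriv divr_gt0 ?mulr_gt0 //.
  by have := sqr_ge0 b; lra.
by rewrite ltr_pwDl ?exprn_gt0 // mulr_ge0 ?sqr_ge0.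
Qed.

(** The derivative in x at fixed y, divided by that of y along a vertical chord, is the Jacobian
    |T'(w)|^2 of the conformal map. *)
Lemma arg_disk_deriv_strip x y : y \in `](- (pi / 2)), (pi / 2)[ ->
  (1 + ch x * cos y) / (ch x + cos y) ^+ 2 /
    arg_disk_deriv (strip_re x y) (strip_im x y) = (ch x + cos y) ^- 2.
Proof.
move=> yB; have d0 := strip_den_gt0 x yB; have c0 := cos_gt0_strip yB.
have C1 := ch_ge1 x.
rewrite /arg_disk_deriv strip_1Bsqr // strip_1Bsqr_re //.
have n0 : 0 < 1 + ch x * cos y by rewrite ltr_pwDl // mulr_ge0 ?ltW // (lt_le_trans ltr01).
by field; rewrite !gt_eqF.
Qed.

End StripCoordinates.

(** * Change of variables from the disk to the strip *)

Section DiskIntegral.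
Variable R : realType.
Let mu := @lebesgue_measure R.

Lemma measurable_fun_inv d (T : measurableType d) (f : T -> R) :
  measurable_fun setT f -> measurable_fun setT (fun t => (f t)^-1).
Proof.
(* Reduces the inverse to the measurable [powR]; squaring makes the base nonnegative, and at a zero
   of [f] both sides are 0. *)
move=> mf; have -> : (fun t => (f t)^-1) = f \* (fun t => (f t ^+ 2) `^ (-1)).
  apply/funext => t /=; have [->|f0] := eqVneq (f t) 0.
    by rewrite invr0 mul0r.
  by rewrite powR_inv1 ?sqr_ge0 //; field.
apply: measurable_funM => //.
apply: (measurableT_comp (measurable_powR (-1))).
exact: measurable_funX.
Qed.

Definition plane_continuous_at (h : R * R -> R) (p : R * R) :=
  forall e, 0 < e -> exists2 d, 0 < d &
    forall q, `|q.1 - p.1| < d -> `|q.2 - p.2| < d -> `|h q - h p| <= e.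

Lemma plane_continuous_curve (h : R * R -> R) (u v : R -> R) (t : R) :
  plane_continuous_at h (u t, v t) -> {for t, continuous u} -> {for t, continuous v} ->
  {for t, continuous (fun t => h (u t, v t))}.
Proof.
move=> ch cu cv; apply/cvgrPdist_le => e e0.
have [d d0 H] := ch e e0.
have /cvgrPdist_lt /(_ d d0) cu' := cu.
have /cvgrPdist_lt /(_ d d0) cv' := cv.
near=> s; rewrite distrC; apply: H => /=; rewrite distrC.
  by near: s.
by near: s.
Unshelve. all: by end_near. Qed.

Lemma arg_inv_continuous_r (a y : R) : y \in `](- (pi / 2)), (pi / 2)[ -> -1 < a < 1 ->
  {for y, continuous (arg_inv a)}.
Proof.
move=> /cos_gt0_strip c0 a1; rewrite /arg_inv; apply: cvgM.
  by apply: cvgM; [exact: continuous_sin|exact: cvg_cst].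
apply: cvgV; first by rewrite gt_eqF // ltr_pwDl // sqrtr_ge0.
apply: cvgD; first exact: continuous_cos.
apply: (@continuous_comp _ _ _ (fun y => 1 - a ^+ 2 * sin y ^+ 2) Num.sqrt);
  last exact: sqrt_continuous.
apply: cvgB; first exact: cvg_cst.
apply: cvgM; first exact: cvg_cst.
by apply: (@continuous_comp _ _ _ sin (fun t => t ^+ 2)); [exact: continuous_sin|exact: exprn_continuous].
Qed.

Lemma arg_inv_continuous_l (a y : R) : y \in `](- (pi / 2)), (pi / 2)[ -> -1 < a < 1 ->
  {for a, continuous (fun a => arg_inv a y)}.
Proof.
move=> /cos_gt0_strip c0 a1; rewrite /arg_inv; apply: cvgM.
  apply: cvgM; first exact: cvg_cst.
  by apply: cvgB; [exact: cvg_cst|exact: exprn_continuous].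
apply: cvgV; first by rewrite gt_eqF // ltr_pwDl // sqrtr_ge0.
apply: cvgD; first exact: cvg_cst.
apply: (@continuous_comp R R R (fun a : R => 1 - a ^+ 2 * sin y ^+ 2) Num.sqrt);
  last exact: sqrt_continuous.
apply: cvgB; first exact: cvg_cst.
by apply: cvgM; [exact: exprn_continuous|exact: cvg_cst].
Qed.

Lemma measurable_arg_inv : measurable_fun setT (fun p : R * R => arg_inv p.1 p.2).
Proof.
have ms : measurable_fun setT (fun p : R * R => sin p.2).
  by apply: (measurableT_comp _ measurable_snd); apply: continuous_measurable_fun; exact: continuous_sin.
have mc : measurable_fun setT (fun p : R * R => cos p.2).
  by apply: (measurableT_comp _ measurable_snd); apply: continuous_measurable_fun; exact: continuous_cos.
have ma : measurable_fun setT (fun p : R * R => 1 - p.1 ^+ 2).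
  by apply: measurable_funB => //; exact: measurable_funX.
apply: measurable_funM; first exact: measurable_funM.
apply: measurable_fun_inv; apply: measurable_funD => //.
apply: (measurableT_comp (continuous_measurable_fun (@sqrt_continuous R))).
apply: measurable_funB => //; apply: measurable_funM; exact: measurable_funX.
Qed.

Lemma continuous_arg_disk_deriv (u v : R -> R) (t : R) : u t ^+ 2 + v t ^+ 2 < 1 ->
  {for t, continuous u} -> {for t, continuous v} ->
  {for t, continuous (fun t => arg_disk_deriv (u t) (v t))}.
Proof.
move=> uv1 cu cv.
have cX (w : R -> R) : {for t, continuous w} -> {for t, continuous (fun t => w t ^+ 2)}.
  by move=> cw; apply: (@continuous_comp _ _ _ w (fun t => t ^+ 2)) => //; exact: exprn_continuous.
have c1 : {for t, continuous (fun t => 1 - u t ^+ 2)}.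
  by apply: cvgB; [exact: cvg_cst|exact: cX].
rewrite /arg_disk_deriv; apply: cvgM.
  apply: cvgM; first exact: cvg_cst.
  by apply: cvgD => //; exact: cX.
apply: cvgV; last first.
  apply: cvgD; last by apply: cvgM; [exact: cvg_cst|exact: cX].
  by apply: (cX (fun t => 1 - u t ^+ 2 - v t ^+ 2)); apply: cvgB => //; exact: cX.
have m0 : 0 < 1 - u t ^+ 2 - v t ^+ 2 by lra.
by rewrite gt_eqF // ltr_pwDl ?exprn_gt0 // mulr_ge0 ?sqr_ge0.
Qed.

Let S : set R := `]- (pi / 2), pi / 2[%classic.

(** One coordinate is changed at a time, with Tonelli in between: on each chord of abscissa a the
    ordinate b is replaced by y, then at fixed y the abscissa a is replaced by x. The two
    derivatives combine in [arg_disk_deriv_strip]. *)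
Lemma disk_integral_strip (h : R * R -> R) :
  (forall p : R * R, 0 <= h p) -> measurable_fun setT h ->
  (forall p : R * R, p.1 ^+ 2 + p.2 ^+ 2 < 1 -> plane_continuous_at h p) ->
  (forall p : R * R, ~ p.1 ^+ 2 + p.2 ^+ 2 < 1 -> h p = 0) ->
  (\int[mu \x mu]_p (h p)%:E =
   \int[mu]_(y in S) \int[mu]_x (h (strip_re x y, strip_im x y) * (ch x + cos y) ^- 2)%:E)%E.
Proof.
move=> h0 mh hc hz.
pose I : set R := `]-1, 1[%classic.
have IE a : I a -> -1 < a < 1 by rewrite /I /= in_itv.
have a21 a : I a -> 0 < 1 - a ^+ 2 by move=> /IE /andP[]; nra.
have oS : open S by exact: interval_open.
have oI : open I by exact: interval_open.
have mS : measurable S by exact: open_measurable.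
have mI : measurable I by exact: open_measurable.
(* The integrand in the intermediate coordinates (a, y), divided by dy/db. *)
pose g a y := h (a, arg_inv a y) / arg_disk_deriv a (arg_inv a y).
have g0 a y : I a -> S y -> 0 <= g a y.
  move=> Ia Sy; rewrite /g divr_ge0 //; apply/ltW/arg_disk_deriv_gt0.
  by have [] := arg_inv_disk Sy (IE _ Ia).
(* Extension of [g] by 0 to the plane, where Tonelli is applied a second time. *)
pose k (p : R * R) : R := \1_I p.1 * \1_S p.2 * g p.1 p.2.
have k0 p : 0 <= k p.
  rewrite /k !indicE; case: (boolP (p.1 \in I)) => [/set_mem Ip|_]; last by rewrite !mul0r.
  case: (boolP (p.2 \in S)) => [/set_mem Sp|_]; last by rewrite mulr0 mul0r.
  by rewrite !mul1r g0.
have mk : measurable_fun setT k.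
  have mq := measurable_arg_inv.
  apply: measurable_funM.
    apply: measurable_funM; first by apply: (measurableT_comp (measurable_indic mI)).
    by apply: (measurableT_comp (measurable_indic mS)).
  apply: measurable_funM.
    by apply: (measurableT_comp mh); apply: measurable_fun_pair.
  apply: measurable_fun_inv; rewrite /arg_disk_deriv.
  have m1 : measurable_fun setT (fun p : R * R => 1 - p.1 ^+ 2).
    by apply: measurable_funB => //; exact: measurable_funX.
  have m2 : measurable_fun setT (fun p : R * R => arg_inv p.1 p.2 ^+ 2).
    exact: measurable_funX.
  apply: measurable_funM.
    by apply: measurable_funM => //; exact: measurable_funD.
  apply: measurable_fun_inv; apply: measurable_funD.
    by apply: measurable_funX; exact: measurable_funB.
  exact: measurable_funM.
have mhE : measurable_fun setT (EFin \o h) by exact/measurable_EFinP.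
have mkE : measurable_fun setT (EFin \o k) by exact/measurable_EFinP.
rewrite [LHS](@fubini_tonelli1 _ _ _ _ _ mu mu (EFin \o h) mhE); last by move=> p; rewrite lee_fin.
transitivity (\int[mu]_a \int[mu]_y (k (a, y))%:E)%E.
  apply: eq_integral => a _; rewrite /fubini_F /=.
  case: (boolP (a \in I)) => [/set_mem Ia|aI]; last first.
    rewrite integral0_eq ?integral0_eq // => b _.
      by rewrite /k /= indicE (negPf aI) !mul0r.
    rewrite hz //= => ab; move/negP: aI; apply; apply/mem_set.
    by rewrite /I /= in_itv /=; have := sqr_ge0 b; move: ab => /=; nra.
  pose r := Num.sqrt (1 - a ^+ 2).
  have r0 : 0 < r by rewrite sqrtr_gt0 a21.
  have r2 : r ^+ 2 = 1 - a ^+ 2 by rewrite sqr_sqrtr // ltW // a21.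
  have rE b : (b \in `]- r, r[) = (a ^+ 2 + b ^+ 2 < 1).
    by rewrite in_itv /= -ltr_norml -ltr_sqr ?nnegrE ?(ltW r0) // real_normK ?num_real // r2 ltrBrDl.
  transitivity (\int[mu]_(b in `](- r)%R, r[) (h (a, b))%:E)%E.
    rewrite [RHS]integral_mkcond; apply: eq_integral => b _; rewrite /patch.
    case: ifPn => // /negP bA; rewrite hz // => ab; apply: bA; apply/mem_set.
    by rewrite /= rE.
  transitivity (\int[mu]_(y in S) (g a y)%:E)%E; last first.
    rewrite [LHS]integral_mkcond; apply: eq_integral => y _; rewrite /patch /k /= !indicE.
    by rewrite [a \in I]mem_set //; case: ifPn => _; rewrite ?mul1r ?mulr0 ?mul0r.
  apply/esym; etransitivity.
    apply: (@ge0_integration_by_substitution_itvoo _ (- r) r S (arg_disk a) (arg_disk_deriv a)).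
  - by rewrite gtrN.
  - exact: oS.
  - by move=> b; rewrite rE; exact: is_derive_arg_disk.
  - move=> b; rewrite rE => ab; apply: (@continuous_arg_disk_deriv (cst a) id) => //.
    by apply: cst_continuous.
  - by move=> b; rewrite rE; exact: arg_disk_deriv_gt0.
  - by move=> b _; exact: arg_disk_itv.
  - move=> y Sy; have [q1 q2] := arg_inv_disk Sy (IE _ Ia).
    by exists (arg_inv a y) => //; rewrite rE.
  - move=> y Sy; have [q1 q2] := arg_inv_disk Sy (IE _ Ia).
    have cq := arg_inv_continuous_r Sy (IE _ Ia).
    apply: cvgM.
      apply: (@plane_continuous_curve h (cst a) (arg_inv a)) => //; first exact: hc.
      by apply: cst_continuous.
    apply: cvgV; first by rewrite gt_eqF // arg_disk_deriv_gt0.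
    by apply: (@continuous_arg_disk_deriv (cst a) (arg_inv a)) => //; apply: cst_continuous.
  - by move=> y Sy; exact: g0.
  - apply: eq_integral => b /set_mem; rewrite /= rE => ab.
    by rewrite /g arg_diskK // divfK // gt_eqF // arg_disk_deriv_gt0.
rewrite [LHS](@fubini_tonelli _ _ _ _ _ mu mu (EFin \o k) mkE); last by move=> p; rewrite lee_fin.
rewrite [RHS]integral_mkcond; apply: eq_integral => y _; rewrite /patch.
case: ifPn => [/set_mem Sy|Sy]; last first.
  by rewrite integral0_eq // => a _; rewrite /k /= !indicE (negPf Sy) mulr0 mul0r.
transitivity (\int[mu]_(a in I) (g a y)%:E)%E.
  rewrite [RHS]integral_mkcond; apply: eq_integral => a _; rewrite /patch /k /= !indicE.
  by rewrite [y \in S]mem_set //; case: ifPn => _; rewrite ?mul1r ?mulr0 ?mul0r.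
etransitivity.
  apply: (@ge0_integration_by_substitution_setT _ I (fun x => strip_re x y)
     (fun x => (1 + ch x * cos y) / (ch x + cos y) ^+ 2)).
- exact: oI.
- by move=> x; exact: is_derive_strip_re.
- move=> x; have cch : {for x, continuous (@ch R)} by exact: (is_derive_continuous (is_derive_ch x)).
  apply: cvgM.
    apply: cvgD; first exact: cvg_cst.
    by apply: cvgM => //; exact: cvg_cst.
  apply: cvgV; first by rewrite expf_neq0 // gt_eqF // strip_den_gt0.
  apply: (@continuous_comp _ _ _ (fun x => ch x + cos y) (fun t => t ^+ 2)).
    by apply: cvgD => //; exact: cvg_cst.
  exact: exprn_continuous.
- move=> x; rewrite divr_gt0 ?exprn_gt0 ?strip_den_gt0 //.
  by rewrite ltr_pwDl // mulr_ge0 ?(ltW (cos_gt0_strip Sy)) // (le_trans ler01) // ch_ge1.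
- move=> x; rewrite /I /= in_itv /=.
  by have := strip_disk x Sy; have := sqr_ge0 (strip_im x y); nra.
- by move=> a /IE; exact: strip_re_surj.
- move=> a Ia; have [q1 q2] := arg_inv_disk Sy (IE _ Ia).
  have cq := arg_inv_continuous_l Sy (IE _ Ia).
  apply: cvgM.
    by apply: (@plane_continuous_curve h id (fun a => arg_inv a y)) => //; exact: hc.
  apply: cvgV; first by rewrite gt_eqF // arg_disk_deriv_gt0.
  by apply: (@continuous_arg_disk_deriv id (fun a => arg_inv a y)).
- by move=> a Ia; exact: g0.
- apply: eq_integral => x _; congr EFin.
  by rewrite /g arg_inv_strip // -[X in _ = _ * X]arg_disk_deriv_strip //; ring.
Qed.

End DiskIntegral.

Section PlaneContinuity.
Variable R : realType.

Lemma plane_continuousM (f g : R * R -> R) p : plane_continuous_at f p ->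
  plane_continuous_at g p -> plane_continuous_at (fun q => f q * g q) p.
Proof.
move=> cf cg e e0; pose m := `|f p| + `|g p| + 1.
have m0 : 0 < m by rewrite ltr_wpDl // addr_ge0.
pose k := Num.min 1 (e / m); have k0 : 0 < k by rewrite lt_min ltr01 divr_gt0.
have [d1 d10 H1] := cf k k0; have [d2 d20 H2] := cg k k0.
exists (Num.min d1 d2); first by rewrite lt_min d10 d20.
move=> q; rewrite !lt_min => /andP[a1 a2] /andP[b1 b2].
have := H1 q a1 b1; have := H2 q a2 b2; set u := g q - g p; set v := f q - f p => uk vk.
have -> : f q * g q - f p * g p = v * u + (v * g p + f p * u) by rewrite /u /v; ring.
apply: (@le_trans _ _ (k * m)); last first.
  by rewrite -ler_pdivlMr // /k ge_min lexx orbT.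
apply: (le_trans (ler_normD _ _)); rewrite normrM.
have := ler_normD (v * g p) (f p * u); rewrite !normrM.
have k1 : k <= 1 by rewrite /k ge_min lexx.
have := normr_ge0 u; have := normr_ge0 v; have := normr_ge0 (f p); have := normr_ge0 (g p).
rewrite /m; move: uk vk; move: `|u| `|v| `|f p| `|g p| => U V A B uk vk.
move=> A0 B0 V0 U0 h.
have h1 : V * U <= k * 1 by rewrite ler_pM // (le_trans uk).
have h2 : V * B <= k * B by rewrite ler_wpM2r.
have h3 : A * U <= k * A by rewrite mulrC ler_wpM2r.
by rewrite (le_trans (lerD h1 (le_trans h (lerD h2 h3)))) // -!mulrDr [1 + _]addrC [B + A]addrC.
Qed.

Lemma plane_continuous_comp (h : R * R -> R) (g : R -> R) p : plane_continuous_at h p ->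
  {for h p, continuous g} -> plane_continuous_at (fun q => g (h q)) p.
Proof.
move=> ch /cvgrPdist_le cg e e0.
have [d /= d0 H] := cg e e0.
have [d' d'0 H'] := ch (d / 2) (divr_gt0 d0 (ltr0Sn R 1)).
exists d' => // q q1 q2; rewrite distrC; apply: H => /=.
by rewrite distrC (le_lt_trans (H' q q1 q2)) // ltr_pdivrMr // ltr_pMr // ltr1n.
Qed.

Lemma plane_continuous_cmod (f : R[i] -> R[i]) (p : R * R) c : cdiff f (p.1 +i* p.2) c ->
  plane_continuous_at (fun q => cmod (f (q.1 +i* q.2))) p.
Proof.
move=> /cdiff_cvg cf e e0; have [d d0 H] := cf e e0.
exists (d / 2); first by rewrite divr_gt0.
move=> q q1 q2; pose h := (q.1 - p.1) +i* (q.2 - p.2).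
have hE : p.1 +i* p.2 + h = q.1 +i* q.2 by rewrite /h; simpc; congr (_ +i* _); ring.
have := H h; rewrite hE => /(_ _) H1.
apply: le_trans (H1 _); last first.
  by apply: (le_lt_trans (cmod_le_ReIm _)); rewrite /h /= [d]splitr; exact: ltrD.
rewrite ler_norml lerB_cmod andbT lerNl opprB cmodBC; exact: lerB_cmod.
Qed.

End PlaneContinuity.

(** * Goursat's theorem on rectangles *)

Section Goursat.
Variable R : realType.
Let mu := @lebesgue_measure R.

Definition subrect (a c l m a' c' l' m' : R) : Prop :=
  [/\ a <= a', a' + l' <= a + l, c <= c', c' + m' <= c + m & 0 < l' /\ 0 < m'].

Let pigeonhole4 (x1 x2 x3 x4 e : R) : e <= `|x1 + x2 + x3 + x4| ->
  [\/ e / 4 <= `|x1|, e / 4 <= `|x2|, e / 4 <= `|x3| | e / 4 <= `|x4|].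
Proof.
move=> h; have [|h1] := leP (e / 4) `|x1|; first by constructor 1.
have [|h2] := leP (e / 4) `|x2|; first by constructor 2.
have [|h3] := leP (e / 4) `|x3|; first by constructor 3.
have [|h4] := leP (e / 4) `|x4|; first by constructor 4.
have := ler_normD (x1 + x2 + x3) x4; have := ler_normD (x1 + x2) x3.
have := ler_normD x1 x2; lra.
Qed.

Let subrect_half (a c l m p1 p2 l' m' s t : R) : subrect a c l m p1 p2 l' m' ->
  0 <= s <= l' / 2 -> 0 <= t <= m' / 2 ->
  subrect a c l m (p1 + s) (p2 + t) (l' / 2) (m' / 2) /\
  (p1 <= p1 + s <= p1 + l' - l' / 2 /\ p2 <= p2 + t <= p2 + m' - m' / 2).
Proof.
move=> [s1 s2 s3 s4 [s5 s6]] /andP[h1 h2] /andP[h3 h4].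
by split; [split => //; [| | | |split]; lra|split; apply/andP; split; lra].
Qed.

(** Goursat's argument freed from integrals: [E] is additive under quartering and o(size^2) near
    each point. If it were nonzero, some quarter would keep a fourth of |E| at every stage, and the
    point common to these nested quarters would contradict the local bound. *)
Lemma rect_bisection (E : R -> R -> R -> R -> R) (a c l m : R) :
  0 < l -> 0 < m ->
  (forall a' c' l' m', subrect a c l m a' c' l' m' ->
    E a' c' l' m' = E a' c' (l' / 2) (m' / 2) + E (a' + l' / 2) c' (l' / 2) (m' / 2)
      + E a' (c' + m' / 2) (l' / 2) (m' / 2) + E (a' + l' / 2) (c' + m' / 2) (l' / 2) (m' / 2)) ->
  (forall x y e, a <= x <= a + l -> c <= y <= c + m -> 0 < e -> exists2 d, 0 < d &
    forall a' c' l' m', subrect a c l m a' c' l' m' -> l' < d -> m' < d ->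
      a' <= x <= a' + l' -> c' <= y <= c' + m' -> `|E a' c' l' m'| <= e * (l' + m') ^+ 2) ->
  E a c l m = 0.
Proof.
move=> l0 m0 Eadd Eloc; apply/eqP; rewrite -normr_eq0; apply: contraT => E0.
have {E0} : 0 < `|E a c l m| by rewrite lt0r E0 normr_ge0.
set e0 := `|E a c l m| => e00.
have [len lenE] : exists len : nat -> R, forall n, len n = l / 2 ^+ n by eexists.
have [wid widE] : exists wid : nat -> R, forall n, wid n = m / 2 ^+ n by eexists.
have len0 n : 0 < len n by rewrite lenE divr_gt0 // exprn_gt0.
have wid0 n : 0 < wid n by rewrite widE divr_gt0 // exprn_gt0.
have lenS n : len n.+1 = len n / 2 by rewrite !lenE exprS; field; rewrite expf_neq0.
have widS n : wid n.+1 = wid n / 2 by rewrite !widE exprS; field; rewrite expf_neq0.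
pose Bad n (p : R * R) := subrect a c l m p.1 p.2 (len n) (wid n) /\
   e0 / 4 ^+ n <= `|E p.1 p.2 (len n) (wid n)|.
(* Placing badness under an implication makes the statement total in [np], so [choice] yields a
   plain map. *)
have step (np : nat * (R * R)) : exists q : R * R, Bad np.1 np.2 ->
    Bad np.1.+1 q /\ (np.2.1 <= q.1 <= np.2.1 + len np.1 - len np.1.+1 /\
                      np.2.2 <= q.2 <= np.2.2 + wid np.1 - wid np.1.+1).
  case: np => n p /=; have [bad|] := EM (Bad n p); last by exists p.
  have [sub eb] := bad; have := sub => -[s1 s2 s3 s4 [s5 s6]].
  have L := len0 n; have W := wid0 n.
  rewrite (Eadd _ _ _ _ sub) in eb.
  have e4 : e0 / 4 ^+ n / 4 = e0 / 4 ^+ n.+1 by rewrite exprS; field; rewrite expf_neq0.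
  have z0 : 0 <= (0 : R) <= len n / 2 by rewrite lexx divr_ge0 // ltW.
  have z1 : 0 <= len n / 2 <= len n / 2 by rewrite lexx divr_ge0 // ltW.
  have w0 : 0 <= (0 : R) <= wid n / 2 by rewrite lexx divr_ge0 // ltW.
  have w1 : 0 <= wid n / 2 <= wid n / 2 by rewrite lexx divr_ge0 // ltW.
  rewrite /Bad lenS widS -e4; case: (pigeonhole4 eb) => h.
  - exists (p.1, p.2) => _; have := subrect_half sub z0 w0.
    by rewrite !addr0 => -[].
  - exists (p.1 + len n / 2, p.2) => _; have := subrect_half sub z1 w0.
    by rewrite !addr0 => -[].
  - exists (p.1, p.2 + wid n / 2) => _; have := subrect_half sub z0 w1.
    by rewrite !addr0 => -[].
  - by exists (p.1 + len n / 2, p.2 + wid n / 2) => _; have [] := subrect_half sub z1 w1.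
have [nxt nxtP] := choice step.
pose s := fix s n := if n is k.+1 then nxt (k, s k) else (a, c).
have badS n : Bad n (s n).
  elim: n => [|n IH]; last by have [] := nxtP (n, s n) IH.
  by rewrite /Bad /= lenE widE !expr0 !divr1 -/e0; split.
have sS n : (s n).1 <= (s n.+1).1 <= (s n).1 + len n - len n.+1 /\
            (s n).2 <= (s n.+1).2 <= (s n).2 + wid n - wid n.+1.
  by have [_ h] := nxtP (n, s n) (badS n).
have mono n k : (s n).1 <= (s (n + k)%N).1 /\ (s (n + k)%N).1 + len (n + k)%N <= (s n).1 + len n /\
   ((s n).2 <= (s (n + k)%N).2 /\ (s (n + k)%N).2 + wid (n + k)%N <= (s n).2 + wid n).
  elim: k => [|k [h1 [h2 [h3 h4]]]]; first by rewrite addn0 !lexx.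
  by rewrite addnS; have [/andP[g1 g2] /andP[g3 g4]] := sS (n + k)%N; do ![split]; lra.
have cross n k : (s n).1 <= (s k).1 + len k /\ (s n).2 <= (s k).2 + wid k.
  have [nk|/ltnW kn] := leqP n k.
    have [h1 [_ [h3 _]]] := mono n (k - n)%N; rewrite subnKC // in h1 h3.
    by have := len0 k; have := wid0 k; split; lra.
  have [_ [h2 [_ h4]]] := mono k (n - k)%N; rewrite subnKC // in h2 h4.
  by have := len0 n; have := wid0 n; split; lra.
(* By [cross] every lower corner lies below every upper one, so the suprema of the lower corners lie
   in all the rectangles. *)
pose x := sup (range (fun n => (s n).1)); pose y := sup (range (fun n => (s n).2)).
have xP n : (s n).1 <= x <= (s n).1 + len n.
  apply/andP; split.
    apply: ub_le_sup; last by exists n.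
    by exists ((s 0).1 + len 0) => _ [k _ <-]; have [] := cross k 0.
  apply: ge_sup; first by exists (s 0).1; exists 0%N.
  by move=> _ [k _ <-]; have [] := cross k n.
have yP n : (s n).2 <= y <= (s n).2 + wid n.
  apply/andP; split.
    apply: ub_le_sup; last by exists n.
    by exists ((s 0).2 + wid 0) => _ [k _ <-]; have [] := cross k 0.
  apply: ge_sup; first by exists (s 0).2; exists 0%N.
  by move=> _ [k _ <-]; have [] := cross k n.
(* With this tolerance the local bound on the n-th rectangle is e0 / (2 4^n), half of what badness
   demands. *)
have e10 : 0 < e0 / (2 * (l + m) ^+ 2) by rewrite divr_gt0 // mulr_gt0 // exprn_gt0 // addr_gt0.
have xab : a <= x <= a + l by have := xP 0; rewrite lenE expr0 divr1.
have ycd : c <= y <= c + m by have := yP 0; rewrite widE expr0 divr1.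
have [d d0 H] := Eloc x y _ xab ycd e10.
have [n nd] : exists n, (l + m) / 2 ^+ n < d.
  have [k] := ltr_add_invr (divr_gt0 d0 (addr_gt0 l0 m0)); rewrite add0r => kd.
  exists k.+1; rewrite ltr_pdivrMr ?exprn_gt0 //.
  rewrite ltr_pdivlMr ?addr_gt0 // in kd.
  have k2 : k.+1%:R <= 2 ^+ k.+1 :> R by rewrite -natrX ler_nat ltnW // ltn_expl.
  have k0 : 0 < k.+1%:R :> R by rewrite ltr0n.
  rewrite ltr_pdivrMl // in kd; rewrite (lt_le_trans kd) // mulrC.
  by rewrite ler_wpM2l // ltW.
have [sub eb] := badS n.
have ll : len n < d.
  by rewrite (le_lt_trans _ nd) // lenE ler_wpM2r ?invr_ge0 ?exprn_ge0 // lerDl ltW.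
have ww : wid n < d.
  by rewrite (le_lt_trans _ nd) // widE ler_wpM2r ?invr_ge0 ?exprn_ge0 // lerDr ltW.
have := H _ _ _ _ sub ll ww (xP n) (yP n).
move/(le_trans eb); rewrite lenE widE -mulrDl exprMn exprVn -exprM mulnC exprM.
rewrite (_ : 2 ^+ 2 = 4); last by ring.
have p4 : 0 < (4 ^+ n)^-1 :> R by rewrite invr_gt0 exprn_gt0.
have lm0 : 0 < (l + m) ^+ 2 by rewrite exprn_gt0 // addr_gt0.
rewrite mulrA ler_pM2r // [X in _ <= X](_ : _ = e0 / 2); last first.
  by field; rewrite gt_eqF // addr_gt0.
by rewrite leNgt ltr_pdivrMr // ltr_pMr // ltr1n.
Qed.

End Goursat.

Section GoursatForms.
Variable R : realType.
Let mu := @lebesgue_measure R.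

Definition rdiff2 (f : R -> R -> R) (x y p q : R) : Prop :=
  forall e, 0 < e -> exists2 d, 0 < d & forall s t, `|s| < d -> `|t| < d ->
    `|f (x + s) (y + t) - f x y - p * s - q * t| <= e * (`|s| + `|t|).

Lemma rdiff2_continuous_l f x y p q : rdiff2 f x y p q -> {for x, continuous (f ^~ y)}.
Proof.
move=> fd; apply/cvgrPdist_le => e e0; have [d d0 H] := fd 1 ltr01.
have p0 : 0 < `|p| + 1 by rewrite ltr_wpDl.
near=> t; have tx : `|t - x| < d by rewrite distrC; near: t; exact: cvgr_dist_lt.
have te : `|t - x| * (`|p| + 1) <= e.
  by rewrite -ler_pdivlMr // distrC; near: t; apply: cvgr_dist_le => //; rewrite divr_gt0.
have := H (t - x) 0 tx; rewrite normr0 => /(_ d0); rewrite addr0 mulr0 subr0 addr0 mul1r.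
rewrite [x + _]addrC subrK => H1; rewrite distrC.
rewrite (_ : f t y - f x y = f t y - f x y - p * (t - x) + p * (t - x)); last by ring.
rewrite (le_trans (ler_normD _ _)) // (le_trans _ te) //.
by rewrite [X in _ <= X](_ : _ = `|t - x| + `|p| * `|t - x|) ?lerD ?normrM //; ring.
Unshelve. all: by end_near. Qed.

Lemma rdiff2_continuous_r f x y p q : rdiff2 f x y p q -> {for y, continuous (f x)}.
Proof.
move=> fd; have : rdiff2 (fun y x => f x y) y x q p.
  move=> e e0; have [d d0 H] := fd e e0; exists d => // s t sd td.
  by have := H t s td sd; rewrite addrAC [`|t| + _]addrC.
by move/rdiff2_continuous_l.
Qed.

Lemma continuous_itv_integrable (f : R -> R) (a b : R) :
  (forall x, a <= x <= b -> {for x, continuous f}) ->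
  mu.-integrable `[a, b] (EFin \o f).
Proof.
move=> cf; apply: continuous_compact_integrable; first exact: segment_compact.
by apply: continuous_in_subspaceT => x /set_mem /=; rewrite in_itv => /cf.
Qed.

Lemma Rintegral_split (f : R -> R) (a l : R) : 0 < l ->
  (forall x, a <= x <= a + l -> {for x, continuous f}) ->
  \int[mu]_(x in `[a, a + l]) f x = \int[mu]_(x in `[a, a + l / 2]) f x
     + \int[mu]_(x in `[a + l / 2, a + l / 2 + l / 2]) f x.
Proof.
move=> l0 cf; have -> : a + l / 2 + l / 2 = a + l by rewrite -addrA -splitr.
have i1 := continuous_itv_integrable cf.
have h : a <= a + l / 2 <= a + l by apply/andP; split; lra.
have := Rintegral_itvB i1 (x := a + l / 2).
rewrite !bnd_simp /= => -/(_ (proj1 (andP h)) (proj2 (andP h))).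
rewrite Rintegral_itv_obnd_cbnd; first by move=> <-; ring.
apply: integrableS i1 => // x /=; rewrite !in_itv /= => /andP[h1 ->].
by rewrite andbT; case/andP: h => h _; exact: le_trans (ltW h1).
Qed.

Lemma Rintegral_approx (f : R -> R) (a l k e : R) : 0 < l ->
  (forall x, a <= x <= a + l -> {for x, continuous f}) ->
  (forall x, a <= x <= a + l -> `|f x - k| <= e) ->
  `|\int[mu]_(x in `[a, a + l]) f x - k * l| <= e * l.
Proof.
move=> l0 cf fk; have i1 := continuous_itv_integrable cf.
have ik (r : R) : mu.-integrable `[a, a + l] (EFin \o cst r).
  by apply: continuous_itv_integrable => x _; apply: cst_continuous.
have cE (r : R) : \int[mu]_(x in `[a, a + l]) r = r * l.
  rewrite Rintegral_cst //= lebesgue_measure_itv /= lte_fin ltrDl l0 -EFinB /=.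
  by rewrite addrAC subrr add0r.
rewrite -cE -(RintegralB _ i1 (ik k)) // -cE.
have i2 : mu.-integrable `[a, a + l] (EFin \o (fun x => f x - k)).
  by apply: continuous_itv_integrable => x /cf fx; apply: cvgB => //; exact: cvg_cst.
apply: le_trans (le_normr_Rintegral _ i2) _ => //.
apply: le_Rintegral => //.
- apply: continuous_itv_integrable => x /cf fx; apply: cvg_norm.
  by apply: cvgB => //; exact: cvg_cst.
- exact: ik.
Qed.

Let itv_l (a l : R) : 0 < l -> a <= a <= a + l.
Proof. by move=> l0; rewrite lexx lerDl ltW. Qed.
Let itv_r (a l : R) : 0 < l -> a <= a + l <= a + l.
Proof. by move=> l0; rewrite lexx lerDl ltW. Qed.
Let itv_m (a l : R) : 0 < l -> a <= a + l / 2 <= a + l.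
Proof. by move=> l0; apply/andP; split; lra. Qed.
Let itv_sub (a l a' l' t : R) : a <= a' -> a' + l' <= a + l -> a' <= t <= a' + l' -> a <= t <= a + l.
Proof. by move=> ? ? /andP[? ?]; apply/andP; split; lra. Qed.
Let itv_half1 (a l t : R) : 0 < l -> a <= t <= a + l / 2 -> a <= t <= a + l.
Proof. by move=> ? /andP[? ?]; apply/andP; split; lra. Qed.
Let itv_half2 (a l t : R) : 0 < l -> a + l / 2 <= t <= a + l / 2 + l / 2 -> a <= t <= a + l.
Proof. by move=> ? /andP[? ?]; apply/andP; split; lra. Qed.
Let itv_dist (a l x t : R) : a <= x <= a + l -> a <= t <= a + l -> `|t - x| <= l.
Proof. by move=> /andP[? ?] /andP[? ?]; rewrite ler_norml; apply/andP; split; lra. Qed.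
Let norm_sub_half (x y e : R) : `|x| <= e / 2 -> `|y| <= e / 2 -> `|x - y| <= e.
Proof. by move=> hx hy; rewrite (le_trans (ler_normB _ _)) // [e]splitr lerD. Qed.

(** The form U dx - V dy is closed, being Re (G dz) when U and V are the parts of a holomorphic G.
    Since U and V are only differentiable at each point, the claim goes through [rect_bisection],
    applied to the boundary integral: inner edges cancel, and the linear parts contribute
    nothing. *)
Lemma goursat_rect (U V : R -> R -> R) (a c l m : R) : 0 < l -> 0 < m ->
  (forall x y, a <= x <= a + l -> c <= y <= c + m ->
     exists p q r, rdiff2 U x y p q /\ rdiff2 V x y (- q) r) ->
  \int[mu]_(x in `[a, a + l]) (U x c - U x (c + m)) =
  \int[mu]_(y in `[c, c + m]) (V (a + l) y - V a y).
Proof.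
move=> l0 m0 UV; apply/eqP; rewrite -subr_eq0; apply/eqP.
pose E a c l m := \int[mu]_(x in `[a, a + l]) (U x c - U x (c + m)) -
  \int[mu]_(y in `[c, c + m]) (V (a + l) y - V a y).
have cU x y : a <= x <= a + l -> c <= y <= c + m -> {for x, continuous (U ^~ y)}.
  by move=> hx hy; have [p [q [r [h _]]]] := UV x y hx hy; exact: rdiff2_continuous_l h.
have cV x y : a <= x <= a + l -> c <= y <= c + m -> {for y, continuous (V x)}.
  by move=> hx hy; have [p [q [r [_ h]]]] := UV x y hx hy; exact: rdiff2_continuous_r h.
have cUB x y1 y2 : a <= x <= a + l -> c <= y1 <= c + m -> c <= y2 <= c + m ->
    {for x, continuous (fun x => U x y1 - U x y2)}.
  by move=> hx h1 h2; apply: cvgB; exact: cU.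
have cVB y x1 x2 : a <= x1 <= a + l -> a <= x2 <= a + l -> c <= y <= c + m ->
    {for y, continuous (fun y => V x1 y - V x2 y)}.
  by move=> hx h1 h2; apply: cvgB; exact: cV.
apply: (@rect_bisection R E a c l m) => //.
  move=> a' c' l' m' [s1 s2 s3 s4 [s5 s6]]; rewrite /E.
  have r1 x : a' <= x <= a' + l' -> a <= x <= a + l by exact: itv_sub.
  have r2 y : c' <= y <= c' + m' -> c <= y <= c + m by exact: itv_sub.
  have b1 := itv_l c' s6; have b2 := itv_m c' s6; have b3 := itv_r c' s6.
  have d1 := itv_l a' s5; have d2 := itv_m a' s5; have d3 := itv_r a' s5.
  have h1 x := @itv_half1 a' l' x s5; have h2 x := @itv_half2 a' l' x s5.
  have h3 x := @itv_half1 c' m' x s6; have h4 x := @itv_half2 c' m' x s6.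
  have iU x0 x1 y1 y2 : (forall x, x0 <= x <= x1 -> a' <= x <= a' + l') ->
      c' <= y1 <= c' + m' -> c' <= y2 <= c' + m' ->
      mu.-integrable `[x0, x1] (EFin \o (fun x => U x y1 - U x y2)).
    by move=> hx k1 k2; apply: continuous_itv_integrable => x /hx hx'; apply: cUB; auto.
  have iV y0 y1 x1 x2 : (forall y, y0 <= y <= y1 -> c' <= y <= c' + m') ->
      a' <= x1 <= a' + l' -> a' <= x2 <= a' + l' ->
      mu.-integrable `[y0, y1] (EFin \o (fun y => V x1 y - V x2 y)).
    by move=> hx k1 k2; apply: continuous_itv_integrable => x /hx hx'; apply: cVB; auto.
  have sU x0 x1 y1 y2 y3 : (forall x, x0 <= x <= x1 -> a' <= x <= a' + l') ->
      c' <= y1 <= c' + m' -> c' <= y2 <= c' + m' -> c' <= y3 <= c' + m' ->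
      \int[mu]_(x in `[x0, x1]) (U x y1 - U x y3) =
      \int[mu]_(x in `[x0, x1]) (U x y1 - U x y2) + \int[mu]_(x in `[x0, x1]) (U x y2 - U x y3).
    move=> hx k1 k2 k3; rewrite -RintegralD //; [|exact: iU|exact: iU].
    by apply: eq_Rintegral => x _; ring.
  have sV y0 y1 x1 x2 x3 : (forall y, y0 <= y <= y1 -> c' <= y <= c' + m') ->
      a' <= x1 <= a' + l' -> a' <= x2 <= a' + l' -> a' <= x3 <= a' + l' ->
      \int[mu]_(y in `[y0, y1]) (V x3 y - V x1 y) =
      \int[mu]_(y in `[y0, y1]) (V x2 y - V x1 y) + \int[mu]_(y in `[y0, y1]) (V x3 y - V x2 y).
    move=> hx k1 k2 k3; rewrite -RintegralD //; [|exact: iV|exact: iV].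
    by apply: eq_Rintegral => x _; ring.
  have E1 : c' + m' / 2 + m' / 2 = c' + m' by rewrite -addrA -splitr.
  have E2 : a' + l' / 2 + l' / 2 = a' + l' by rewrite -addrA -splitr.
  rewrite (Rintegral_split (f := fun x => U x c' - U x (c' + m')) s5); last first.
    by move=> x hx; apply: cUB; auto.
  rewrite (Rintegral_split (f := fun y => V (a' + l') y - V a' y) s6); last first.
    by move=> x hx; apply: cVB; auto.
  rewrite (sU _ _ c' (c' + m' / 2) (c' + m') h1) //.
  rewrite (sU _ _ c' (c' + m' / 2) (c' + m') h2) //.
  rewrite (sV _ _ a' (a' + l' / 2) (a' + l') h3) //.
  rewrite (sV _ _ a' (a' + l' / 2) (a' + l') h4) //.
  rewrite E1 E2; ring.
move=> x y e hx hy e0; have [p [q [r [hU hV]]]] := UV x y hx hy.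
have e20 : 0 < e / 2 by rewrite divr_gt0.
have [d1 d10 H1] := hU _ e20; have [d2 d20 H2] := hV _ e20.
exists (Num.min d1 d2); first by rewrite lt_min d10.
move=> a' c' l' m' [s1 s2 s3 s4 [s5 s6]]; rewrite !lt_min => /andP[l1 l2] /andP[m1 m2].
move=> /andP[x1 x2] /andP[y1 y2].
have r1 t : a' <= t <= a' + l' -> a <= t <= a + l by exact: itv_sub.
have r2 t : c' <= t <= c' + m' -> c <= t <= c + m by exact: itv_sub.
have b1 := itv_l c' s6; have b3 := itv_r c' s6.
have g1 := itv_l a' s5; have g3 := itv_r a' s5.
have nx t : a' <= t <= a' + l' -> `|t - x| <= l' by apply: itv_dist; rewrite x1.
have ny t : c' <= t <= c' + m' -> `|t - y| <= m' by apply: itv_dist; rewrite y1.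
have K1' t u : a' <= t <= a' + l' -> c' <= u <= c' + m' ->
    `|U t u - U x y - p * (t - x) - q * (u - y)| <= e * (l' + m') / 2.
  move=> /nx ht /ny hu; have := H1 (t - x) (u - y) (le_lt_trans ht l1) (le_lt_trans hu m1).
  rewrite ![_ + (_ - _)]addrC !subrK => /le_trans; apply.
  by rewrite [X in _ <= X]mulrAC ler_wpM2l ?(ltW e20) // lerD.
have K2' t u : a' <= t <= a' + l' -> c' <= u <= c' + m' ->
    `|V t u - V x y + q * (t - x) - r * (u - y)| <= e * (l' + m') / 2.
  move=> /nx ht /ny hu; have := H2 (t - x) (u - y) (le_lt_trans ht l2) (le_lt_trans hu m2).
  rewrite ![_ + (_ - _)]addrC !subrK mulNr opprK => /le_trans; apply.
  by rewrite [X in _ <= X]mulrAC ler_wpM2l ?(ltW e20) // lerD.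
(* The linear parts contribute - q m' l' to the horizontal and to the vertical integral alike, so
   they cancel in [E]; what remains is at most e (l' + m') times each side. *)
have A1 : `|\int[mu]_(x in `[a', a' + l']) (U x c' - U x (c' + m')) - (- q * m') * l'|
    <= e * (l' + m') * l'.
  apply: (@Rintegral_approx (fun x => U x c' - U x (c' + m'))) => //.
    by move=> t ht; apply: cUB; auto.
  move=> t ht; have := norm_sub_half (K1' t _ ht b1) (K1' t _ ht b3).
  by congr (`|_| <= _); ring.
have A2 : `|\int[mu]_(y in `[c', c' + m']) (V (a' + l') y - V a' y) - (- q * l') * m'|
    <= e * (l' + m') * m'.
  apply: (@Rintegral_approx (fun y => V (a' + l') y - V a' y)) => //.
    by move=> t ht; apply: cVB; auto.
  move=> t ht; have := norm_sub_half (K2' _ t g3 ht) (K2' _ t g1 ht).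
  by congr (`|_| <= _); ring.
rewrite (_ : E _ _ _ _ = (\int[mu]_(x in `[a', a' + l']) (U x c' - U x (c' + m')) - (- q * m') * l')
  - (\int[mu]_(y in `[c', c' + m']) (V (a' + l') y - V a' y) - (- q * l') * m')); last by rewrite /E; ring.
by rewrite expr2 mulrA mulrDr (le_trans (ler_normB _ _)) // lerD.
Qed.

End GoursatForms.

(** * Midpoint convexity of line means *)

Section StripConvexity.
Variable R : realType.
Let mu := @lebesgue_measure R.
Let S : set R := `]- (pi / 2), pi / 2[%classic.

(** The Cauchy-Riemann equations, read off from multiplication by [c]. *)
Lemma cdiff_rdiff2 (f : R[i] -> R[i]) (x y : R) (c : R[i]) : cdiff f (x +i* y) c ->
  rdiff2 (fun x y => complex.Re (f (x +i* y))) x y (complex.Re c) (- complex.Im c) /\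
  rdiff2 (fun x y => complex.Im (f (x +i* y))) x y (complex.Im c) (complex.Re c).
Proof.
move=> fd; have key e : 0 < e -> exists2 d, 0 < d & forall s t, `|s| < d -> `|t| < d ->
    cmod (f ((x + s) +i* (y + t)) - f (x +i* y) - c * (s +i* t)) <= e * (`|s| + `|t|).
  move=> e0; have [d d0 H] := fd e e0; exists (d / 2); first by rewrite divr_gt0.
  move=> s t sd td; have st := cmod_le_ReIm (s +i* t); rewrite /= in st.
  have := H (s +i* t); rewrite [X in f X](_ : _ = (x + s) +i* (y + t)) // => H1.
  rewrite (le_trans (H1 _)) ?ler_wpM2l ?(ltW e0) // (le_lt_trans st) //.
  by rewrite [d]splitr ltrD.
split=> e e0; have [d d0 H] := key e e0; exists d => // s t sd td;
  rewrite (le_trans _ (H s t sd td)) //.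
- rewrite (le_trans _ (ler_Re_cmod _)) // le_eqVlt; apply/orP; left; apply/eqP; congr (`|_|).
  case: (f _) (f _) c {fd key H} => [a1 a2] [b1 b2] [c1 c2] /=; ring.
- rewrite (le_trans _ (ler_Im_cmod _)) // le_eqVlt; apply/orP; left; apply/eqP; congr (`|_|).
  case: (f _) (f _) c {fd key H} => [a1 a2] [b1 b2] [c1 c2] /=; ring.
Qed.

Variable F : R[i] -> R[i].
Hypothesis HF : forall x y, S y -> exists c, cdiff F (x +i* y) c.

Let u (x y : R) : R := cmod (F (x +i* y)) ^+ 2.

Let u0 x y : 0 <= u x y. Proof. exact: sqr_ge0. Qed.

Let u_continuous (p : R * R) : S p.2 -> plane_continuous_at (fun p => u p.1 p.2) p.
Proof.
case: p => x y /= Sy; have [c Fc] := HF x Sy.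
apply: (@plane_continuous_comp _ _ (fun t => t ^+ 2)); last exact: exprn_continuous.
exact: plane_continuous_cmod Fc.
Qed.

Let cu_l x y : S y -> {for x, continuous (u ^~ y)}.
Proof.
move=> Sy; apply: (@plane_continuous_curve _ (fun p => u p.1 p.2) id (cst y)).
- exact: u_continuous.
- exact: cvg_id.
- exact: cst_continuous.
Qed.

Let cu_r x y (v : R -> R) : S (v y) -> {for y, continuous v} ->
  {for y, continuous (fun y => u x (v y))}.
Proof.
move=> Sy cv; apply: (@plane_continuous_curve _ (fun p => u p.1 p.2) (cst x) v) => //.
- exact: u_continuous.
- exact: cst_continuous.
Qed.

(** The extension by 0 allows translations, reflections and Tonelli on the whole plane. *)
Definition strip_ext (p : R * R) : R := \1_S p.2 * u p.1 p.2.

Lemma strip_ext_ge0 p : 0 <= strip_ext p.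
Proof. by rewrite /strip_ext mulr_ge0 // indicE ler0n. Qed.

Lemma strip_extE x y : S y -> strip_ext (x, y) = u x y.
Proof. by move=> Sy; rewrite /strip_ext indicE mem_set //= mul1r. Qed.

Lemma measurable_strip_ext : measurable_fun setT strip_ext.
Proof.
pose U := [set p : R * R | S p.2].
have oU (p : R * R) : U p -> exists2 d, 0 < d &
     forall q : R * R, `|q.1 - p.1| < d -> `|q.2 - p.2| < d -> U q.
  rewrite /U /S /= in_itv /= => /andP[h1 h2].
  exists (Num.min (p.2 + pi / 2) (pi / 2 - p.2)); first by rewrite lt_min; apply/andP; split; lra.
  move=> q _; rewrite lt_min !ltr_norml in_itv /= => /andP[/andP[? ?] /andP[? ?]].
  by apply/andP; split; lra.
have mU : measurable U by exact: plane_open_measurable.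
have mu' : measurable_fun U (fun p => u p.1 p.2).
  by apply: plane_continuous_measurable => // p; exact: u_continuous.
have -> : strip_ext = (fun p => u p.1 p.2) \_ U.
  apply/funext => p; rewrite /strip_ext /patch indicE.
  have -> : (p.2 \in S) = (p \in U) by apply/idP/idP => /set_mem h; exact/mem_set.
  by case: ifP; rewrite ?mul1r ?mul0r.
exact: (measurable_restrictT _ mU).1.
Qed.

Definition line_mean (y : R) : \bar R := (\int[mu]_x (strip_ext (x, y))%:E)%E.

Lemma line_mean_ge0 y : (0 <= line_mean y)%E.
Proof. by apply: integral_ge0 => x _; rewrite lee_fin strip_ext_ge0. Qed.

Lemma measurable_line_mean : measurable_fun setT line_mean.
Proof.
apply: (@measurable_fun_fubini_tonelli_G _ _ _ _ _ mu (EFin \o strip_ext)).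
  by apply/measurable_EFinP; exact: measurable_strip_ext.
by move=> p; rewrite lee_fin strip_ext_ge0.
Qed.

Let AMGM (z w : R[i]) : `|complex.Re (z * w^*)| <= (cmod z ^+ 2 + cmod w ^+ 2) / 2 /\
  `|complex.Im (z * w^*)| <= (cmod z ^+ 2 + cmod w ^+ 2) / 2.
Proof.
have h : cmod (z * w^*) <= (cmod z ^+ 2 + cmod w ^+ 2) / 2.
  by rewrite cmodM cmodJ; have := sqr_ge0 (cmod z - cmod w); lra.
by split; [exact: le_trans (ler_Re_cmod _) h|exact: le_trans (ler_Im_cmod _) h].
Qed.

(* The function [w |-> F (w + i y) * conj (F (conj w + i y))] is holomorphic, equals
   [|F (x + i y)|^2] on the real line and [F (x + i (y + h)) * conj (F (x + i (y - h)))]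
   on the line [Im w = h]. *)
Lemma rect_shift (y h T1 T2 : R) : 0 < h -> S (y - h) -> S (y + h) -> T1 < T2 ->
  \int[mu]_(x in `[T1, T2]) u x y <=
    \int[mu]_(x in `[T1, T2]) ((u x (y + h) + u x (y - h)) / 2) +
    \int[mu]_(s in `[0, h]) ((u T2 (y + s) + u T2 (y - s)) / 2) +
    \int[mu]_(s in `[0, h]) ((u T1 (y + s) + u T1 (y - s)) / 2).
Proof.
move=> h0 S1 S2 T12.
have Ss s : 0 <= s <= h -> S (y + s) /\ S (y - s).
  move: S1 S2; rewrite /S /= !in_itv /= => /andP[a1 a2] /andP[a3 a4] /andP[a5 a6].
  by split; apply/andP; split; lra.
pose G (w : R[i]) := F (w + 0 +i* y) * (F (w^* + 0 +i* y))^*.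
pose U a b := complex.Re (G (a +i* b)); pose V a b := complex.Im (G (a +i* b)).
have GE a b : G (a +i* b) = F (a +i* (y + b)) * (F (a +i* (y - b)))^*.
  by rewrite /G /=; congr (F _ * (F _)^*); apply/eqP; rewrite eq_complex /= addr0 eqxx /= addrC.
have GD a b : 0 <= b <= h -> exists c, cdiff G (a +i* b) c.
  move=> /Ss[Sp Sm]; have [c1 H1] := HF a Sp; have [c2 H2] := HF a Sm.
  have sh (z : R[i]) : cdiff (fun w => w + 0 +i* y) z (1 + 0).
    exact: (cdiffD (cdiff_id z) (cdiff_cst (0 +i* y) z)).
  have H3 : cdiff (fun w => F (w + 0 +i* y)) (a +i* b) (c1 * (1 + 0)).
    apply: (cdiff_comp (sh _)); move: H1; congr (cdiff F _ _).
    by apply/eqP; rewrite eq_complex /= addr0 eqxx /= addrC.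
  have H4 : cdiff (fun w => F (w + 0 +i* y)) (a +i* b)^* (c2 * (1 + 0)).
    apply: (cdiff_comp (sh _)); move: H2; congr (cdiff F _ _).
    by apply/eqP; rewrite eq_complex /= addr0 eqxx /= addrC.
  by eexists; exact: (cdiffM H3 (cdiff_reflect H4)).
have UVd a b : 0 <= b <= h ->
    exists p q r, rdiff2 U a b p q /\ rdiff2 V a b (- q) r.
  move=> /(GD a)[c /cdiff_rdiff2[g1 g2]].
  by exists (complex.Re c), (- complex.Im c), (complex.Re c); rewrite opprK.
have l0 : 0 < T2 - T1 by rewrite subr_gt0.
have T2E : T1 + (T2 - T1) = T2 by rewrite addrC subrK.
have := @goursat_rect R U V T1 0 (T2 - T1) h l0 h0.
rewrite T2E !add0r => /(_ (fun a b _ hb => UVd a b hb)) GG.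
have b0 : 0 <= (0 : R) <= h by rewrite lexx ltW.
have bh : 0 <= h <= h by rewrite lexx ltW.
have cU b x : 0 <= b <= h -> {for x, continuous (U ^~ b)}.
  by move=> /(UVd x)[p [q [r [k _]]]]; exact: rdiff2_continuous_l k.
have cV a t : 0 <= t <= h -> {for t, continuous (V a)}.
  by move=> /(UVd a)[p [q [r [_ k]]]]; exact: rdiff2_continuous_r k.
have Uy x : U x 0 = u x y.
  rewrite /U GE addr0 subr0 /u sqr_cmod.
  by case: (F _) => a b /=; ring.
have [S0 _] := Ss 0 b0; rewrite addr0 in S0.
have iU b : 0 <= b <= h -> mu.-integrable `[T1, T2] (EFin \o (U ^~ b)).
  by move=> hb; apply: continuous_itv_integrable => x _; exact: cU.
have iV a : mu.-integrable `[0, h] (EFin \o (V a)).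
  by apply: continuous_itv_integrable => t; exact: cV.
have iu : mu.-integrable `[T1, T2] (EFin \o (fun x => (u x (y + h) + u x (y - h)) / 2)).
  apply: continuous_itv_integrable => x _; apply: cvgM; last exact: cvg_cst.
  by apply: cvgD; exact: cu_l.
have iv a : mu.-integrable `[0, h] (EFin \o (fun s => (u a (y + s) + u a (y - s)) / 2)).
  apply: continuous_itv_integrable => s /Ss[Sp Sm]; apply: cvgM; last exact: cvg_cst.
  apply: cvgD.
    by apply: (@cu_r a s (fun s => y + s)) => //; apply: cvgD; [exact: cvg_cst|exact: cvg_id].
  by apply: (@cu_r a s (fun s => y - s)) => //; apply: cvgB; [exact: cvg_cst|exact: cvg_id].
(* Goursat trades the base for the top edge and the two vertical sides. On each of them the modulus
   of the product is at most the mean of the two squares, by [AMGM]. *)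
have E1 : \int[mu]_(x in `[T1, T2]) u x y = \int[mu]_(x in `[T1, T2]) U x h +
    (\int[mu]_(s in `[0, h]) V T2 s - \int[mu]_(s in `[0, h]) V T1 s).
  rewrite -RintegralB // -GG RintegralB //; [|exact: iU|exact: iU].
  rewrite addrC subrK; apply: eq_Rintegral => x _; exact/esym/Uy.
rewrite E1 -addrA lerD //.
  apply: le_Rintegral => //; first exact: iU.
  move=> x _; rewrite (le_trans (ler_norm _)) // /U GE.
  by have [] := AMGM (F (x +i* (y + h))) (F (x +i* (y - h))).
have bV a : `|\int[mu]_(s in `[0, h]) V a s| <=
    \int[mu]_(s in `[0, h]) ((u a (y + s) + u a (y - s)) / 2).
  apply: le_trans (le_normr_Rintegral _ (iV a)) _ => //.
  apply: le_Rintegral => //.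
    by apply: continuous_itv_integrable => s hs; apply: cvg_norm; exact: cV.
  move=> s _; rewrite /V GE.
  by have [] := AMGM (F (a +i* (y + s))) (F (a +i* (y - s))).
rewrite lerD //; first exact: le_trans (ler_norm _) (bV T2).
by rewrite (le_trans _ (bV T1)) // -normrN ler_norm.
Qed.

Let mstripc (y : R) : measurable_fun setT (fun x => strip_ext (x, y)).
Proof.
apply: (measurableT_comp measurable_strip_ext).
by apply: measurable_fun_pair => //; exact: measurable_cst.
Qed.

Let EFin_Rint (f : R -> R) (a b : R) : mu.-integrable `[a, b] (EFin \o f) ->
  (\int[mu]_(x in `[a, b]) f x)%:E = (\int[mu]_(x in `[a, b]) (f x)%:E)%E.
Proof. by move=> i; rewrite fineK //; exact: integrable_fin_num. Qed.

(** Were [f] at least [e] on all of [D], its integral would be infinite. This provides distant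
    abscissas at which the vertical sides are negligible. *)
Let exists_small (f : R -> \bar R) (D : set R) (e : R) : measurable D -> @lebesgue_measure R D = +oo%E ->
  (forall x, 0 <= f x)%E -> measurable_fun setT f -> (\int[mu]_x f x < +oo)%E -> 0 < e ->
  exists2 x, D x & (f x < e%:E)%E.
Proof.
move=> mD Doo f0 mf foo e0; apply: contrapT => h.
have fe x : D x -> (e%:E <= f x)%E.
  by move=> Dx; rewrite leNgt; apply/negP => fx; apply: h; exists x.
have : (\int[mu]_(x in D) (cst e%:E) x <= \int[mu]_x f x)%E.
  apply: (@le_trans _ _ (\int[mu]_(x in D) f x)%E).
    apply: ge0_le_integral => //; first by move=> x _; rewrite lee_fin ltW.
    exact: measurable_funTS.
  by apply: ge0_subset_integral.
rewrite integral_cst //= Doo gt0_muley ?lte_fin // leye_eq => /eqP E.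
by rewrite E ltxx in foo.
Qed.

Let S_itv (y h s : R) : S (y - h) -> S (y + h) -> 0 <= s <= h -> S (y + s) /\ S (y - s).
Proof.
rewrite /S /= !in_itv /= => /andP[a1 a2] /andP[a3 a4] /andP[a5 a6].
by split; apply/andP; split; lra.
Qed.

(** Up to a factor 1/2, the integrand bounding a vertical side in [rect_shift], cut off to [0, h] so
    that it lives on the plane. *)
Let side (y h : R) (p : R * R) : R :=
  \1_`[0, h] p.2 * (strip_ext (p.1, y + p.2) + strip_ext (p.1, y - p.2)).

Let side_ge0 y h p : (0 <= (EFin \o side y h) p)%E.
Proof. by rewrite lee_fin mulr_ge0 ?addr_ge0 ?strip_ext_ge0 // indicE ler0n. Qed.

Let measurable_side y h : measurable_fun setT (EFin \o side y h).
Proof.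
apply/measurable_EFinP; apply: measurable_funM.
  by apply: (measurableT_comp (measurable_indic (measurable_itv `[0, h]))).
apply: measurable_funD; apply: (measurableT_comp measurable_strip_ext);
  apply: measurable_fun_pair => //.
  by apply: measurable_funD => //; exact: measurable_cst.
by apply: measurable_funB => //; exact: measurable_cst.
Qed.

Let sideE y h T : S (y - h) -> S (y + h) -> (\int[mu]_s (side y h (T, s))%:E =
  \int[mu]_(s in `[0%R, h]) (u T (y + s) + u T (y - s))%:E)%E.
Proof.
move=> S1 S2; rewrite [RHS]integral_mkcond; apply: eq_integral => s _; rewrite /patch /side /= indicE.
case: ifPn => [/set_mem|_]; last by rewrite mul0r.
by rewrite /= in_itv /= => /(S_itv S1 S2)[Sp Sm]; rewrite mul1r !strip_extE.
Qed.

Let side_tonelli y h : (\int[mu]_T \int[mu]_s (side y h (T, s))%:E =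
  \int[mu]_(s in `[0%R, h]) (line_mean (y + s) + line_mean (y - s)))%E.
Proof.
rewrite (@fubini_tonelli _ _ _ _ _ mu mu (EFin \o side y h) (measurable_side y h) (side_ge0 y h)).
rewrite [RHS]integral_mkcond; apply: eq_integral => s _.
rewrite /patch /side /= indicE; case: ifPn => _; last first.
  by rewrite integral0_eq // => x _; rewrite mul0r.
under eq_integral do rewrite mul1r EFinD.
rewrite ge0_integralD //.
- by move=> x _; rewrite lee_fin strip_ext_ge0.
- by apply/measurable_EFinP; apply: mstripc.
- by move=> x _; rewrite lee_fin strip_ext_ge0.
- by apply/measurable_EFinP; apply: mstripc.
Qed.

(** By Tonelli, the finiteness hypothesis says that the side integrals [Sig T] are integrable in T.
    They are thus small somewhere to the right and somewhere to the left of any bounded interval,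
    and [rect_shift] between two such abscissas leaves only the horizontal edges. *)
Lemma line_mean_midpoint (y h : R) : 0 < h -> S (y - h) -> S (y + h) ->
  (\int[mu]_(s in `[0%R, h]) (line_mean (y + s) + line_mean (y - s)) < +oo)%E ->
  (line_mean y <= (2^-1)%:E * (line_mean (y + h) + line_mean (y - h)))%E.
Proof.
move=> h0 S1 S2 Soo.
have Ss s := @S_itv y h s S1 S2.
have [S0 _] := Ss 0 (introT andP (conj (lexx 0) (ltW h0))); rewrite addr0 in S0.
pose Sig T := (\int[mu]_s (side y h (T, s))%:E)%E.
have SigE T : Sig T = (\int[mu]_(s in `[0%R, h]) (u T (y + s) + u T (y - s))%:E)%E by exact: sideE.
have mSig : measurable_fun setT Sig.
  exact: (@measurable_fun_fubini_tonelli_F _ _ _ _ _ mu (EFin \o side y h) (measurable_side y h) (side_ge0 y h)).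
have Sig0 T : (0 <= Sig T)%E by apply: integral_ge0 => s _; exact: side_ge0.
have SigI : (\int[mu]_T Sig T < +oo)%E by rewrite /Sig side_tonelli.
have iu n y' : S y' -> mu.-integrable `[- n, n] (EFin \o (fun x => u x y')).
  by move=> Sy'; apply: continuous_itv_integrable => x _; exact: cu_l.
(* [T1] and [T2] are chosen outside ]-(n + 1), n + 1[ with [Sig] below [e], so each side costs at
   most e / 2. *)
have key (n : nat) : (\int[mu]_(x in `[(- n.+1%:R)%R, n.+1%:R]) (strip_ext (x, y))%:E <=
    (2^-1)%:E * (line_mean (y + h) + line_mean (y - h)))%E.
  apply/lee_addgt0Pr => e e0.
  have my1 : @lebesgue_measure R `[n.+1%:R, +oo[%classic = +oo%E.
    by rewrite lebesgue_measure_itv /= ltry.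
  have [T2] := exists_small (measurable_itv _) my1 Sig0 mSig SigI e0.
  rewrite /= in_itv /= andbT => nT2 SigT2.
  have my2 : @lebesgue_measure R `]-oo, (- n.+1%:R)%R]%classic = +oo%E.
    by rewrite lebesgue_measure_itv /= ltNyr.
  have [T1] := exists_small (measurable_itv _) my2 Sig0 mSig SigI e0.
  rewrite /= in_itv /= => nT1 SigT1.
  have n0 : 0 < n.+1%:R :> R by rewrite ltr0n.
  have T12 : T1 < T2 by move: (n.+1%:R : R) n0 nT1 nT2 => v ? ? ?; lra.
  have iT y' : S y' -> mu.-integrable `[T1, T2] (EFin \o (fun x => u x y')).
    by move=> Sy'; apply: continuous_itv_integrable => x _; exact: cu_l.
  have csum a s : 0 <= s <= h -> {for s, continuous (fun s => u a (y + s) + u a (y - s))}.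
    move=> /Ss[Sp Sm]; apply: cvgD.
      by apply: (@cu_r a s (fun s => y + s)) => //; apply: cvgD; [exact: cvg_cst|exact: cvg_id].
    by apply: (@cu_r a s (fun s => y - s)) => //; apply: cvgB; [exact: cvg_cst|exact: cvg_id].
  have isum a : mu.-integrable `[0, h] (EFin \o (fun s => (u a (y + s) + u a (y - s)) / 2)).
    by apply: continuous_itv_integrable => s hs; apply: cvgM; [exact: csum|exact: cvg_cst].
  have im : mu.-integrable `[T1, T2] (EFin \o (fun x => (u x (y + h) + u x (y - h)) / 2)).
    apply: continuous_itv_integrable => x _; apply: cvgM; last exact: cvg_cst.
    by apply: cvgD; exact: cu_l.
  apply: (@le_trans _ _ (\int[mu]_(x in `[T1, T2]) (u x y)%:E)%E).
    apply: (@le_trans _ _ (\int[mu]_(x in `[T1, T2]) (strip_ext (x, y))%:E)%E).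
      apply: ge0_subset_integral => //.
      - by apply: measurable_funTS; apply/measurable_EFinP; exact: mstripc.
      - by move=> x _; rewrite lee_fin strip_ext_ge0.
      - by apply: subset_itv; rewrite bnd_simp.
    by rewrite le_eqVlt; apply/orP; left; apply/eqP/eq_integral => x _; rewrite strip_extE.
  have := rect_shift h0 S1 S2 T12.
  rewrite -lee_fin !EFinD !EFin_Rint //; last exact: iT.
  move/le_trans; apply.
  have half T : (Sig T < e%:E)%E ->
      (\int[mu]_(s in `[0%R, h]) ((u T (y + s) + u T (y - s)) / 2)%:E <= (e / 2)%:E)%E.
    move=> ST; under eq_integral do rewrite mulrC EFinM.
    rewrite ge0_integralZl_EFin //.
    - by rewrite -SigE mulrC EFinM lee_wpmul2l ?lee_fin ?invr_ge0 // ltW.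
    - by move=> s _; rewrite lee_fin addr_ge0.
    - apply: (measurable_int mu (continuous_itv_integrable _)).
      exact: csum.
  rewrite -addeA; apply: leeD; last first.
    by rewrite [e in leRHS]splitr EFinD leeD // half.
  apply: (@le_trans _ _ (\int[mu]_x ((2^-1)%:E * ((strip_ext (x, y + h))%:E + (strip_ext (x, y - h))%:E)))%E).
    apply: (@le_trans _ _ (\int[mu]_(x in `[T1, T2]) ((2^-1)%:E * ((strip_ext (x, y + h))%:E + (strip_ext (x, y - h))%:E)))%E).
      rewrite le_eqVlt; apply/orP; left; apply/eqP/eq_integral => x _.
      by rewrite !strip_extE // -EFinD -EFinM mulrC.
    apply: ge0_subset_integral => //.
      by apply/measurable_EFinP; apply: measurable_funM; [exact: measurable_cst|apply: measurable_funD; exact: mstripc].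
    by move=> x _; rewrite -EFinD -EFinM lee_fin mulr_ge0 ?invr_ge0 // addr_ge0 // strip_ext_ge0.
  rewrite ge0_integralZl_EFin ?invr_ge0 //.
  - rewrite ge0_integralD //.
    + by move=> x _; rewrite lee_fin strip_ext_ge0.
    + by apply/measurable_EFinP; apply: mstripc.
    + by move=> x _; rewrite lee_fin strip_ext_ge0.
    + by apply/measurable_EFinP; apply: mstripc.
  - by move=> x _; rewrite -EFinD lee_fin addr_ge0 // strip_ext_ge0.
  - by apply: emeasurable_funD; apply/measurable_EFinP; exact: mstripc.
have setTE : [set: R] = \bigcup_n `[- n.+1%:R, n.+1%:R]%classic.
  apply/seteqP; split => // x _.
  exists (Num.truncn `|x|) => //=; rewrite in_itv /= -ler_norml ltW //.
  exact: truncnS_gt.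
have LB : (\int[mu]_(x in `[(- n.+1%:R)%R, n.+1%:R]) (strip_ext (x, y))%:E @[n --> \oo] --> line_mean y)%E.
  rewrite /line_mean setTE; apply: ge0_nondecreasing_set_cvg_integral => //.
  - move=> m n mn; apply/subsetPset; apply: subset_itv; rewrite bnd_simp ?lerN2 ler_nat //.
  - by move=> n; apply: measurable_funTS; apply/measurable_EFinP; exact: mstripc.
  - by move=> n x _; rewrite lee_fin strip_ext_ge0.
rewrite -(cvg_lim _ LB) //; apply: lime_le; first by apply/cvg_ex; eexists; exact: LB.
exact: nearW.
Qed.

End StripConvexity.

(** * Chebyshev's inequality against powers of the cosine *)

Section LebesgueInvariance.
Variable R : realType.
Let mu := @lebesgue_measure R.
Local Open Scope ereal_scope.

Lemma ge0_integral_opp (f : R -> \bar R) : measurable_fun setT f -> (forall x, 0 <= f x) ->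
  \int[mu]_x f (- x)%R = \int[mu]_x f x.
Proof.
move=> mf f0.
transitivity (\int[pushforward mu (-%R : R -> measurableTypeR R)]_x f x).
  by rewrite ge0_integral_pushforward.
by apply: eq_measure_integral => //= A mA _; exact: lebesgue_measureN.
Qed.

Lemma lebesgue_measureD (a : R) (A : set R) : measurable A ->
  pushforward mu (fun x : measurableTypeR R => (a + x)%R : measurableTypeR R) A = mu A.
Proof.
move=> mA; have mD : measurable_fun setT (fun x : measurableTypeR R => (a + x)%R : measurableTypeR R).
  by apply: measurable_funD => //; exact: measurable_cst.
apply/esym/lebesgue_measure_unique => //= _ [[b c]] _ <-.
rewrite /pushforward (_ : _ @^-1` _ = `](b - a)%R, (c - a)%R]%classic); last first.
  by apply/seteqP; split => x /=; rewrite !in_itv /= => /andP[? ?]; apply/andP; split; lra.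
rewrite /mu !lebesgue_measure_itv /= !lte_fin ltrD2r.
by case: ifPn => // _; rewrite -!EFinB; congr EFin; lra.
Qed.

Lemma ge0_integral_translate (a : R) (f : R -> \bar R) :
  measurable_fun setT f -> (forall x, 0 <= f x) ->
  \int[mu]_x f (a + x)%R = \int[mu]_x f x.
Proof.
move=> mf f0; have mD : measurable_fun setT (fun x : measurableTypeR R => (a + x)%R : measurableTypeR R).
  by apply: measurable_funD => //; exact: measurable_cst.
transitivity (\int[pushforward mu (fun x : measurableTypeR R => (a + x)%R : measurableTypeR R)]_x f x).
  by rewrite ge0_integral_pushforward.
by apply: eq_measure_integral => //= A mA _; exact: lebesgue_measureD.
Qed.

(** Rewrites the finiteness hypothesis of [line_mean_midpoint] as integrability of the line means on
    an interval centred at y. *)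
Lemma ge0_integral_sym_sum (M : R -> \bar R) (y h : R) : (0 < h)%R ->
  measurable_fun setT M -> (forall x, 0 <= M x) ->
  \int[mu]_(s in `[0%R, h]) (M (y + s)%R + M (y - s)%R) =
  \int[mu]_(s in `[(y - h)%R, (y + h)%R]) M s.
Proof.
move=> h0 mM M0.
have mMp : measurable_fun setT (fun s : R => M (y + s)%R).
  by apply: (measurableT_comp mM); apply: measurable_funD => //; exact: measurable_cst.
have mMm : measurable_fun setT (fun s : R => M (y - s)%R).
  by apply: (measurableT_comp mM); apply: measurable_funB => //; exact: measurable_cst.
rewrite ge0_integralD //; try exact: measurable_funTS.
have mr (D : set R) : measurable D -> measurable_fun setT (M \_ D).
  by move=> mD; apply: (measurable_restrictT _ mD).1; exact: measurable_funTS.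
have r0 (D : set R) x : 0 <= (M \_ D) x by rewrite /patch; case: ifP.
have -> : \int[mu]_(s in `[0%R, h]) M (y + s)%R = \int[mu]_(s in `[y, (y + h)%R]) M s.
  rewrite [RHS]integral_mkcond -(ge0_integral_translate y) //; last exact: mr.
  rewrite integral_mkcond; apply: eq_integral => s _; rewrite /patch.
  by congr (if _ then _ else _); apply/idP/idP => /set_mem /=; rewrite in_itv /= => /andP[? ?];
    apply/mem_set; rewrite /= in_itv /=; apply/andP; split; lra.
have -> : \int[mu]_(s in `[0%R, h]) M (y - s)%R = \int[mu]_(s in `[(y - h)%R, y]) M s.
  rewrite [RHS]integral_mkcond -(ge0_integral_translate y) //; last exact: mr.
  rewrite -ge0_integral_opp //; last first.
    apply: (measurableT_comp (mr _ (measurable_itv _))).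
    by apply: measurable_funD => //; exact: measurable_cst.
  rewrite integral_mkcond; apply: eq_integral => s _; rewrite /patch.
  by congr (if _ then _ else _); apply/idP/idP => /set_mem /=; rewrite in_itv /= => /andP[? ?];
    apply/mem_set; rewrite /= in_itv /=; apply/andP; split; lra.
have spl : `[(y - h)%R, (y + h)%R]%classic = `[(y - h)%R, y]%classic `|` `]y, (y + h)%R]%classic :> set R.
  by apply: itv_bndbnd_setU; rewrite bnd_simp ?gerBl ?lerDl ltW.
rewrite [in RHS]spl ge0_integral_setU //.
- by rewrite addeC integral_itv_obnd_cbnd //; exact: measurable_funTS.
- exact: measurable_funTS.
- by apply/disj_setPS => s [/=]; rewrite !in_itv /= => /andP[_ sy] /andP[]; rewrite ltNge sy.
Qed.

End LebesgueInvariance.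

(** * Monotone symmetrization and Chebyshev's inequality *)

Section SymmetricChebyshev.
Variable R : realType.
Let mu := @lebesgue_measure R.
Let S : set R := `]- (pi / 2), pi / 2[%classic.

Variable M : R -> \bar R.
Hypothesis M0 : forall y, (0 <= M y)%E.
Hypothesis mM : measurable_fun setT M.
Hypothesis Mmid : forall y h : R, 0 < h -> S (y - h) -> S (y + h) ->
  (\int[mu]_(s in `[(y - h)%R, (y + h)%R]) M s < +oo)%E ->
  (M y <= (2^-1)%:E * (M (y + h) + M (y - h)))%E.

Let SE y : S y <-> `|y| < pi / 2.
Proof. by rewrite /S /= in_itv /= ltr_norml; split. Qed.

Let mMs (D : set R) : measurable_fun D M. Proof. exact: measurable_funTS. Qed.

Let mMN : measurable_fun setT (fun y : R => M (- y)).
Proof. by apply: (measurableT_comp mM); exact: oppr_measurable. Qed.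

Variable alpha : R.
Hypothesis HX : (\int[mu]_(y in S) ((cos y `^ alpha)%:E * M y) < +oo)%E.

Let mcos (a : R) : measurable_fun setT (fun y : R => (cos y `^ a)%:E).
Proof.
apply/measurable_EFinP; apply: (measurableT_comp (measurable_powR a)).
by apply: continuous_measurable_fun; exact: continuous_cos.
Qed.

Let mwM (a : R) (D : set R) (f : R -> \bar R) : measurable_fun D f ->
  measurable_fun D (fun y => (cos y `^ a)%:E * f y)%E.
Proof. by move=> mf; apply: emeasurable_funM => //; exact: measurable_funTS (mcos a). Qed.

Let cos_le (r s : R) : `|s| <= r -> r < pi / 2 -> cos r <= cos s.
Proof.
move=> sr rp; rewrite -(cos_norm s); have [->//|ne] := eqVneq `|s| r.
have p := pi_gt0 R; have s0 := normr_ge0 s.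
have rI : r \in `[0, pi] by rewrite in_itv /=; apply/andP; split; lra.
have sI : `|s| \in `[0, pi] by rewrite in_itv /=; apply/andP; split; lra.
by apply: ltW; rewrite ltr_cos // lt_neqAle ne.
Qed.

Let M_locint (r : R) : 0 < r -> r < pi / 2 -> (\int[mu]_(s in `[(- r)%R, r]) M s < +oo)%E.
Proof.
(* A lower bound of the weight on [-r, r]: cos r ^ alpha serves when alpha >= 0, and 1 when alpha <
   0. *)
move=> r0 rp; pose c := Num.min 1 (cos r `^ alpha).
have cr0 : 0 < cos r by apply: cos_gt0_pihalf; apply/andP; split; lra.
have c0 : 0 < c by rewrite lt_min ltr01 powR_gt0.
have sub (s : R) : s \in `[- r, r] -> S s.
  by rewrite /S /= !in_itv /= => /andP[? ?]; apply/andP; split; lra.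
have cle (s : R) : `|s| <= r -> c <= cos s `^ alpha.
  move=> sr; have crs := cos_le sr rp.
  have cs0 : 0 < cos s by exact: lt_le_trans crs.
  have [a0|a0] := leP 0 alpha.
    rewrite (le_trans (_ : c <= cos r `^ alpha)) //; first by rewrite ge_min lexx orbT.
    by rewrite ge0_ler_powR // nnegrE ltW.
  rewrite (le_trans (_ : c <= 1)) //; first by rewrite ge_min lexx.
  by rewrite -(powRr0 (cos s)) ger_powR ?cs0 ?cos_le1 // ltW.
have : (c%:E * \int[mu]_(s in `[(- r)%R, r]) M s <= \int[mu]_(y in S) ((cos y `^ alpha)%:E * M y))%E.
  rewrite -ge0_integralZl_EFin // ?(ltW c0) //; last exact: mMs.
  apply: (@le_trans _ _ (\int[mu]_(y in `[(- r)%R, r]) ((cos y `^ alpha)%:E * M y))%E).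
    apply: ge0_le_integral => //.
    - by move=> y _; rewrite mule_ge0 // lee_fin ltW.
    - by apply: emeasurable_funM; [exact: measurable_cst|exact: mMs].
    - by apply: mwM; exact: mMs.
    - move=> y /=; rewrite in_itv /= -ler_norml => /cle cy.
      by rewrite lee_wpmul2r // lee_fin.
  apply: ge0_subset_integral => //.
  - exact: measurable_itv.
  - by apply: mwM; exact: mMs.
  - by move=> y _; rewrite mule_ge0 // lee_fin powR_ge0.
move=> h; have {}h := le_lt_trans h HX.
rewrite ltNge leye_eq; apply/negP => /eqP E.
by rewrite E gt0_muley ?lte_fin // ltxx in h.
Qed.

Let Mmid' y h : 0 < h -> S (y - h) -> S (y + h) ->
  (M y <= (2^-1)%:E * (M (y + h) + M (y - h)))%E.
Proof.
move=> h0 S1 S2; apply: Mmid => //.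
pose r := Num.max `|y - h| `|y + h|.
have rp : r < pi / 2 by rewrite gt_max; apply/andP; split; exact/SE.
have r1 : `|y - h| <= r by rewrite le_max lexx.
have r2 : `|y + h| <= r by rewrite le_max lexx orbT.
have r0 : 0 < r by move: r1 r2; rewrite !ler_norml => /andP[? ?] /andP[? ?]; lra.
apply: le_lt_trans (M_locint r0 rp); apply: ge0_subset_integral => //; first exact: mMs.
apply: subset_itv; rewrite bnd_simp.
  by move: r1; rewrite ler_norml => /andP[].
by move: r2; rewrite ler_norml => /andP[].
Qed.

(** Convexity turns an integral bound into a pointwise one: integrating the midpoint inequality over
    the steps t in [0, h] bounds h M(y) by the integral of M over [y - h, y + h]. *)
Let M_bounded (r : R) : 0 < r -> r < pi / 2 -> exists K : R, forall y : R, `|y| <= r -> (M y <= K%:E)%E.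
Proof.
(* Half the distance to the edge, so that [y - h, y + h] stays inside [-(r + h), r + h], a compact
   part of [S]. *)
move=> r0 rp; pose h := (pi / 2 - r) / 2.
have h0 : 0 < h by rewrite divr_gt0 // subr_gt0.
have rh : r + h < pi / 2 by rewrite /h; lra.
have rh0 : 0 < r + h by rewrite addr_gt0.
have := M_locint rh0 rh; set I := (\int[mu]_(s in _) M s)%E => Ioo.
have I0 : (0 <= I)%E by exact: integral_ge0.
have If : I = (fine I)%:E by rewrite fineK // ge0_fin_numE.
exists (fine I / h) => y yr.
have yr' : - r <= y <= r by rewrite -ler_norml.
have key : (h%:E * M y <= I)%E.
  have -> : (h%:E * M y = \int[mu]_(t in `[0%R, h]) cst (M y) t)%E.
    by rewrite integral_cst //= lebesgue_measure_itv /= lte_fin h0 sube0 muleC.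
  apply: (@le_trans _ _ (\int[mu]_(t in `[0%R, h]) (M (y + t) + M (y - t)))%E).
    apply: ge0_le_integral => //.
    - by move=> t _; exact: M0.
    - apply: emeasurable_funD; apply: measurable_funTS; apply: (measurableT_comp mM).
        by apply: measurable_funD => //; exact: measurable_cst.
      by apply: measurable_funB => //; exact: measurable_cst.
    - move=> t /=; rewrite in_itv /= => /andP[]; rewrite le_eqVlt => /predU1P[<- _|t0 th].
        by rewrite addr0 subr0 leeDl.
      apply: (@le_trans _ _ ((2^-1)%:E * (M (y + t) + M (y - t)))%E).
        case/andP: yr' => ? ?.
        by apply: Mmid' => //; apply/SE; rewrite ltr_norml; apply/andP; split; lra.
      rewrite -[leRHS]mul1e lee_wpmul2r ?adde_ge0 // lee_fin invf_le1 // ler1n //.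
  rewrite ge0_integral_sym_sum //; apply: ge0_subset_integral => //; first exact: mMs.
  by case/andP: yr' => ? ?; apply: subset_itv; rewrite bnd_simp; lra.
rewrite If in key; rewrite -(@lee_pmul2l _ h%:E) ?lte_fin //.
by rewrite (le_trans key) // -EFinM lee_fin mulrC divfK ?gt_eqF.
Qed.

Let M_fin y : S y -> M y \is a fin_num.
Proof.
move=> /SE yp; have [r [r0 rp yr]] : exists r, [/\ 0 < r, r < pi / 2 & `|y| <= r].
  by exists ((`|y| + pi / 2) / 2); have := pi_gt0 R; have := normr_ge0 y; split; lra.
have [K HK] := M_bounded r0 rp.
by rewrite ge0_fin_numE // (le_lt_trans (HK y yr)) // ltry.
Qed.

Let N y := fine (M y) + fine (M (- y)).

Let NN y : N (- y) = N y. Proof. by rewrite /N opprK addrC. Qed.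

Let N_norm y : N `|y| = N y.
Proof. by have [y0|y0] := leP 0 y; rewrite ?(ger0_norm y0) ?(ltr0_norm y0) ?NN. Qed.

Let fine_mid y h : 0 < h -> S (y - h) -> S (y + h) ->
  fine (M y) <= (fine (M (y + h)) + fine (M (y - h))) / 2.
Proof.
move=> h0 S1 S2; have := Mmid' h0 S1 S2.
have Sy : S y.
  by move: S1 S2; rewrite /S /= !in_itv /= => /andP[? ?] /andP[? ?]; apply/andP; split; lra.
rewrite -(fineK (M_fin Sy)) -(fineK (M_fin S1)) -(fineK (M_fin S2)).
by rewrite -EFinD -EFinM lee_fin mulrC.
Qed.

(* If [B] is the supremum of [N] over [-r, r] then the midpoint inequality
   between [r] and [2 y - r] gives [2 B <= N r + B]. *)
Let N_le y r : `|y| <= r -> r < pi / 2 -> N y <= N r.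
Proof.
move=> yr rp; have r0 : 0 <= r by exact: le_trans yr.
have [rz|rn0] := eqVneq r 0.
  by move: yr; rewrite rz normr_le0 => /eqP ->.
have {}r0 : 0 < r by rewrite lt0r rn0.
pose A := [set N t | t in [set t : R | `|t| <= r]].
have [K HK] := M_bounded r0 rp.
have inS (t : R) : `|t| <= r -> S t by move=> tr; apply/SE; exact: le_lt_trans rp.
have ubA : ubound A (K + K).
  move=> _ [t /= tr <-]; apply: lerD; rewrite -lee_fin fineK ?HK ?normrN //; apply: M_fin.
    exact: inS.
  by apply: inS; rewrite normrN.
have hA : has_ubound A by exists (K + K).
have ler (t : R) : `|t| <= r -> N t <= sup A by move=> tr; apply: (ub_le_sup hA); exists t.
suff sA : sup A <= (N r + sup A) / 2 by have := ler y yr; lra.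
apply: ge_sup; first by exists (N 0); exists 0 => //=; rewrite normr0 ltW.
move=> _ [t /= tr <-]; rewrite -N_norm; have [->|ne] := eqVneq `|t| r.
  have : `|r| <= r by rewrite ger0_norm // ltW.
  by move/ler; lra.
have {ne}tr : `|t| < r by rewrite lt_neqAle ne.
set s := `|t| in tr *; have s0 : 0 <= s := normr_ge0 _.
have h0 : 0 < r - s by rewrite subr_gt0.
have e1 : s + (r - s) = r by ring.
have e2 : s - (r - s) = s *+ 2 - r by rewrite mulr2n; ring.
have e3 : - s + (r - s) = - (s *+ 2 - r) by rewrite mulr2n; ring.
have e4 : - s - (r - s) = - r by ring.
have b2 : `|s *+ 2 - r| <= r by rewrite mulr2n ler_norml; apply/andP; split; lra.
have b1 : `|r| <= r by rewrite ger0_norm // ltW.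
have := @fine_mid s _ h0; rewrite e1 e2 => /(_ (inS _ b2) (inS _ b1)).
have := @fine_mid (- s) _ h0; rewrite e3 e4.
move=> /(_ (inS _ _) (inS _ _)); rewrite !normrN => /(_ b1 b2).
by have := ler _ b2; rewrite /N; lra.
Qed.

(** Let k = Jb / Ja and let y0 satisfy cos(y0)^(beta - alpha) = k. As N increases with |y| and the
    cosine decreases, (N y - N y0) (k - cos(y)^(beta - alpha)) is nonnegative on both sides of |y| =
    y0. Integrating it against cos(y)^alpha gives the claim for N, hence for M since the weights are
    even. *)
Lemma symmetric_chebyshev (beta Ja Jb : R) : alpha < beta -> 0 < Ja -> 0 < Jb ->
  (\int[mu]_(y in S) (cos y `^ alpha)%:E = Ja%:E)%E ->
  (\int[mu]_(y in S) (cos y `^ beta)%:E = Jb%:E)%E ->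
  (\int[mu]_(y in S) ((cos y `^ beta)%:E * M y) <=
   (Jb / Ja)%:E * \int[mu]_(y in S) ((cos y `^ alpha)%:E * M y))%E.
Proof.
move=> ab Ja0 Jb0 JaE JbE; pose k := Jb / Ja.
have k0 : 0 < k by rewrite divr_gt0.
have mS : measurable S by exact: measurable_itv.
have g0 : 0 < beta - alpha by rewrite subr_gt0.
have c0 y : S y -> 0 < cos y by move=> Sy; apply: cos_gt0_pihalf; rewrite /S /= in_itv in Sy.
have cD y : S y -> cos y `^ beta = cos y `^ alpha * cos y `^ (beta - alpha).
  move=> /c0 cy0; have cn : cos y != 0 by rewrite gt_eqF.
  by rewrite -powRD ?cn ?implybT // addrC subrK.
(* Hence [q] is at most 1 and [acos q] is a genuine angle. *)
have k1 : k <= 1.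
  rewrite ler_pdivrMr // mul1r -lee_fin -JaE -JbE; apply: ge0_le_integral => //.
  - by move=> y _; rewrite lee_fin powR_ge0.
  - exact: measurable_funTS (mcos _).
  - exact: measurable_funTS (mcos _).
  - move=> y Sy; rewrite lee_fin; apply: ger_powR; last exact: ltW.
    by rewrite c0 // cos_le1.
pose q := k `^ (beta - alpha)^-1.
have q0 : 0 < q by rewrite powR_gt0.
have q1 : q <= 1.
  have <- : 1 `^ (beta - alpha)^-1 = 1 :> R by rewrite powR1.
  by rewrite ge0_ler_powR ?nnegrE ?invr_ge0 ?(ltW k0) ?(ltW g0).
have qk : q `^ (beta - alpha) = k.
  by rewrite -powRrM mulVf ?gt_eqF // powRr1 // ltW.
have qN1 : -1 <= q by rewrite (le_trans _ (ltW q0)) // lerN10.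
pose y0 := acos q.
have cy0 : cos y0 = q by rewrite acosK // in_itv /= qN1.
have y00 : 0 <= y0 by rewrite acos_ge0 // qN1.
have y0p : y0 < pi / 2.
  rewrite ltNge; apply/negP => h; have := acos_lepi; move/(_ R q); rewrite qN1 q1 => /(_ isT) h2.
  have : cos y0 <= 0.
    rewrite -[y0](subrK pi) cosDpi oppr_le0; apply: cos_ge0_pihalf.
    by rewrite -/y0 in h2; have p := pi_gt0 R; apply/andP; split; lra.
  by rewrite cy0 leNgt q0.
have n00 : 0 <= N y0 by rewrite addr_ge0 // fine_ge0.
(* The pointwise inequality with every term moved to the side where it is nonnegative, so that it
   integrates in the extended reals without subtraction. *)
have pt y : S y -> cos y `^ beta * N y + k * N y0 * cos y `^ alpha <=
    k * cos y `^ alpha * N y + N y0 * cos y `^ beta.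
  move=> Sy; rewrite cD //; set a := cos y `^ alpha; set c := cos y `^ _.
  have a0 : 0 <= a by exact: powR_ge0.
  suff : 0 <= a * ((N y - N y0) * (k - c)) by lra.
  rewrite mulr_ge0 //; have yp := (SE y).1 Sy.
  have [yy|/ltW yy] := leP `|y| y0.
    rewrite mulr_le0 // subr_le0; first exact: N_le.
    rewrite -qk /c ge0_ler_powR ?nnegrE ?(ltW g0) ?(ltW q0) ?(ltW (c0 _ Sy)) //.
    by rewrite -cy0; exact: cos_le.
  rewrite mulr_ge0 // subr_ge0.
    by rewrite -(N_norm y); apply: N_le => //; rewrite ger0_norm.
  rewrite -qk /c ge0_ler_powR ?nnegrE ?(ltW g0) ?(ltW q0) ?(ltW (c0 _ Sy)) //.
  by rewrite -cy0 -(cos_norm y); apply: cos_le => //; rewrite ger0_norm.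
have refl a : (\int[mu]_(y in S) ((cos y `^ a)%:E * M (- y)%R) =
    \int[mu]_(y in S) ((cos y `^ a)%:E * M y))%E.
  pose f := (fun y => (cos y `^ a)%:E * M y)%E \_ S.
  have mf : measurable_fun setT f.
    by apply: (measurable_restrictT _ mS).1; apply: emeasurable_funM => //; exact: measurable_funTS.
  have f0 y : (0 <= f y)%E.
    by rewrite /f /patch; case: ifP => // _; rewrite mule_ge0 // lee_fin powR_ge0.
  rewrite [RHS]integral_mkcond -/f -ge0_integral_opp //.
  rewrite integral_mkcond; apply: eq_integral => y _; rewrite /f /patch cosN.
  congr (if _ then _ else _); apply/idP/idP => /set_mem/SE h; apply/mem_set/SE.
    by rewrite normrN.
  by rewrite normrN in h.
have NE y : S y -> (M y + M (- y)%R = (N y)%:E)%E.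
  by move=> Sy; rewrite /N EFinD !fineK //; apply: M_fin => //; apply/SE; rewrite normrN; exact/SE.
have mN : measurable_fun S (fun y => (N y)%:E).
  apply/measurable_EFinP; apply: measurable_funD; apply: measurable_funTS.
    exact: (measurableT_comp (fine_measurable measurableT)).
  exact: (measurableT_comp (fine_measurable measurableT) mMN).
have sum2 a : (\int[mu]_(y in S) ((cos y `^ a)%:E * (N y)%:E) =
    2%:E * \int[mu]_(y in S) ((cos y `^ a)%:E * M y))%E.
  rewrite mule_natl mule2n -{2}refl -ge0_integralD //.
  - by apply: eq_integral => y /set_mem Sy; rewrite -NE // ge0_muleDr.
  - by move=> y _; rewrite mule_ge0 // lee_fin powR_ge0.
  - by apply: mwM; exact: mMs.
  - by move=> y _; rewrite mule_ge0 // lee_fin powR_ge0.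
  - by apply: mwM; exact: measurable_funTS mMN.
have N0 y : 0 <= N y by rewrite addr_ge0 // fine_ge0.
have wN0 a y : (0 <= (cos y `^ a)%:E * (N y)%:E)%E by rewrite -EFinM lee_fin mulr_ge0 // powR_ge0.
have mwN a : measurable_fun S (fun y => (cos y `^ a)%:E * (N y)%:E)%E by exact: mwM.
have mw a : measurable_fun S (fun y => (cos y `^ a)%:E) by exact: measurable_funTS.
have w0 a (y : R) : (0 <= (cos y `^ a)%:E)%E by rewrite lee_fin powR_ge0.
have mk (c : R) f : measurable_fun S f -> measurable_fun S (fun y => c%:E * f y)%E.
  by move=> mf; apply: emeasurable_funM; [exact: measurable_cst|exact: mf].
have : (\int[mu]_(y in S) ((cos y `^ beta)%:E * (N y)%:E + (k * N y0)%:E * (cos y `^ alpha)%:E) <=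
  \int[mu]_(y in S) (k%:E * ((cos y `^ alpha)%:E * (N y)%:E) + (N y0)%:E * (cos y `^ beta)%:E))%E.
  apply: ge0_le_integral => //.
  - by move=> y _; rewrite adde_ge0 // mule_ge0 // lee_fin mulr_ge0 // ltW.
  - by apply: emeasurable_funD; [exact: mwN|exact: mk (mw _)].
  - by apply: emeasurable_funD; [exact: mk (mwN _)|exact: mk (mw _)].
  - by move=> y Sy; rewrite -!EFinM -!EFinD lee_fin mulrA; exact: pt.
have kn0 : 0 <= k * N y0 by rewrite mulr_ge0 // ltW.
rewrite !ge0_integralD //; try exact: mwN; try exact: mw; try (by apply: mk);
  try (by move=> y _; rewrite mule_ge0 // lee_fin // ltW).
rewrite !ge0_integralZl_EFin // ?(ltW k0) //; try exact: mwN; try exact: mw.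
rewrite JaE JbE -!EFinM.
(* The two terms in [N y0] coincide by the choice of [k], and cancel. *)
have -> : k * N y0 * Ja = N y0 * Jb by rewrite /k; field; rewrite gt_eqF.
by rewrite leeD2rE // !sum2 muleCA lee_pmul2l ?lte_fin.
Qed.

End SymmetricChebyshev.

(** * The integrals of cosine powers and the Gamma function *)

Section PeriodicProduct.
Variable R : realType.

(* [(a + 1) J(a) J(a + 1)] has period [1] and, by monotonicity of [J], does not
   grow by more than a factor [(b + 1) / (a + 1)] between [a] and [b]. *)
Lemma Wallis_product_const (J : R -> R) :
  (forall x, -1 < x -> 0 < J x) -> (forall x y, -1 < x -> x <= y -> J y <= J x) ->
  (forall x, -1 < x -> (x + 2) * J (x + 2) = (x + 1) * J x) ->
  forall a b, -1 < a -> -1 < b -> (a + 1) * J a * J (a + 1) = (b + 1) * J b * J (b + 1).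
Proof.
move=> J0 J_le Jrec; pose f a := (a + 1) * J a * J (a + 1).
have fS x : -1 < x -> f (x + 1) = f x.
  move=> x1; have := Jrec x x1; rewrite /f (_ : x + 1 + 1 = x + 2); last by ring.
  by move=> E; rewrite -E; ring.
have fn x n : -1 < x -> f (x + n%:R) = f x.
  move=> x1; elim: n => [|n IH]; first by rewrite addr0.
  by rewrite -natr1 addrA fS // (lt_le_trans x1) // lerDl ler0n.
have f_gt0 x : -1 < x -> 0 < f x.
  by move=> x1; rewrite !mulr_gt0 ?J0; lra.
have f_le x y : -1 < x -> x <= y -> f y <= f x.
  move=> x1 xy; have y1 : -1 < y by exact: lt_le_trans xy.
  apply/ler_addgt0Pr => e e0.
  have fx0 := f_gt0 _ x1.
  (* Translation by n changes neither value, and for large n the factor (y + n + 1) / (x + n + 1)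
     costs at most [e]. *)
  have [n nP] : exists n : nat, (y - x) * f x / e < n%:R.
    by exists (Num.truncn ((y - x) * f x / e)).+1; exact: truncnS_gt.
  rewrite ltr_pdivrMr // in nP.
  have n0 : 0 <= n%:R :> R by rewrite ler0n.
  rewrite -(fn y n) // -(fn x n) //.
  have xn1 : -1 < x + n%:R by lra.
  have xn10 : 0 < x + n%:R + 1 by lra.
  have h1 : f (y + n%:R) <= (y + n%:R + 1) * J (x + n%:R) * J (x + n%:R + 1).
    have yn1 : -1 < y + n%:R by lra.
    have xyn : x + n%:R <= y + n%:R by lra.
    have [p1 p2 p3] : [/\ 0 <= y + n%:R + 1, -1 < y + n%:R + 1 & -1 < x + n%:R + 1] by split; lra.
    rewrite /f -!mulrA ler_wpM2l // ler_pM ?J_le ?lerD2r //; exact/ltW/J0.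
  apply: (le_trans h1).
  rewrite (_ : _ * _ * _ = f (x + n%:R) + (y - x) * f (x + n%:R) / (x + n%:R + 1)); last first.
    by rewrite /f; field; rewrite gt_eqF.
  by rewrite lerD2l fn // ler_pdivrMr //; nra.
move=> a b a1 b1; rewrite -/(f a) -/(f b).
wlog ab : a b a1 b1 / a <= b.
  by move=> H; have [ab|/ltW ba] := leP a b; [exact: H|exact/esym/H].
apply/eqP; rewrite eq_le; apply/andP; split; last exact: f_le.
(* For the other inequality, [a] is translated past [b], where [f_le] compares in the opposite
   order. *)
rewrite -(fn a (Num.truncn (b - a)).+1) // f_le //.
by have := truncnS_gt (b - a); lra.
Qed.

End PeriodicProduct.

(** * Integrals of powers of the cosine *)

Section CosinePowers.
Variable R : realType.
Let mu := @lebesgue_measure R.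
Let S : set R := `]- (pi / 2), pi / 2[%classic.

Lemma ge0_integral_gt0 (D : set R) (f : R -> R) : measurable D -> (0 < mu D)%E ->
  measurable_fun D f -> (forall x, D x -> 0 < f x) -> (0 < \int[mu]_(x in D) (f x)%:E)%E.
Proof.
move=> mD D0 mf f0; rewrite lt0e integral_ge0 ?andbT; last by move=> x Dx; rewrite lee_fin ltW ?f0.
apply/negP => /eqP I0.
have mfE : measurable_fun D (EFin \o f) by apply/measurable_EFinP.
have : (\int[mu]_(x in D) `|(EFin \o f) x| = 0)%E.
  rewrite -[RHS]I0; apply: eq_integral => x /set_mem Dx /=.
  by rewrite ger0_norm // ltW // f0.
move/(ae_eq_integral_abs mu mD mfE) => [A [mA A0 DA]].
have sub : D `<=` A.
  move=> x Dx; apply: DA => /= /(_ Dx) [] fx0.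
  by have := f0 x Dx; rewrite fx0 ltxx.
have DA' : (mu D <= mu A)%E by rewrite le_measure ?inE.
have A0' : mu A = 0%E by exact: A0.
by move: DA'; rewrite A0' leNgt D0.
Qed.

Definition cos_int (a : R) : \bar R := (\int[mu]_(y in S) (cos y `^ a)%:E)%E.

Let cS y : S y -> 0 < cos y.
Proof. by move=> Sy; apply: cos_gt0_pihalf; rewrite /S /= in_itv in Sy. Qed.

Let mS : measurable S. Proof. exact: measurable_itv. Qed.

Let muS : mu S = pi%:E.
Proof.
have p := pi_gt0 R; rewrite /mu lebesgue_measure_itv /= lte_fin.
by rewrite ifT; [rewrite -EFinB; congr EFin; lra|lra].
Qed.

Let mcosp a D : measurable_fun D (fun y : R => cos y `^ a).
Proof.
apply: measurable_funTS; apply: (measurableT_comp (measurable_powR a)).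
by apply: continuous_measurable_fun; exact: continuous_cos.
Qed.

Lemma cos_int_gt0 a : (0 < cos_int a)%E.
Proof.
apply: ge0_integral_gt0 => //; first by rewrite muS lte_fin pi_gt0.
by move=> y Sy; rewrite powR_gt0 // cS.
Qed.

(** Cut-offs increasing to pi/2: for a < 0 the power cos^a is singular at the ends of [S], so the
    recurrence is first proved on [-cc n, cc n]. *)
Let cc (n : nat) : R := pi / 2 - pi / 2 / n.+2%:R.

Let cc_itv n : 0 < cc n < pi / 2.
Proof.
have p : 0 < pi / 2 :> R by rewrite divr_gt0 // pi_gt0.
rewrite /cc; apply/andP; split.
  by rewrite subr_gt0 ltr_pdivrMr ?ltr0n // ltr_pMr // ltr1n.
by rewrite gtrBl divr_gt0.
Qed.

Let cc_mono m n : (m <= n)%N -> cc m <= cc n.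
Proof.
move=> mn; have p : 0 < pi / 2 :> R by rewrite divr_gt0 // pi_gt0.
by rewrite lerD2l lerN2 ler_pM2l // lef_pV2 ?posrE // ler_nat ltnS.
Qed.

Let cc_cvg : cc @ \oo --> (pi / 2 : R).
Proof.
rewrite -[X in _ --> X]subr0; apply: cvgB; first exact: cvg_cst.
have h : (fun n => harmonic n.+1) @ \oo --> (0 : R).
  by rewrite (cvg_shiftS (@harmonic R)); exact: cvg_harmonic.
rewrite -(mulr0 (pi / 2)); apply: cvgM; [exact: cvg_cst|exact: h].
Qed.

Let cc_bigcup : S = \bigcup_n `[- cc n, cc n]%classic.
Proof.
have p : 0 < pi / 2 :> R by rewrite divr_gt0 // pi_gt0.
apply/seteqP; split => [y|y [n _]]; rewrite /S /= !in_itv /=.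
  rewrite -ltr_norml => yp.
  have d0 : 0 < pi / 2 - `|y| by rewrite subr_gt0.
  move/cvgrPdist_lt : cc_cvg => /(_ _ d0)[n _ /(_ n (leqnn n))].
  have /andP[c1 c2] := cc_itv n.
  rewrite gtr0_norm ?subr_gt0 // => h; exists n => //=.
  by rewrite in_itv /= -ler_norml; lra.
have /andP[c1 c2] := cc_itv n.
by move=> /andP[? ?]; apply/andP; split; lra.
Qed.

Let cos_int_cvg a :
  (\int[mu]_(y in `[(- cc n)%R, cc n]) (cos y `^ a)%:E @[n --> \oo] --> cos_int a)%E.
Proof.
rewrite /cos_int cc_bigcup; apply: ge0_nondecreasing_set_cvg_integral => //.
- move=> m n mn; apply/subsetPset; apply: subset_itv; rewrite bnd_simp ?lerN2; exact: cc_mono.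
- by move=> n; apply/measurable_EFinP; exact: mcosp.
- by move=> n y _; rewrite lee_fin powR_ge0.
Qed.

Let is_derive_cosp a y : S y -> is_derive y 1 (fun y : R => cos y `^ a) (- (a * cos y `^ (a - 1) * sin y)).
Proof.
move=> /cS c0; have d1 := is_derive1_powR a c0.
have -> : (fun y : R => cos y `^ a) = (@powR R ^~ a) \o cos by [].
by apply: is_derive_eq; rewrite mulrN.
Qed.

(** The derivative of sin y cos(y)^(a + 1) is (a + 2) cos(y)^(a + 2) - (a + 1) cos(y)^a. *)
Let cos_int_itv a c : 0 < c < pi / 2 ->
  ((a + 2)%:E * \int[mu]_(y in `[(- c)%R, c]) (cos y `^ (a + 2))%:E =
   (a + 1)%:E * \int[mu]_(y in `[(- c)%R, c]) (cos y `^ a)%:E + (2 * sin c * cos c `^ (a + 1))%:E)%E.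
Proof.
move=> /andP[c0 cp].
have inS y : - c <= y <= c -> S y.
  by move=> /andP[? ?]; rewrite /S /= in_itv /=; apply/andP; split; lra.
pose f y := (a + 2) * cos y `^ (a + 2) - (a + 1) * cos y `^ a.
pose F y := sin y * cos y `^ (a + 1).
have dF y : S y -> is_derive y 1 F (f y).
  move=> Sy; have d1 := is_derive_cosp (a + 1) Sy; have c00 := cS Sy.
  have -> : F = sin * (fun y => cos y `^ (a + 1)) by [].
  apply: is_derive_eq; rewrite /GRing.scale /= addrK /f.
  have c0n : cos y != 0 by rewrite gt_eqF.
  rewrite (powRD (s := 2)) ?c0n ?implybT // (powR_mulrn 2) ?(ltW c00) //.
  rewrite (powRD (s := 1)) ?c0n ?implybT // powRr1 ?(ltW c00) //.
  have e := cos2sin2 y; move: (cos y `^ a) => w; move: (sin y) (cos y) e => t u e.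
  apply/eqP; rewrite -subr_eq0; apply/eqP.
  transitivity ((a + 1) * w * (1 - t ^+ 2 - u ^+ 2)); first by ring.
  by rewrite e; ring.
have cw b y : S y -> {for y, continuous (fun y => cos y `^ b)}.
  by move=> Sy; exact: is_derive_continuous (is_derive_cosp b Sy).
have cf y : S y -> {for y, continuous f}.
  move=> Sy; apply: cvgB; apply: cvgM; try exact: cvg_cst; exact: cw.
have iw b : mu.-integrable `[- c, c] (EFin \o (fun y => cos y `^ b)).
  by apply: continuous_itv_integrable => y /inS; exact: cw.
have cF y : S y -> {for y, continuous F} by move=> Sy; exact: is_derive_continuous (dF _ Sy).
have cc0 : - c < c by lra.
have wI y : y \in `]- c, c[ -> S y.
  by rewrite in_itv /= => /andP[? ?]; apply: inS; apply/andP; split; exact: ltW.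
have Sc : S c by apply: inS; rewrite lexx andbT ltW.
have ScN : S (- c) by apply: inS; rewrite lexx ltW.
have FTC : (\int[mu]_(y in `[(- c)%R, c]) (f y)%:E = (F c)%:E - (F (- c))%:E)%E.
  apply: continuous_FTC2 => //.
  - by apply: continuous_in_subspaceT => y /set_mem /=; rewrite in_itv /= => /inS/cf.
  - split.
    + by move=> y /wI /dF h; exact: ex_derive.
    + by apply: cvg_at_right_filter; exact: cF.
    + by apply: cvg_at_left_filter; exact: cF.
  - by move=> y /wI /dF h; rewrite derive1E; exact: derive_val.
have E b : (\int[mu]_(y in `[(- c)%R, c]) (cos y `^ b)%:E =
    (\int[mu]_(y in `[- c, c]) (cos y `^ b))%:E)%E.
  by rewrite fineK //; exact: integrable_fin_num (iw b).
have : \int[mu]_(y in `[- c, c]) f y = 2 * sin c * cos c `^ (a + 1).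
  by rewrite /Rintegral FTC -EFinB /= /F sinN cosN; ring.
rewrite RintegralB //; last 2 first.
- exact: integrableZl (iw _).
- exact: integrableZl (iw _).
rewrite !RintegralZl // => <-.
by rewrite !E -!EFinM -EFinD; congr EFin; ring.
Qed.

(** The boundary term 2 sin c cos(c)^(a + 1) tends to 0 because a + 1 > 0. The identity is kept in
    the extended reals since [cos_int_fin] deduces finiteness from it. *)
Lemma cos_int_rec a : -1 < a -> ((a + 2)%:E * cos_int (a + 2) = (a + 1)%:E * cos_int a)%E.
Proof.
move=> a1; have a10 : 0 < a + 1 by lra.
have L2 := cvgeZl (erefl : (a + 2)%:E \is a fin_num) (@cos_int_cvg (a + 2)).
have L1 := cvgeZl (erefl : (a + 1)%:E \is a fin_num) (@cos_int_cvg a).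
have L0 : (2 * sin (cc n) * cos (cc n) `^ (a + 1) @[n --> \oo] --> (0 : R)).
  have ccos : cos (cc n) @[n --> \oo] --> (0 : R).
    rewrite -(cos_pihalf R); exact: (cvg_comp _ _ cc_cvg (@continuous_cos R (pi / 2))).
  have csin : sin (cc n) @[n --> \oo] --> (1 : R).
    rewrite -(sin_pihalf R); exact: (cvg_comp _ _ cc_cvg (@continuous_sin R (pi / 2))).
  have cpow : cos (cc n) `^ (a + 1) @[n --> \oo] --> (0 : R).
    apply: ((cvg_at_rightP _ _ _).1 (powR_cvg0 a10) (fun n => cos (cc n))); split => // n.
    by have /andP[? ?] := cc_itv n; apply: cS; rewrite /S /= in_itv /=; apply/andP; split; lra.
  rewrite -(mulr0 (2 * 1)); apply: cvgM cpow; apply: cvgM csin; exact: cvg_cst.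
have L3 : ((a + 1)%:E * \int[mu]_(y in `[(- cc n)%R, cc n]) (cos y `^ a)%:E +
    (2 * sin (cc n) * cos (cc n) `^ (a + 1))%:E @[n --> \oo] --> (a + 1)%:E * cos_int a + 0%:E)%E.
  apply: cvgeD => //; last by apply: cvg_EFin; [exact: nearW|exact: L0].
  by rewrite fin_num_adde_defl.
rewrite adde0 in L3; apply: (cvg_unique (@ereal_hausdorff R) L2).
rewrite [X in X @ _](_ : _ = fun n => ((a + 1)%:E * \int[mu]_(y in `[(- cc n)%R, cc n])
  (cos y `^ a)%:E + (2 * sin (cc n) * cos (cc n) `^ (a + 1))%:E)%E) //.
by apply/funext => n /=; exact: cos_int_itv.
Qed.

Lemma cos_int_le a b : a <= b -> (cos_int b <= cos_int a)%E.
Proof.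
move=> ab; apply: ge0_le_integral => //.
- by move=> y _; rewrite lee_fin powR_ge0.
- by apply/measurable_EFinP; exact: mcosp.
- by apply/measurable_EFinP; exact: mcosp.
- by move=> y Sy; rewrite lee_fin ger_powR ?cS ?cos_le1.
Qed.

(** The exponent a + 2 is nonnegative, so its integral is at most pi; the recurrence carries
    finiteness back to a. *)
Lemma cos_int_fin a : -1 < a -> cos_int a \is a fin_num.
Proof.
move=> a1; have c0 b : (0 <= cos_int b)%E by exact/ltW/cos_int_gt0.
have : (cos_int (a + 2) < +oo)%E.
  have a20 : 0 <= a + 2 by lra.
  apply: (le_lt_trans (cos_int_le a20)); rewrite /cos_int.
  under eq_integral do rewrite powRr0.
  rewrite integral_cst // mul1e.
  by apply: (@le_lt_trans _ _ (pi%:E : \bar R)); [rewrite -muS|exact: ltry].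
rewrite ge0_fin_numE // => h.
have : ((a + 1)%:E * cos_int a < +oo)%E.
  by rewrite -cos_int_rec // lte_mul_pinfty // lee_fin; lra.
rewrite ltNge leye_eq => /eqP n; rewrite ltNge leye_eq; apply/negP => /eqP E; apply: n.
by rewrite E gt0_muley // lte_fin; lra.
Qed.

Definition cos_intR a := fine (cos_int a).

Lemma cos_intRE a : -1 < a -> cos_int a = (cos_intR a)%:E.
Proof. by move=> a1; rewrite fineK // cos_int_fin. Qed.

Lemma cos_intR_gt0 a : -1 < a -> 0 < cos_intR a.
Proof. by move=> a1; rewrite -lte_fin -cos_intRE // cos_int_gt0. Qed.

Lemma cos_intR_prod a b : -1 < a -> -1 < b ->
  (a + 1) * cos_intR a * cos_intR (a + 1) = (b + 1) * cos_intR b * cos_intR (b + 1).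
Proof.
move: a b; apply: Wallis_product_const.
- exact: cos_intR_gt0.
- move=> x y x1 xy; have y1 := lt_le_trans x1 xy.
  by have := cos_int_le xy; rewrite (cos_intRE x1) (cos_intRE y1) lee_fin.
- move=> x x1; have x3 : -1 < x + 2 by lra.
  by have := cos_int_rec x1; rewrite (cos_intRE x1) (cos_intRE x3) => -[].
Qed.

End CosinePowers.

(** * Squares of Gamma values through the Beta integral *)

Section GammaDuplication.
Variable R : realType.
Let mu := @lebesgue_measure R.
Let S : set R := `]- (pi / 2), pi / 2[%classic.
Let P : set R := `]0, +oo[%classic.

Let PE x : P x <-> 0 < x.
Proof. by rewrite /P /= in_itv /= andbT. Qed.
Let oP : open P. Proof. exact: interval_open. Qed.
Let mP : measurable P. Proof. exact: measurable_itv. Qed.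

Let g (b t : R) : R := t `^ (b - 1) * expR (- t).
Let g0 b t : 0 <= g b t.
Proof. by rewrite mulr_ge0 ?powR_ge0 ?expR_ge0. Qed.

Let cpowR (a x : R) : 0 < x -> {for x, continuous (fun x : R => x `^ a)}.
Proof. by move=> x0; exact: is_derive_continuous (is_derive1_powR a x0). Qed.

Let cexpN (c x : R) : {for x, continuous (fun x : R => expR (- (c * x)))}.
Proof.
apply: (@continuous_comp _ _ _ (fun x : R => - (c * x)) expR); last exact: continuous_expR.
by apply: cvgN; apply: cvgM; [exact: cvg_cst|exact: cvg_id].
Qed.

Let cg b x : P x -> {for x, continuous (g b)}.
Proof.
move=> /PE x0; apply: cvgM; first exact: cpowR.
by have := @cexpN 1 x; rewrite (_ : (fun x : R => expR (- (1 * x))) = (fun x => expR (- x))) //;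
  apply/funext => y; rewrite mul1r.
Qed.

Definition gamma_int (b : R) : \bar R := (\int[mu]_(t in P) (g b t)%:E)%E.

Lemma GammaE b : Gamma b = fine (gamma_int b). Proof. by []. Qed.

Let mg b D : measurable_fun D (g b).
Proof.
apply: measurable_funTS; apply: measurable_funM.
  exact: (measurable_powR (b - 1)).
by apply: (measurableT_comp (@measurable_expR R)); exact: oppr_measurable.
Qed.

Let mgs (c b : R) (D : set R) : measurable_fun D (fun x : R => g b (c * x)).
Proof.
apply: measurable_funTS.
apply: (@measurableT_comp _ _ _ _ _ _ (g b) setT (fun x => c * x)); first exact: mg.
by apply: measurable_funM => //; exact: measurable_cst.
Qed.

Lemma ge0_integral_scale (c : R) (G : R -> R) : 0 < c ->
  (forall y, 0 < y -> {for y, continuous G}) -> (forall y, 0 < y -> 0 <= G y) ->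
  (\int[mu]_(y in P) (G y)%:E = \int[mu]_(x in P) (G (c * x) * c)%:E)%E.
Proof.
move=> c0 cG G0.
apply: (@ge0_integration_by_substitution_itv0y _ P (fun x => c * x) (cst c)) => //.
- move=> x _; have -> : (fun x : R => c * x) = c *: (@id R) by [].
  by apply: is_derive_eq; rewrite /GRing.scale /= mulr1.
- by move=> x _; exact: cst_continuous.
- by move=> x x0; apply/PE; rewrite mulr_gt0.
- by move=> y /PE y0; exists (y / c); [rewrite divr_gt0|rewrite mulrC divfK ?gt_eqF].
- by move=> y /PE; exact: cG.
- by move=> y /PE; exact: G0.
Qed.

Lemma gamma_int_fin x : 1 <= x -> gamma_int x \is a fin_num.
Proof.
move=> x1; have gx0 : (0 <= gamma_int x)%E by apply: integral_ge0 => t _; rewrite lee_fin.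
(* The term 1 of [C] serves t <= 1; the other comes from the term of order n + 1 of the exponential
   series, t^(n + 1) <= (n + 1)! 2^(n + 1) e^(t / 2). The integrand is then at most 2 C times the
   exponential density of rate 1/2. *)
pose n := (Num.truncn (x - 1)); pose C : R := 1 + n.+1`!%:R * 2 ^+ n.+1.
have C0 : 0 < C by rewrite ltr_pwDl // mulr_ge0 // exprn_ge0.
have f0 : 0 < n.+1`!%:R :> R by rewrite ltr0n fact_gt0.
have bnd t : 0 < t -> t `^ (x - 1) <= C * expR (t / 2).
  move=> t0; have e1 : 1 <= expR (t / 2) by rewrite -expR0 ler_expR divr_ge0 // ltW.
  have [t1|t1] := leP t 1.
    apply: (@le_trans _ _ 1).
      by rewrite -[X in _ <= X](powRr0 t); apply: ger_powR; rewrite ?t0 // subr_ge0.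
    have C1 : 1 <= C by rewrite lerDl mulr_ge0 // exprn_ge0.
    by rewrite -[leLHS]mulr1 ler_pM.
  apply: (@le_trans _ _ (t ^+ n.+1)).
    rewrite -powR_mulrn ?(ltW t0) // ler_powR ?(ltW t1) //; exact/ltW/truncnS_gt.
  have := @expR_ge1Dxn R (t / 2) n (ltW (divr_gt0 t0 (ltr0Sn R 1))) => h.
  have h2 : (t / 2) ^+ n.+1 / n.+1`!%:R <= expR (t / 2) by rewrite (le_trans _ h) // lerDr.
  rewrite ler_pdivrMr // expr_div_n ler_pdivrMr ?exprn_gt0 // in h2.
  apply: (le_trans h2); rewrite /C mulrDl mul1r [X in _ + X]mulrC mulrA.
  by rewrite lerDr expR_ge0.
rewrite ge0_fin_numE //.
pose ex := @exponential_pdf R 2^-1.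
have ex0 t : 0 <= ex t by exact: exponential_pdf_ge0.
have mex : measurable_fun setT (EFin \o ex).
  by apply/measurable_EFinP; exact: measurable_exponential_pdf.
apply: (@le_lt_trans _ _ (\int[mu]_(t in P) ((2 * C)%:E * (ex t)%:E))%E).
  apply: ge0_le_integral => //.
  - by move=> t _; rewrite lee_fin.
  - by apply/measurable_EFinP; exact: mg.
  - by apply: emeasurable_funM; [exact: measurable_cst|exact: measurable_funTS mex].
  - move=> t /PE t0; rewrite lee_fin /g /ex exponential_pdfE ?(ltW t0) //.
    rewrite (_ : 2 * C * _ = C * expR (t / 2) * expR (- t)); last first.
      have e : expR (t / 2) * expR (- t) = expR (- 2^-1 * t).
        by rewrite -expRD; congr expR; field.
      by rewrite -[RHS]mulrA e; field.
    by rewrite ler_wpM2r ?expR_ge0 // bnd.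
have C20 : 0 <= 2 * C by rewrite mulr_ge0 // ltW.
rewrite ge0_integralZl_EFin //; last 2 first.
- by move=> t _; rewrite lee_fin.
- exact: measurable_funTS mex.
apply: lte_mul_pinfty; rewrite ?lee_fin //.
apply: (@le_lt_trans _ _ (\int[mu]_t (ex t)%:E)%E).
  by apply: ge0_subset_integral => // t _; rewrite lee_fin.
by rewrite integral_exponential_pdf ?ltry // invr_gt0.
Qed.

Lemma gamma_int_gt0 b : (0 < gamma_int b)%E.
Proof.
apply: ge0_integral_gt0 => //.
- by have := @lebesgue_measure_itv R `]0, +oo[; rewrite /= ltry => ->; rewrite ltry.
- by move=> t /PE t0; rewrite mulr_gt0 ?powR_gt0 ?expR_gt0.
Qed.

(** Euler's Beta function at (b, b), as an integral over the half-line. *)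
Let beta_int (b : R) : \bar R :=
  (\int[mu]_(t in P) (t `^ (b - 1) * (1 + t) `^ (- (2 * b)))%:E)%E.

(* Substituting [t = s tau] in the second factor of [Gamma(b)^2]. *)
Let gamma_int_sqr b : (gamma_int b * gamma_int b = gamma_int (2 * b) * beta_int b)%E.
Proof.
pose k (p : R * R) : R := \1_P p.1 * \1_P p.2 * (p.1 `^ (2 * b - 1) * p.2 `^ (b - 1) * expR (- ((1 + p.2) * p.1))).
have k0 p : (0 <= (EFin \o k) p)%E.
  by rewrite lee_fin /k !indicE !mulr_ge0 ?powR_ge0 ?expR_ge0 ?ler0n.
have mk : measurable_fun setT (EFin \o k).
  apply/measurable_EFinP; apply: measurable_funM.
    by apply: measurable_funM; apply: (measurableT_comp (measurable_indic mP)).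
  apply: measurable_funM.
    by apply: measurable_funM; [apply: (measurableT_comp (measurable_powR _))|apply: (measurableT_comp (measurable_powR _))].
  apply: (measurableT_comp (@measurable_expR R)).
  apply: (measurableT_comp (@oppr_measurable R setT)).
  apply: measurable_funM => //; apply: measurable_funD => //; exact: measurable_cst.
have gE0 c t : (0 <= (g c t)%:E)%E by rewrite lee_fin.
have mgE c : measurable_fun P (fun t => (g c t)%:E) by apply/measurable_EFinP; exact: mg.
have gam0 c : (0 <= gamma_int c)%E by exact: integral_ge0.
transitivity (\int[mu]_s \int[mu]_t (EFin \o k) (s, t))%E.
  rewrite {1}/gamma_int -ge0_integralZr //; last exact: mgE.
  rewrite integral_mkcond; apply: eq_integral => s _; rewrite /patch.
  case: ifPn => [/set_mem Ps|Ps]; last first.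
    by rewrite integral0_eq // => t _; rewrite /k /= indicE (negPf Ps) !mul0r.
  have s0 := (PE s).1 Ps.
  rewrite /gamma_int (@ge0_integral_scale s) //; last first.
    by move=> y /PE; exact: cg.
  rewrite -ge0_integralZl_EFin //; last 2 first.
  - by move=> t _; rewrite lee_fin mulr_ge0 // ltW.
  - apply/measurable_EFinP; apply: measurable_funM; last exact: measurable_cst.
    exact: mgs.
  rewrite integral_mkcond; apply: eq_integral => t _; rewrite /patch /k /= !indicE.
  rewrite [s \in P]mem_set //; case: ifPn => [/set_mem /PE t0|_]; last by rewrite mulr0 mul0r.
  rewrite !mul1r -EFinM; congr EFin; rewrite /g powRM ?(ltW s0) ?(ltW t0) //.
  have -> : s `^ (2 * b - 1) = s `^ (b - 1) * s `^ (b - 1) * s.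
    rewrite -[X in _ = _ * _ * X]powRr1 ?(ltW s0) // -!powRD ?(gt_eqF s0) ?implybT //.
    by congr powR; ring.
  rewrite (_ : - ((1 + t) * s) = - s - s * t); last by ring.
  by rewrite expRD; ring.
(* In the exchanged order the inner integral in s is a Gamma integral rescaled by 1 + t, equal to
   Gamma(2 b) (1 + t)^(-2 b). *)
etransitivity; first exact: (@fubini_tonelli _ _ _ _ _ mu mu (EFin \o k) mk k0).
rewrite /beta_int -ge0_integralZl //; last 2 first.
- apply/measurable_EFinP; apply: measurable_funM.
    exact: measurable_funTS (measurable_powR _).
  apply: measurable_funTS; apply: (measurableT_comp (measurable_powR _)).
  by apply: measurable_funD => //; exact: measurable_cst.
- by move=> t _; rewrite lee_fin mulr_ge0 ?powR_ge0.
rewrite [RHS]integral_mkcond; apply: eq_integral => t _; rewrite /patch.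
case: ifPn => [/set_mem Pt|Pt]; last first.
  by rewrite integral0_eq // => s _; rewrite /k /= !indicE (negPf Pt) mulr0 mul0r.
have t0 := (PE t).1 Pt; have t10 : 0 < 1 + t by rewrite addr_gt0.
rewrite /gamma_int (@ge0_integral_scale (1 + t)) //; last first.
  by move=> y /PE; exact: cg.
rewrite -ge0_integralZr //; last 3 first.
- apply/measurable_EFinP; apply: measurable_funM; last exact: measurable_cst.
  exact: mgs.
- by move=> s _; rewrite lee_fin mulr_ge0 // ltW.
- by rewrite lee_fin mulr_ge0 ?powR_ge0.
rewrite [RHS]integral_mkcond; apply: eq_integral => s _; rewrite /patch /k /= !indicE.
rewrite [t \in P]mem_set //; case: ifPn => [/set_mem /PE s0|_]; last by rewrite !mul0r.
rewrite !mul1r -EFinM; congr EFin; rewrite /g powRM ?(ltW s0) ?(ltW t10) //.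
have : (1 + t) `^ (2 * b - 1) * (1 + t) * (1 + t) `^ (- (2 * b)) = 1.
  rewrite -[X in _ * X * _]powRr1 ?(ltW t10) // -!powRD ?(gt_eqF t10) ?implybT //.
  by rewrite (_ : _ - 1 + 1 - _ = 0) ?powRr0 //; ring.
move: ((1 + t) `^ _) ((1 + t) `^ _) => A B AB.
by rewrite -[LHS]mul1r -[X in X * _ = _]AB; ring.
Qed.

Let powR_tan_half (b a c d : R) : 0 < a -> 0 < c -> 0 < d ->
  ((c / d) ^+ 2) `^ (b - 1) * (a / d) `^ (- (2 * b)) * (a * c / d ^+ 2) =
  a `^ (1 - 2 * b) * c `^ (2 * b - 1).
Proof.
have pe (x : R) : 0 < x -> exists u, x = expR u by move=> x0; exists (ln x); rewrite lnK.
(* With all bases written as exponentials, the identity of powers becomes one between exponents. *)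
move=> /pe[w ->] /pe[u ->] /pe[v ->].
by rewrite !expr2 -!(expRN, expRD, expRM); congr expR; ring.
Qed.

(** Substitute t = (1 + sin y) / (1 - sin y) = tan^2 (pi / 4 + y / 2), for which 1 + t = 2 / (1 -
    sin y) and t is the square of cos y / (1 - sin y). *)
Let beta_int_cos b : beta_int b = ((2 `^ (1 - 2 * b))%:E * cos_int (2 * b - 1))%E.
Proof.
have cS y : S y -> 0 < cos y by move=> Sy; apply: cos_gt0_pihalf; rewrite /S /= in_itv in Sy.
have s1 y : S y -> -1 < sin y < 1.
  move=> /cS c0; have e := cos2Dsin2 y.
  have : sin y ^+ 2 < 1 by rewrite -e ltrDr exprn_gt0.
  by move=> h; apply/andP; split; nra.
pose F (y : R) := (1 + sin y) / (1 - sin y).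
pose f (y : R) := 2 * cos y / (1 - sin y) ^+ 2.
have p := pi_gt0 R.
have mcos : measurable_fun S (fun y => (cos y `^ (2 * b - 1))%:E).
  apply/measurable_EFinP; apply: measurable_funTS; apply: (measurableT_comp (measurable_powR _)).
  by apply: continuous_measurable_fun; exact: continuous_cos.
have mS : measurable S by exact: measurable_itv.
have c20 : 0 <= 2 `^ (1 - 2 * b) :> R by exact: powR_ge0.
have cE0 y : S y -> (0 <= (cos y `^ (2 * b - 1))%:E)%E by rewrite lee_fin powR_ge0.
apply: eq_trans (ge0_integralZl_EFin mu mS cE0 mcos c20).
rewrite /beta_int.
etransitivity.
  apply: (@ge0_integration_by_substitution_itvoo _ (- (pi / 2)) (pi / 2) P F f).
- by lra.
- exact: oP.
- move=> y /s1 /andP[h1 h2].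
  have dn : is_derive y 1 (fun y : R => 1 + sin y) (cos y).
    have -> : (fun y : R => 1 + sin y) = cst 1 + sin by [].
    by apply: is_derive_eq; rewrite add0r.
  have dd : is_derive y 1 (fun y : R => 1 - sin y) (- cos y).
    have -> : (fun y : R => 1 - sin y) = cst 1 - sin by [].
    by apply: is_derive_eq; rewrite sub0r.
  have d0 : 1 - sin y != 0 by rewrite gt_eqF // subr_gt0.
  have := is_derive_div dn dd d0; rewrite (_ : _ - _ * _ = 2 * cos y) //; ring.
- move=> y /s1 /andP[h1 h2]; apply: cvgM.
    by apply: cvgM; [exact: cvg_cst|exact: continuous_cos].
  apply: cvgV; first by rewrite expf_neq0 // gt_eqF // subr_gt0.
  apply: (@continuous_comp _ _ _ (fun y : R => 1 - sin y) (fun t => t ^+ 2)).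
    by apply: cvgB; [exact: cvg_cst|exact: continuous_sin].
  exact: exprn_continuous.
- move=> y Sy; have /andP[h1 h2] := s1 y Sy.
  by rewrite divr_gt0 ?mulr_gt0 ?cS ?exprn_gt0 ?subr_gt0.
- by move=> y /s1 /andP[h1 h2]; apply/PE; rewrite divr_gt0; lra.
- move=> t /PE t0; pose q := (t - 1) / (t + 1).
  have t10 : 0 < t + 1 by rewrite addr_gt0.
  have q1 : -1 < q by rewrite ltr_pdivlMr //; lra.
  have q2 : q < 1 by rewrite ltr_pdivrMr //; lra.
  exists (asin q).
    by rewrite in_itv /= asin_gtNpi2 ?asin_ltpi2 // ?q1 ?q2 ?(ltW q1) ?(ltW q2).
  rewrite /F asinK ?in_itv /= ?(ltW q1) ?(ltW q2) // /q; field.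
  by rewrite gt_eqF //= gt_eqF // (_ : _ - _ = 2) //; ring.
- move=> t /PE t0; apply: cvgM; first exact: cpowR.
  apply: (@continuous_comp _ _ _ (fun t : R => 1 + t) (fun t => t `^ (- (2 * b)))).
    by apply: cvgD; [exact: cvg_cst|exact: cvg_id].
  by apply: cpowR; rewrite addr_gt0.
- by move=> t _; rewrite mulr_ge0 ?powR_ge0.
apply: eq_integral => y /set_mem Sy; rewrite -EFinM; congr EFin.
have /andP[h1 h2] := s1 y Sy; have c0 := cS y Sy.
have d0 : 0 < 1 - sin y by rewrite subr_gt0.
have F0 : 0 < F y by rewrite divr_gt0 //; lra.
have -> : 1 + F y = 2 / (1 - sin y) by rewrite /F; field; rewrite gt_eqF.
have FE : F y = (cos y / (1 - sin y)) ^+ 2.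
  rewrite /F expr_div_n cos2sin2; field; rewrite gt_eqF //=.
have cd0 : 0 < cos y / (1 - sin y) by rewrite divr_gt0.
have pe (x : R) : 0 < x -> exists u, x = expR u by move=> x0; exists (ln x); rewrite lnK.
by rewrite FE; exact: powR_tan_half.
Qed.

Lemma Gamma_sqr_cos_int (b : R) : 2^-1 < b ->
  Gamma b ^+ 2 = Gamma (2 * b) * (2 `^ (1 - 2 * b) * cos_intR (2 * b - 1)).
Proof.
move=> b2; have g2 := @gamma_int_fin (2 * b) ltac:(lra).
have c1 : -1 < 2 * b - 1 by lra.
have e := gamma_int_sqr b; rewrite beta_int_cos (cos_intRE c1) -[gamma_int (2 * b)]fineK // -!EFinM in e.
(* Finiteness at b itself is read off from that of the square. *)
have gb : gamma_int b \is a fin_num.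
  have gb0 := gamma_int_gt0 b.
  by move: e gb0; case: (gamma_int b).
by move: e; rewrite -[gamma_int b]fineK // -EFinM => -[]; rewrite !GammaE expr2.
Qed.

(** Since [fine] sends +oo to 0, a positive integral is not enough; the formula for the square
    excludes the value 0. *)
Lemma Gamma_gt0 (b : R) : 2^-1 < b -> 0 < Gamma b.
Proof.
move=> b2; rewrite lt0r fine_ge0 ?ltW ?gamma_int_gt0 // andbT.
have [h|h] := ltP 1 (2 * b).
  apply/eqP => G0; have := Gamma_sqr_cos_int b2; rewrite G0 expr0n /=.
  have g2 : 0 < Gamma (2 * b).
    by rewrite GammaE fine_gt0 // gamma_int_gt0 -ge0_fin_numE ?gamma_int_fin ?ltW ?gamma_int_gt0.
  by move=> /esym/eqP; rewrite !mulf_eq0 !gt_eqF ?powR_gt0 ?cos_intR_gt0 //; lra.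
lra.
Qed.

End GammaDuplication.

(** * Bergman norms in the strip *)

Section StripModel.
Variable R : realType.
Let mu := @lebesgue_measure R.
Let S : set R := `]- (pi / 2), pi / 2[%classic.

Definition strip_map (w : R[i]) : R[i] := (cexp w - 1) / (cexp w + 1).

Lemma strip_mapE x y : S y -> strip_map (x +i* y) = strip_re x y +i* strip_im x y.
Proof.
move=> Sy; have d0 := strip_den_gt0 x Sy; have c0 := cos_gt0_strip Sy.
have w0 : cexp (x +i* y) + 1 != 0.
  by apply: Re_gt0_neq0; rewrite cexpE /= addr_gt0 // mulr_gt0 // expR_gt0.
apply: (mulIf w0); rewrite /strip_map divfK // cexpE.
rewrite (_ : 1 = 1 +i* 0 :> R[i]) //.
have e1 := ch2Bsh2 x; have e2 := cos2Dsin2 y.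
have d0' : ch x + cos y != 0 by rewrite gt_eqF.
rewrite /strip_re /strip_im expR_chDsh; move: (ch x) (sh x) (cos y) (sin y) e1 e2 d0' => C H c s e1 e2 d0'.
simpc.
have eH : H ^+ 2 = C ^+ 2 - 1 by rewrite -e1; ring.
have es : s ^+ 2 = 1 - c ^+ 2 by rewrite -e2; ring.
congr (_ +i* _); apply: (mulIf d0').
  rewrite [RHS](_ : _ = H ^+ 2 * c + H * C * c + H - s ^+ 2 * (C + H)); last by field.
  by rewrite eH es; ring.
rewrite [RHS](_ : _ = H ^+ 2 * s + H * C * s + s * ((C + H) * c + 1)); last by field.
by rewrite eH; ring.
Qed.

Lemma strip_map_disk x y : S y -> unit_disk (strip_map (x +i* y)).
Proof.
move=> Sy; rewrite strip_mapE // /unit_disk /= -(@ltr_pXn2r _ 2) ?nnegrE ?cmod_ge0 //.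
by rewrite sqr_cmod expr1n /= strip_disk.
Qed.

Lemma cmod_1Bsqr_strip_map x y : S y ->
  cmod (1 - strip_map (x +i* y) ^+ 2) = 2 / (ch x + cos y).
Proof.
move=> Sy; have d0 := strip_den_gt0 x Sy.
apply: (@pexpIrn _ 2) => //; rewrite ?nnegrE ?cmod_ge0 ?divr_ge0 ?(ltW d0) //.
rewrite sqr_cmod strip_mapE // expr2 expr_div_n (_ : 2 ^+ 2 = 4) -?natrX //.
rewrite -strip_1Bsqr // (_ : 1 = 1 +i* 0 :> R[i]) //; simpc => /=.
by move: (strip_re x y) (strip_im x y) => a b; ring.
Qed.

Lemma cdiff_strip_map x y : S y -> exists c, cdiff strip_map (x +i* y) c.
Proof.
move=> Sy; have c0 := cos_gt0_strip Sy.
have w0 : cexp (x +i* y) + 1 != 0.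
  by apply: Re_gt0_neq0; rewrite cexpE /= addr_gt0 // mulr_gt0 // expR_gt0.
have d1 c := cdiffD (cdiff_cexp (x +i* y)) (cdiff_cst c _).
eexists; exact: (cdiffM (d1 (- 1)) (cdiff_comp (d1 1) (cdiff_inv w0))).
Qed.

End StripModel.

(** * Squared Bergman norms as weighted integrals of line means *)

Section BergmanStrip.
Variable R : realType.
Let mu := @lebesgue_measure R.
Let S : set R := `]- (pi / 2), pi / 2[%classic.
Let U : set (R * R) := [set p | p.1 ^+ 2 + p.2 ^+ 2 < 1].

Let UE p : U p <-> unit_disk (p.1 +i* p.2).
Proof.
by rewrite /U /unit_disk /=; have /= <- := sqr_cmod (p.1 +i* p.2); rewrite expr_lt1 ?cmod_ge0.
Qed.

Let cU (p : R * R) : plane_continuous_at (fun q : R * R => cmod (q.1 +i* q.2)) p.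
Proof. exact: (plane_continuous_cmod (cdiff_id _)). Qed.

Let oU p : U p -> exists2 d, 0 < d &
  forall q : R * R, `|q.1 - p.1| < d -> `|q.2 - p.2| < d -> U q.
Proof.
move=> /UE p1; have e0 : 0 < (1 - cmod (p.1 +i* p.2)) / 2 by rewrite divr_gt0 // subr_gt0.
have [d d0 H] := @cU p _ e0; exists d => // q q1 q2; apply/UE.
have := H q q1 q2; rewrite ler_norml => /andP[_].
by move: p1; rewrite /unit_disk /=; lra.
Qed.

Let mU : measurable U. Proof. exact: plane_open_measurable. Qed.

Variables (a : R) (phi F : R[i] -> R[i]).
Hypothesis a1 : -1 < a.
Hypothesis Aphi : forall z, unit_disk z -> exists c, cdiff phi z c.
Hypothesis HF : forall x y, S y -> exists c, cdiff F (x +i* y) c.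
Hypothesis Fphi : forall x y, S y ->
  cmod (F (x +i* y)) ^+ 2 =
  cmod (phi (strip_map (x +i* y))) ^+ 2 * (2 / (ch x + cos y)) `^ (a + 2).

Let f (p : R * R) : R :=
  cmod (phi (p.1 +i* p.2)) ^+ 2 * (1 - cmod (p.1 +i* p.2) ^+ 2) `^ a / pi.

Let f0 p : 0 <= f p.
Proof. by rewrite divr_ge0 ?pi_ge0 // mulr_ge0 ?powR_ge0 ?sqr_ge0. Qed.

Let cf p : U p -> plane_continuous_at f p.
Proof.
move=> /UE Up; have [c pc] := Aphi Up.
apply: plane_continuousM; last by move=> e e0; exists 1 => // q _ _; rewrite subrr normr0 ltW.
apply: plane_continuousM.
  apply: (@plane_continuous_comp _ _ (fun t => t ^+ 2)); first exact: plane_continuous_cmod pc.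
  exact: exprn_continuous.
apply: (@plane_continuous_comp _ _ (fun t => (1 - t ^+ 2) `^ a)); first exact: cU.
apply: (@continuous_comp _ _ _ (fun t : R => 1 - t ^+ 2) (fun t => t `^ a)).
  by apply: cvgB; [exact: cvg_cst|exact: exprn_continuous].
apply: is_derive_continuous (is_derive1_powR a _).
by rewrite subr_gt0 expr_lt1 // cmod_ge0.
Qed.

(** With q = 2 / (cosh x + cos y), the weight times the Jacobian is cos(y)^a q^(a + 2) / 4, whose
    power of q is the one required of [F]. The lemma serves twice with the same [F]: for phi with a
    = alpha, and for g0 phi with a = beta. *)
Lemma bergman_normsq_strip : bergman_normsq a phi =
  (((a + 1) / (4 * pi))%:E * (\int[mu]_(y in S) ((cos y `^ a)%:E * line_mean F y)))%E.
Proof.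
have US : U = [set p : R * R | unit_disk (p.1 +i* p.2)].
  by apply/seteqP; split => p /UE.
rewrite /bergman_normsq -US.
pose h := f \_ U.
have hE : (fun p => (h p)%:E) = (fun p => (f p)%:E) \_ U.
  by apply/funext => p; rewrite /h /patch; case: ifP.
have h_in p : U p -> h p = f p by move=> Up; rewrite /h patchE mem_set.
rewrite [X in (_ * X)%E]integral_mkcond -hE disk_integral_strip; last 4 first.
- by move=> p; rewrite /h patchE; case: ifP.
- apply: (measurable_restrictT _ mU).1.
  by apply: plane_continuous_measurable => // p; exact: cf.
- move=> p Up e e0; have [d d0 H] := cf Up e0; have [d' d'0 H'] := oU Up.
  exists (Num.min d d'); first by rewrite lt_min d0.
  move=> q; rewrite !lt_min => /andP[q1 q1'] /andP[q2 q2'].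
  by rewrite !h_in ?H //; exact: H'.
- by move=> p Up; rewrite /h patchE memNset.
have p0 := pi_gt0 R; have k0 : 0 <= (4 * pi)^-1 :> R by rewrite invr_ge0 mulr_ge0 // ltW.
have m1 : measurable_fun S (fun y => ((cos y `^ a)%:E * line_mean F y)%E).
  apply: emeasurable_funM; last exact: measurable_funTS (measurable_line_mean HF).
  apply/measurable_EFinP; apply: measurable_funTS; apply: (measurableT_comp (measurable_powR _)).
  by apply: continuous_measurable_fun; exact: continuous_cos.
have g0 y : S y -> (0 <= (cos y `^ a)%:E * line_mean F y)%E.
  by move=> _; rewrite mule_ge0 ?line_mean_ge0 // lee_fin powR_ge0.
have mS : measurable S by exact: measurable_itv.
have key : (\int[mu]_(y in S) \int[mu]_x
    (h (strip_re x y, strip_im x y) * (ch x + cos y) ^- 2)%:E =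
  ((4 * pi)^-1)%:E * \int[mu]_(y in S) ((cos y `^ a)%:E * line_mean F y))%E.
  apply: eq_trans (ge0_integralZl_EFin mu mS g0 m1 k0).
  apply: eq_integral => y /set_mem Sy; have c0 := cos_gt0_strip Sy.
  have ms : measurable_fun setT (fun x => (strip_ext F (x, y))%:E).
    by apply/measurable_EFinP; apply: (measurableT_comp (measurable_strip_ext HF)).
  have s0 (x : R) : setT x -> (0 <= (strip_ext F (x, y))%:E)%E.
    by rewrite lee_fin strip_ext_ge0.
  have kc0 : 0 <= (4 * pi)^-1 * cos y `^ a by rewrite mulr_ge0 ?powR_ge0.
  rewrite muleA -EFinM; apply: eq_trans (ge0_integralZl_EFin mu measurableT s0 ms kc0).
  apply: eq_integral => x _; rewrite -EFinM; congr EFin.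
  have D0 := strip_den_gt0 x Sy.
  rewrite strip_extE // Fphi // h_in; last exact: strip_disk.
  have n1 : 1 - cmod (strip_re x y +i* strip_im x y) ^+ 2 = 2 * cos y / (ch x + cos y).
    by rewrite sqr_cmod /= opprD addrA strip_normsq.
  rewrite /f /= n1 strip_mapE //.
  rewrite (_ : 2 * cos y / (ch x + cos y) = cos y * (2 / (ch x + cos y))); last by ring.
  have q0 : 0 < 2 / (ch x + cos y) by rewrite divr_gt0.
  rewrite powRM ?(ltW c0) ?(ltW q0) // [_ `^ (a + 2)]powRD ?(gt_eqF q0) ?implybT //.
  rewrite powR_mulrn ?(ltW q0) //; move: (_ `^ a) (_ `^ a) => A B.
  by move: pi (negbT (gt_eqF p0)) => q qn; field; rewrite qn (gt_eqF D0).
rewrite key muleA -EFinM; congr (_%:E * _)%E.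
Qed.

End BergmanStrip.

(** * The upper bound for the ratio of squared norms *)

Section UpperBound.
Variables (R : realType) (alpha beta : R).
Hypothesis halpha : -1 < alpha.
Hypothesis hbeta : alpha < beta.
Let mu := @lebesgue_measure R.
Let S : set R := `]- (pi / 2), pi / 2[%classic.

Definition multiplier_const : R :=
  (beta + 1) * cos_intR beta / ((alpha + 1) * cos_intR alpha).

Let hbeta1 : -1 < beta. Proof. exact: lt_trans halpha hbeta. Qed.

Let a1 : 0 < alpha + 1. Proof. by rewrite -ltrBlDr sub0r. Qed.
Let b1 : 0 < beta + 1. Proof. by rewrite -ltrBlDr sub0r. Qed.

Lemma multiplier_const_gt0 : 0 < multiplier_const.
Proof.
have Ja := cos_intR_gt0 halpha; have Jb := cos_intR_gt0 hbeta1.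
by rewrite divr_gt0 ?mulr_gt0 ?a1 ?b1.
Qed.

Lemma analytic_cdiff (phi : R[i] -> R[i]) : analytic_on_disk phi ->
  forall z, unit_disk z -> exists c, cdiff phi z c.
Proof. by move=> A z /A; exact: derivable_cdiff. Qed.

Lemma analytic_cpow_1Bsqr (s : R) : analytic_on_disk (fun z : R[i] => cpow (1 - z ^+ 2) s).
Proof. by move=> z /(cdiff_cpow_1Bsqr s)[c]; exact: cdiff_derivable. Qed.

Lemma analytic_mul (f g : R[i] -> R[i]) : analytic_on_disk f -> analytic_on_disk g ->
  analytic_on_disk (fun z => f z * g z).
Proof.
move=> /analytic_cdiff Af /analytic_cdiff Ag z zD.
have [[a fa] [b gb]] := (Af z zD, Ag z zD); exact: cdiff_derivable (cdiffM fa gb).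
Qed.

(* The function of [w] on the strip whose squared line means against
   [cos y `^ alpha] give the norm of [phi] in the Bergman space. *)
Definition strip_lift (phi : R[i] -> R[i]) (w : R[i]) : R[i] :=
  phi (strip_map w) * cpow (1 - strip_map w ^+ 2) ((alpha + 2) / 2).

Lemma cdiff_strip_lift phi : analytic_on_disk phi ->
  forall x y, S y -> exists c, cdiff (strip_lift phi) (x +i* y) c.
Proof.
move=> A x y Sy; have [c mc] := cdiff_strip_map x Sy.
have [d Ad] := analytic_cdiff (analytic_mul A (@analytic_cpow_1Bsqr ((alpha + 2) / 2)))
  (strip_map_disk x Sy).
by eexists; exact: cdiff_comp mc Ad.
Qed.

Lemma cmod_cpow_strip x y (s : R) : S y ->
  cmod (cpow (1 - strip_map (x +i* y) ^+ 2) s) = (2 / (ch x + cos y)) `^ s.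
Proof.
move=> Sy; rewrite cmod_cpow ?cmod_1Bsqr_strip_map //.
exact: Re_gt0_neq0 (Re_1Bsqr (strip_map_disk x Sy)).
Qed.

Let half (t s : R) : 0 < t -> (t `^ (s / 2)) ^+ 2 = t `^ s.
Proof. by move=> t0; rewrite -powR_mulrn ?powR_ge0 // -powRrM divfK. Qed.

Lemma bergman_normsq_lift phi : analytic_on_disk phi ->
  bergman_normsq alpha phi = (((alpha + 1) / (4 * pi))%:E *
    \int[mu]_(y in S) ((cos y `^ alpha)%:E * line_mean (strip_lift phi) y))%E.
Proof.
move=> A; apply: bergman_normsq_strip => //.
- exact: analytic_cdiff.
- exact: cdiff_strip_lift.
- move=> x y Sy; have D0 := strip_den_gt0 x Sy.
  by rewrite cmodM exprMn cmod_cpow_strip // half // divr_gt0.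
Qed.

Lemma bergman_normsq_g0_lift phi : analytic_on_disk phi ->
  bergman_normsq beta (fun z => g0 alpha beta z * phi z) = (((beta + 1) / (4 * pi))%:E *
    \int[mu]_(y in S) ((cos y `^ beta)%:E * line_mean (strip_lift phi) y))%E.
Proof.
move=> A; apply: bergman_normsq_strip => //.
- exact: (analytic_cdiff (analytic_mul (@analytic_cpow_1Bsqr _) A)).
- exact: cdiff_strip_lift.
- move=> x y Sy; have D0 := strip_den_gt0 x Sy.
  have q0 : 0 < 2 / (ch x + cos y) by rewrite divr_gt0.
  rewrite /strip_lift /g0 cmodM [in RHS]cmodM ![(cmod _ * _) ^+ 2]exprMn !cmod_cpow_strip // -mulNr !half //.
  rewrite [RHS]mulrAC -powRD ?(gt_eqF q0) ?implybT // mulrC.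
  by congr (_ `^ _ * _); ring.
Qed.

Lemma bergman_normsq_g0_le phi : bergman_space alpha phi ->
  (bergman_normsq beta (fun z => g0 alpha beta z * phi z)%R <=
   multiplier_const%:E * bergman_normsq alpha phi)%E.
Proof.
case=> A; rewrite bergman_normsq_g0_lift // bergman_normsq_lift //.
set X := (\int[mu]_(y in S) ((cos y `^ alpha)%:E * _))%E => finX.
have Ja := cos_intR_gt0 halpha; have Jb := cos_intR_gt0 hbeta1.
have p0 := pi_gt0 R.
have X0 : (0 <= X)%E.
  by apply: integral_ge0 => y _; rewrite mule_ge0 ?line_mean_ge0 // lee_fin powR_ge0.
have ca : 0 < (alpha + 1) / (4 * pi) by rewrite divr_gt0 ?mulr_gt0 ?a1 ?b1.
have cb : 0 < (beta + 1) / (4 * pi) by rewrite divr_gt0 ?mulr_gt0 ?a1 ?b1.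
have finX' : (X < +oo)%E.
  move: finX X0; case: X => [x||] // ; by rewrite ?ltry // gt0_muley ?lte_fin.
have F := cdiff_strip_lift A.
have H : (\int[mu]_(y in S) ((cos y `^ beta)%:E * line_mean (strip_lift phi) y) <=
   (cos_intR beta / cos_intR alpha)%:E * X)%E.
  apply: symmetric_chebyshev => //.
  - move=> y; exact: line_mean_ge0.
  - exact: measurable_line_mean.
  - move=> y h h0 Sl Sr fin; apply: line_mean_midpoint => //.
    by rewrite ge0_integral_sym_sum //; [exact: measurable_line_mean|move=> z; exact: line_mean_ge0].
  - exact: cos_intRE.
  - exact: cos_intRE.
apply: (@le_trans _ _ (((beta + 1) / (4 * pi))%:E * ((cos_intR beta / cos_intR alpha)%:E * X))%E).
  by rewrite lee_pmul2l.
rewrite !muleA -!EFinM le_eqVlt; apply/orP; left; apply/eqP; congr (_%:E * _)%E.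
rewrite /multiplier_const.
have := gt_eqF Ja; have := gt_eqF a1; have := gt_eqF p0.
by move: pi (cos_intR alpha) (alpha + 1) => p J c p1 c1 J1; field; rewrite p1 c1 J1.
Qed.

End UpperBound.

(** * Test functions and the multiplier norm *)

Section TestFunctions.
Variables (R : realType) (alpha beta : R).
Hypothesis halpha : -1 < alpha.
Hypothesis hbeta : alpha < beta.
Let mu := @lebesgue_measure R.
Let S : set R := `]- (pi / 2), pi / 2[%classic.

Lemma sh_surj (t : R) : exists x, sh x = t.
Proof.
pose r := Num.sqrt (1 + t ^+ 2).
have r2 : r ^+ 2 = 1 + t ^+ 2 by rewrite sqr_sqrtr // addr_ge0 // sqr_ge0.
have r0 : 0 <= r by exact: sqrtr_ge0.
have u0 : 0 < t + r by nra.
exists (ln (t + r)); rewrite /sh expRN lnK ?posrE //.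
apply: (mulIf (lt0r_neq0 u0)).
rewrite (_ : _ * (t + r) = ((t + r) ^+ 2 - 1) / 2); last by field; exact: lt0r_neq0.
by rewrite sqrrD r2; field.
Qed.

(** The Gudermannian substitution y = atan (sinh x), under which cos y = 1 / cosh x and dy = dx /
    cosh x. *)
Lemma ch_int (e : R) : (\int[mu]_x ((ch x)^-1 `^ e)%:E = cos_int (e - 1))%E.
Proof.
have ch0 x : 0 < ch x :> R by exact: lt_le_trans ltr01 (ch_ge1 x).
have cosE x : cos (atan (sh x)) = (ch x)^-1 :> R.
  rewrite cos_atan (_ : 1 + sh x ^+ 2 = ch x ^+ 2); last by rewrite -(ch2Bsh2 x); ring.
  by rewrite sqrtr_sqr gtr0_norm.
apply/esym; etransitivity.
  apply: (@ge0_integration_by_substitution_setT _ S (fun x => atan (sh x)) (fun x => (ch x)^-1)).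
  - exact: interval_open.
  - move=> x; have d1 := is_derive_sh x; have d2 := is_derive1_atan (sh x).
    have := is_derive1_comp d2 d1; rewrite (_ : _ * _ = (ch x)^-1) //.
    rewrite (_ : 1 + sh x ^+ 2 = ch x ^+ 2); last by rewrite -(ch2Bsh2 x); ring.
    by field; exact: lt0r_neq0.
  - move=> x; apply: cvgV; first exact: lt0r_neq0.
    exact: is_derive_continuous (is_derive_ch x).
  - by move=> x; rewrite invr_gt0.
  - by move=> x; rewrite /S /= in_itv /= atan_gtNpi2 atan_ltpi2.
  - by move=> y Sy; have [x xy] := sh_surj (tan y); exists x; rewrite xy tanK.
  - move=> y Sy; apply: (@continuous_comp _ _ _ (@cos R) (fun t => t `^ (e - 1))).
      exact: continuous_cos.
    exact: is_derive_continuous (is_derive1_powR (e - 1) (cos_gt0_strip Sy)).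
  - by move=> y _; rewrite powR_ge0.
apply: eq_integral => x _; congr EFin; rewrite cosE.
have i0 : 0 < (ch x)^-1 by rewrite invr_gt0.
rewrite -[X in _ * X]powRr1 ?(ltW i0) // -powRD ?(gt_eqF i0) ?implybT //.
by rewrite subrK.
Qed.

Variable e : R.
Hypothesis e0 : 0 < e.

(** The exponent is such that the lift has squared modulus (2 / (cosh x + cos y))^e; e > 0 makes its
    integral over each horizontal line converge. *)
Definition test_function (z : R[i]) : R[i] := cpow (1 - z ^+ 2) ((e - (alpha + 2)) / 2).

Let A : analytic_on_disk test_function. Proof. exact: analytic_cpow_1Bsqr. Qed.

Let I : R := cos_intR (e - 1).
Let e1 : -1 < e - 1. Proof. by rewrite ltrBrDr addNr. Qed.
Let I0 : 0 < I. Proof. exact: cos_intR_gt0. Qed.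
Let IE : (\int[mu]_x ((ch x)^-1 `^ e)%:E = I%:E)%E.
Proof. by rewrite ch_int cos_intRE. Qed.

Let lift_sq x y : S y ->
  strip_ext (strip_lift alpha test_function) (x, y) = (2 / (ch x + cos y)) `^ e.
Proof.
move=> Sy; have D0 := strip_den_gt0 x Sy; have q0 : 0 < 2 / (ch x + cos y) by rewrite divr_gt0.
rewrite strip_extE // /strip_lift /test_function cmodM !cmod_cpow_strip //.
rewrite -powRD ?(gt_eqF q0) ?implybT // -powR_mulrn ?powR_ge0 // -powRrM.
by congr (_ `^ _); field.
Qed.

Let m_ch : measurable_fun setT (fun x : R => ((ch x)^-1 `^ e)%:E).
Proof.
apply/measurable_EFinP; apply: (measurableT_comp (measurable_powR _)).
apply: measurable_fun_inv; apply: continuous_measurable_fun => x.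
exact: is_derive_continuous (is_derive_ch x).
Qed.

Let m_lift y : measurable_fun setT
  (fun x : R => (strip_ext (strip_lift alpha test_function) (x, y))%:E).
Proof.
have ms := measurable_strip_ext (@cdiff_strip_lift _ alpha _ A).
by apply/measurable_EFinP; apply: (measurableT_comp ms).
Qed.

(** As 0 < cos y <= 1 <= cosh x, the base 2 / (cosh x + cos y) lies between 1 / cosh x and 2 / cosh
    x. This bound and [line_lift_le] thus differ by the factor 2^e only. *)
Let line_lift_ge y : S y -> (I%:E <= line_mean (strip_lift alpha test_function) y)%E.
Proof.
move=> Sy; rewrite -IE; apply: ge0_le_integral => //.
- by move=> x _; rewrite lee_fin powR_ge0.
- exact: m_lift.
- move=> x _; rewrite lee_fin lift_sq //; have D0 := strip_den_gt0 x Sy.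
  have c1 := ch_ge1 x; have c0 := lt_le_trans ltr01 c1.
  apply: ge0_ler_powR; rewrite ?nnegrE ?(ltW e0) ?invr_ge0 ?divr_ge0 ?(ltW c0) ?(ltW D0) //.
  rewrite ler_pdivlMr // mulrC ler_pdivrMr //.
  by have := cos_le1 y; lra.
Qed.

Let line_lift_le y : S y ->
  (line_mean (strip_lift alpha test_function) y <= (2 `^ e * I)%:E)%E.
Proof.
move=> Sy; have p0 : 0 <= 2 `^ e by exact: powR_ge0.
have g0 (x : R) : setT x -> (0 <= ((ch x)^-1 `^ e)%:E)%E by rewrite lee_fin powR_ge0.
rewrite EFinM -IE -(ge0_integralZl_EFin mu measurableT g0 m_ch p0).
apply: ge0_le_integral => //.
- by move=> x _; rewrite lee_fin strip_ext_ge0.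
- exact: m_lift.
- by apply: emeasurable_funM; [exact: measurable_cst|exact: m_ch].
- move=> x _; rewrite -EFinM lee_fin lift_sq //; have D0 := strip_den_gt0 x Sy.
  have c1 := ch_ge1 x; have c0 := lt_le_trans ltr01 c1.
  rewrite -powRM ?invr_ge0 ?(ltW c0) //.
  apply: ge0_ler_powR; rewrite ?nnegrE ?mulr_ge0 ?(ltW e0) ?invr_ge0 ?(ltW c0) ?(ltW D0) //.
  by rewrite ler_pM2l // lef_pV2 ?posrE // lerDl ltW // cos_gt0_strip.
Qed.

Let mcos (a : R) : measurable_fun S (fun y : R => (cos y `^ a)%:E).
Proof.
apply/measurable_EFinP; apply: measurable_funTS; apply: (measurableT_comp (measurable_powR _)).
by apply: continuous_measurable_fun; exact: continuous_cos.
Qed.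

Let mS : measurable S. Proof. exact: measurable_itv. Qed.

Let mline : measurable_fun S (line_mean (strip_lift alpha test_function)).
Proof. exact: measurable_funTS (measurable_line_mean (@cdiff_strip_lift _ alpha _ A)). Qed.

Let cos0 (a y : R) : S y -> (0 <= (cos y `^ a)%:E)%E.
Proof. by rewrite lee_fin powR_ge0. Qed.

Let eq_lee (x y : \bar R) : x = y -> (x <= y)%E. Proof. by move->. Qed.

Let int_ge (a : R) : -1 < a -> ((I * cos_intR a)%:E <=
  \int[mu]_(y in S) ((cos y `^ a)%:E * line_mean (strip_lift alpha test_function) y))%E.
Proof.
move=> a1; have eI := ge0_integralZl_EFin mu mS (@cos0 a) (@mcos a) (ltW I0).
rewrite EFinM -(cos_intRE a1); apply: (le_trans (eq_lee (esym eI))).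
apply: ge0_le_integral => //.
- by move=> y _; rewrite mule_ge0 ?lee_fin ?powR_ge0 ?(ltW I0).
- by apply: emeasurable_funM; [exact: measurable_cst|exact: mcos].
- by apply: emeasurable_funM; [exact: mcos|exact: mline].
- by move=> y Sy; rewrite muleC lee_wpmul2l ?lee_fin ?powR_ge0 // line_lift_ge.
Qed.

Let int_le (a : R) : -1 < a ->
  (\int[mu]_(y in S) ((cos y `^ a)%:E * line_mean (strip_lift alpha test_function) y) <=
   (2 `^ e * I * cos_intR a)%:E)%E.
Proof.
move=> a1; have k0 : 0 <= 2 `^ e * I by rewrite mulr_ge0 ?powR_ge0 // ltW.
have eI := ge0_integralZl_EFin mu mS (@cos0 a) (@mcos a) k0.
rewrite EFinM -(cos_intRE a1); apply: le_trans (eq_lee eI).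
apply: ge0_le_integral => //.
- by move=> y _; rewrite mule_ge0 ?line_mean_ge0 // lee_fin powR_ge0.
- by apply: emeasurable_funM; [exact: mcos|exact: mline].
- by apply: emeasurable_funM; [exact: measurable_cst|exact: mcos].
- by move=> y Sy; rewrite muleC lee_wpmul2r ?lee_fin ?powR_ge0 // line_lift_le.
Qed.

Let ka0 : 0 < (alpha + 1) / (4 * pi).
Proof. by rewrite divr_gt0 ?mulr_gt0 ?pi_gt0 // -ltrBlDr sub0r. Qed.

Lemma bergman_space_test : bergman_space alpha test_function.
Proof.
split => //; rewrite bergman_normsq_lift //.
have k0 := ltW ka0.
apply: (@le_lt_trans _ _ (((alpha + 1) / (4 * pi))%:E * (2 `^ e * I * cos_intR alpha)%:E)%E).
  by rewrite lee_wpmul2l ?lee_fin // int_le.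
by rewrite -EFinM ltry.
Qed.

Lemma bergman_normsq_test_gt0 : (0 < bergman_normsq alpha test_function)%E.
Proof.
rewrite bergman_normsq_lift // mule_gt0 //.
by apply: lt_le_trans (int_ge halpha); rewrite lte_fin mulr_gt0 ?cos_intR_gt0.
Qed.

Lemma bergman_normsq_test_ge :
  ((2 `^ (- e) * multiplier_const alpha beta)%:E * bergman_normsq alpha test_function <=
   bergman_normsq beta (fun z => g0 alpha beta z * test_function z)%R)%E.
Proof.
have b1 : -1 < beta by exact: lt_trans hbeta.
have Ja := cos_intR_gt0 halpha; have Jb := cos_intR_gt0 b1.
have p0 := pi_gt0 R.
have a1 : 0 < alpha + 1 by rewrite -ltrBlDr sub0r.
have b10 : 0 < beta + 1 by rewrite -ltrBlDr sub0r.
have kb : 0 <= (beta + 1) / (4 * pi) by rewrite divr_ge0 ?mulr_ge0 ?(ltW p0) ?(ltW b10).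
have ka : 0 <= (alpha + 1) / (4 * pi) by rewrite divr_ge0 ?mulr_ge0 ?(ltW p0) ?(ltW a1).
rewrite bergman_normsq_lift // bergman_normsq_g0_lift //.
(* The line means are bounded below in the norm for beta and above in the norm for alpha, which
   loses exactly 2^e. *)
apply: (@le_trans _ _ (((beta + 1) / (4 * pi))%:E * (I * cos_intR beta)%:E)%E); last first.
  by apply: lee_wpmul2l; [rewrite lee_fin|exact: int_ge].
apply: (@le_trans _ _ ((2 `^ (- e) * multiplier_const alpha beta)%:E *
    (((alpha + 1) / (4 * pi))%:E * (2 `^ e * I * cos_intR alpha)%:E))%E).
  apply: lee_wpmul2l; first by rewrite lee_fin mulr_ge0 ?powR_ge0 ?ltW ?multiplier_const_gt0.
  by apply: lee_wpmul2l; [rewrite lee_fin|exact: int_le].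
rewrite -!EFinM lee_fin le_eqVlt; apply/orP; left; apply/eqP.
have n2 : 2 `^ e != 0 :> R by rewrite gt_eqF // powR_gt0.
rewrite /multiplier_const powRN; move: (2 `^ e) n2 => P P0.
move: pi (cos_intR alpha) (alpha + 1) (gt_eqF p0) (gt_eqF Ja) (gt_eqF a1) => p J c p1 J1 c1.
by field; rewrite P0 p1 J1 c1.
Qed.

Lemma test_function_neq0 : test_function 0 != 0.
Proof. by rewrite -cmod_gt0 /test_function expr0n /= subr0 cmod_cpow ?oner_neq0 // cmod1 powR1. Qed.

End TestFunctions.

(** * The supremum and its closed form *)

Section MultiplierNorm.
Variables (R : realType) (alpha beta : R).
Hypothesis halpha : -1 < alpha.
Hypothesis hbeta : alpha < beta.
Let K : R := multiplier_const alpha beta.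
Let K0 : 0 < K. Proof. exact: multiplier_const_gt0. Qed.

Lemma bergman_normsq_ge0 (a : R) (phi : R[i] -> R[i]) : -1 < a ->
  (0 <= bergman_normsq a phi)%E.
Proof.
move=> a1; rewrite /bergman_normsq mule_ge0 //; first by rewrite lee_fin -lerBlDr sub0r ltW.
apply: integral_ge0 => p _.
by rewrite lee_fin divr_ge0 ?pi_ge0 // mulr_ge0 ?powR_ge0 ?sqr_ge0.
Qed.

Lemma bergman_norm_g0_le phi : bergman_space alpha phi ->
  (bergman_norm beta (fun z => g0 alpha beta z * phi z)%R <=
   (Num.sqrt K)%:E * bergman_norm alpha phi)%E.
Proof.
move=> Bphi; have Kn : (0 <= K%:E)%E by rewrite lee_fin ltW.
rewrite (_ : (Num.sqrt K)%:E = sqrte K%:E) // -sqrteM // lee_sqrt.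
  exact: bergman_normsq_g0_le.
by rewrite mule_ge0 // bergman_normsq_ge0.
Qed.

Let sqrte_lty (x : \bar R) : (x < +oo)%E -> (sqrte x < +oo)%E.
Proof. by case: x => [x||] //= _; rewrite ltry. Qed.

Lemma is_multiplier_g0 : is_multiplier alpha beta (g0 alpha beta).
Proof.
split; first exact: analytic_cpow_1Bsqr.
exists (Num.sqrt K) => phi Bphi; split; last exact: bergman_norm_g0_le.
have [A fin] := Bphi; split; first exact: analytic_mul (@analytic_cpow_1Bsqr _ _) A.
apply: le_lt_trans (bergman_normsq_g0_le halpha hbeta Bphi) _.
by rewrite lte_mul_pinfty // lee_fin ltW.
Qed.

Lemma multiplier_norm_g0 : multiplier_norm alpha beta (g0 alpha beta) = (Num.sqrt K)%:E.
Proof.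
have sK : 0 < Num.sqrt K by rewrite sqrtr_gt0.
apply/eqP; rewrite eq_le; apply/andP; split.
  apply: ge_ereal_sup => _ [phi [Bphi _] <-].
  have := bergman_norm_g0_le Bphi; have [_ fin] := Bphi.
  have : (bergman_norm alpha phi < +oo)%E by exact: sqrte_lty.
  have := sqrte_ge0 (bergman_normsq alpha phi); rewrite -/(bergman_norm alpha phi).
  case: (bergman_norm alpha phi) => [n||] // n0 _.
  (* A zero denominator forces a zero numerator by the bound just proved, so the quotient is 0
     whatever the inverse of 0 is. *)
  have [->|nN0] := eqVneq n 0.
    rewrite mule0 => h; have -> : bergman_norm beta (fun z => g0 alpha beta z * phi z) = 0%E.
      by apply/eqP; rewrite eq_le h sqrte_ge0.
    by rewrite mul0e lee_fin ltW.
  have np : 0 < n by rewrite lt_neqAle eq_sym nN0 -lee_fin.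
  by rewrite inver (negPf nN0) lee_pdivrMr.
apply/lee_mul01Pr; first by rewrite lee_fin ltW.
(* Chosen so that 2^(-e) = r^2: the test function then reaches a quotient of norms at least r sqrt
   K. *)
move=> r /andP[r0 r1]; pose e : R := - 2 * ln r / ln 2.
have l2 : 0 < ln 2 :> R by rewrite ln_gt0 // ltr1n.
have lr : ln r < 0 by rewrite ln_lt0 // r0.
have e0 : 0 < e by rewrite divr_gt0 // nmulr_rgt0 // oppr_lt0.
have rE : 2 `^ (- e) = r ^+ 2.
  rewrite /powR pnatr_eq0 /= /e -[RHS]lnK ?posrE ?exprn_gt0 // lnXn //.
  by congr expR; field; rewrite gt_eqF.
have Bt := bergman_space_test halpha e0.
have Xgt := bergman_normsq_test_gt0 halpha e0.
have Xge := bergman_normsq_test_ge halpha hbeta e0.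
set phi := test_function alpha e in Bt Xgt Xge.
have Sup : (bergman_norm beta (fun z => g0 alpha beta z * phi z)%R / bergman_norm alpha phi <=
    multiplier_norm alpha beta (g0 alpha beta))%E.
  apply: ereal_sup_ubound; exists phi => //; split => //.
  by exists 0; [rewrite /unit_disk /= cmod0|exact: test_function_neq0].
apply: le_trans Sup.
have [_ fin] := Bt; have Kn : (0 <= (2 `^ (- e) * K)%:E)%E.
  by rewrite lee_fin mulr_ge0 ?powR_ge0 // ltW.
have : ((r * Num.sqrt K)%:E * bergman_norm alpha phi <=
        bergman_norm beta (fun z => g0 alpha beta z * phi z)%R)%E.
  rewrite (_ : (r * Num.sqrt K)%:E = sqrte (2 `^ (- e) * K)%:E); last first.
    by rewrite rE /sqrte (@sqrtrM _ (r ^+ 2) K (sqr_ge0 r)) sqrtr_sqr gtr0_norm.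
  rewrite -sqrteM // lee_sqrt //.
  by rewrite bergman_normsq_ge0 // (lt_trans halpha).
have : (0 < bergman_norm alpha phi)%E.
  rewrite lt_neqAle sqrte_ge0 andbT eq_sym; apply/eqP => h.
  move: (Xgt); rewrite -(sqr_sqrte (ltW Xgt)); rewrite /bergman_norm in h.
  by rewrite h expe2 mule0 ltxx.
have : (bergman_norm alpha phi < +oo)%E by exact: sqrte_lty.
case: (bergman_norm alpha phi) => [n||] // _ n0.
by rewrite inver gt_eqF // -EFinM lee_pdivlMr.
Qed.

Lemma multiplier_const_Gamma : K =
  (2 `^ (beta - alpha))^-1 * (Gamma (beta + 2) / Gamma (alpha + 2))
     * (Gamma (1 + alpha / 2) / Gamma (1 + beta / 2)) ^+ 2.
Proof.
have hb : -1 < beta := lt_trans halpha hbeta.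
have a1 : 0 < alpha + 1 by rewrite -ltrBlDr sub0r.
have b1 : 0 < beta + 1 by rewrite -ltrBlDr sub0r.
have Gsq (x : R) : -1 < x ->
  Gamma (1 + x / 2) ^+ 2 = Gamma (x + 2) * (2 `^ (- 1 - x) * cos_intR (x + 1)).
  move=> x1; rewrite Gamma_sqr_cos_int; last by lra.
  rewrite (_ : 2 * (1 + x / 2) = x + 2); last by field.
  by rewrite (_ : 1 - (x + 2) = - 1 - x) 1?(_ : x + 2 - 1 = x + 1) //; ring.
have G2 (x : R) : -1 < x -> 0 < Gamma (x + 2) by move=> x1; apply: Gamma_gt0; lra.
have J (x : R) : -1 < x -> 0 < cos_intR x /\ 0 < cos_intR (x + 1).
  by move=> x1; split; apply: cos_intR_gt0 => //; lra.
have [[Ja Ja1] [Jb Jb1]] := (J _ halpha, J _ hb).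
rewrite expr_div_n !Gsq // /K /multiplier_const.
(* Aligns the powers of two that [Gsq] produces at alpha and at beta; their quotient cancels the
   prefactor of the statement. *)
have -> : 2 `^ (- 1 - alpha) = 2 `^ (- 1 - beta) * 2 `^ (beta - alpha).
  by rewrite -powRD ?pnatr_eq0 ?implybT //; congr (_ `^ _); ring.
have P1 : 0 < 2 `^ (- 1 - beta) :> R by exact: powR_gt0.
have P2 : 0 < 2 `^ (beta - alpha) :> R by exact: powR_gt0.
have := cos_intR_prod hb halpha.
move: (2 `^ _) (2 `^ _) P1 P2 (Gamma (alpha + 2)) (Gamma (beta + 2)) (G2 _ halpha) (G2 _ hb).
move=> p q p0 q0 g h gp hp prod.
(* Every Gamma value cancels, and [prod] identifies the remaining quotient with [K]. *)
rewrite [RHS](_ : _ = cos_intR (alpha + 1) / cos_intR (beta + 1)); last first.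
  by field; rewrite ?gt_eqF.
move: (cos_intR alpha) (cos_intR beta) (cos_intR (alpha + 1)) (cos_intR (beta + 1))
  (alpha + 1) (beta + 1) Ja Jb Ja1 Jb1 a1 b1 prod => A B A1 B1 a b A0 B0 A10 B10 a0 b0 prod.
apply: (canLR (mulfK _)); first by rewrite gt_eqF // mulr_gt0.
by rewrite mulrAC; apply: (canRL (mulfK _)); rewrite ?gt_eqF // prod mulrC.
Qed.

End MultiplierNorm.

Theorem theorem1p8 (R : realType) (alpha beta : R)
    (halpha : - 1 < alpha) (hbeta : alpha < beta) :
  is_multiplier alpha beta (g0 alpha beta) /\
  (multiplier_norm alpha beta (g0 alpha beta) ^+ 2)%E =
  ((2 `^ (beta - alpha))^-1 * (Gamma (beta + 2) / Gamma (alpha + 2))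
     * (Gamma (1 + alpha / 2) / Gamma (1 + beta / 2)) ^+ 2)%:E.
Proof.
split; first exact: is_multiplier_g0.
rewrite multiplier_norm_g0 // expe2 -EFinM -expr2 sqr_sqrtr.
  by rewrite multiplier_const_Gamma.
exact: ltW (multiplier_const_gt0 _ _).
Qed.
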